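(* Let $f^0\in\mathcal P(\triangle)$ be a probability density with a product form, i.e. $f^0=\exp(\ell^0-\mathrm a_0)\mathbf 1_\triangle$ with $\ell^0=\sum_{i=1}^d\ell^0_{[i]}$, where the $\ell^0_i$ are bounded measurable functions on $I$ with $\int_I\ell^0_i q_i=0$ and $\mathrm a_0=\log\int_\triangle e^{\ell^0}$. Assume that $\ell^0_i\in W^2_{r_i}(q_i)$ with $r_i\in\mathbb N$ and $r_i>d$, for all $1\le i\le d$. Let $(X^n,n\in\mathbb N^* )$ be i.i.d. random variables with density $f^0$. Consider a sequence $(m(n)=(m_1(n),\dots,m_d(n)),\,n\in\mathbb N^* )$ in $(\mathbb N^* )^d$ such that $\lim_{n\to\infty}m_i(n)=+\infty$ for all $1\le i\le d$ and, writing $m=m(n)$ and $|m|=\sum_{i=1}^d m_i$, $$\lim_{n\to\infty}|m|^{2d}\Big(\sum_{i=1}^d m_i^{-2r_i}\Big)=0\qquad\text{and}\qquad \lim_{n\to\infty}\frac{|m|^{2d+1}}{n}=0.$$ Then the Kullback-Leibler distance from $f^0$ to the maximum likelihood estimator $\hat f_{m,n}$ converges in probability to $0$ with the rate $$D(f^0\|\hat f_{m,n})=O_{\mathbb P}\Big(\sum_{i=1}^d m_i^{-2r_i}+\frac{|m|}{n}\Big).$$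
   Context: Let $d\ge 2$, $I=[0,1]$, $\triangle=\{(x_1,\dots,x_d)\in I^d: x_1\le x_2\le\dots\le x_d\}$, $\mathbb N=\{0,1,2,\dots\}$, $\mathbb N^*=\mathbb N\setminus\{0\}$. $\mathcal P(\triangle)$ is the set of probability densities on $\triangle$ (w.r.t. Lebesgue measure), and for $g,h\in\mathcal P(\triangle)$, $D(g\|h)=\int_\triangle g\log(g/h)\in[0,+\infty]$. For a real function $h_i$ on $I$, $h_{[i]}(x)=h_i(x_i)\mathbf 1_\triangle(x)$. The one-dimensional marginals of Lebesgue measure on $\triangle$ are $q_i(dt)=\frac{1}{(d-i)!(i-1)!}(1-t)^{d-i}t^{i-1}\mathbf 1_I(t)\,dt$, $1\le i\le d$ ($q_i$ also denotes the density). Sobolev space: for $r\in\mathbb N^*$, $W^2_r(q_i)=\{h\in L^2(q_i): h^{(r-1)}\text{ is absolutely continuous and }h^{(r)}\in L^2(q_i)\}$. Basis: $P_k^{(\alpha,\beta)}(t)=\frac{(-1)^k}{2^kk!\,w_{\alpha,\beta}(t)}\frac{d^k}{dt^k}[w_{\alpha,\beta}(t)(1-t^2)^k]$ with $w_{\alpha,\beta}(t)=(1-t)^\alpha(1+t)^\beta$ are the Jacobi polynomials, and $\varphi_{i,k}(t)=\rho_{i,k}\sqrt{(d-i)!(i-1)!}\,P_k^{(d-i,i-1)}(2t-1)$ for $t\in I$, $\rho_{i,k}=\sqrt{(2k+d)\,k!\,(k+d-1)!/((k+d-i)!(k+i-1)!)}$. The polynomial $\varphi_{i,k}$ has degree $k$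 and $(\varphi_{i,k},k\in\mathbb N)$ is orthonormal in $L^2(q_i)$. Model: for $m\in(\mathbb N^* )^d$, $|m|=\sum_i m_i$, $\varphi_m=(\varphi_{[i],k};1\le k\le m_i,1\le i\le d)$ is $\mathbb R^{|m|}$-valued. For $\theta\in\mathbb R^{|m|}$, $\theta\cdot\varphi_m=\sum_{i=1}^d\sum_{k=1}^{m_i}\theta_{i,k}\varphi_{[i],k}$, $\psi(\theta)=\log\int_\triangle\exp(\theta\cdot\varphi_m)$ and $f_\theta=\exp(\theta\cdot\varphi_m-\psi(\theta))\mathbf 1_\triangle$. The map $A_m(\theta)=\int_\triangle\varphi_m f_\theta$ is one-to-one from $\mathbb R^{|m|}$ onto $\Omega_m=A_m(\mathbb R^{|m|})$, with inverse $\Theta_m$. Estimator: $\hat\mu_{m,n}=\frac1n\sum_{j=1}^n\varphi_m(X^j)$, $\hat\theta_{m,n}=\Theta_m(\hat\mu_{m,n})$ (defined when $\hat\mu_{m,n}\in\Omega_m$), and $\hat f_{m,n}=f_{\hat\theta_{m,n}}$. If $\hat\mu_{m,n}\notin\Omega_m$, $\hat\theta_{m,n}$ is an arbitrary (fixed) element of $\mathbb R^{|m|}$. $Y_n=O_{\mathbb P}(a_n)$, for a positive sequence $(a_n)$, means: for every $\varepsilon>0$ there is $C_\varepsilon>0$ such that $\mathbb P(|Y_n/a_n|>C_\varepsilon)<\varepsilon$ for all $n$. *)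

(* Defs.v *)
From HB Require Import structures.
From mathcomp Require Import all_boot all_order all_algebra.
From mathcomp Require Import all_classical all_reals all_analysis.

Set Implicit Arguments.
Unset Strict Implicit.
Unset Printing Implicit Defensive.

Import Order.TTheory GRing.Theory Num.Theory.
Import numFieldNormedType.Exports.

Local Open Scope classical_set_scope.
Local Open Scope ring_scope.

(* Lebesgue measure on R^n (n.-tuple R with its product sigma-algebra),
   by induction on n: the image of the product of Lebesgue measure on R and
   of Lebesgue measure on R^n under (t, x) |-> t :: x. *)
Section lebesgue_tuple.
Context {R : realType}.

Definition tcons n (p : measurableTypeR R * n.-tuple R) : n.+1.-tuple R :=
  [tuple of p.1 :: p.2].

Lemma measurable_tcons n : measurable_fun [set: _] (@tcons n).
Proof. by apply: measurable_cons; [exact: measurable_fst|exact: measurable_snd]. Qed.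

Section step.
Context (n : nat) (mu : {sigma_finite_measure set (n.-tuple R) -> \bar R}).

Definition lebesgue_tcons : set (n.+1.-tuple R) -> \bar R :=
  pushforward (@lebesgue_measure R \x mu)%E (@tcons n).

Let lebesgue_tcons0 : lebesgue_tcons set0 = 0%E.
Proof. by rewrite /lebesgue_tcons /pushforward preimage_set0 measure0. Qed.

Let lebesgue_tcons_ge0 A : (0 <= lebesgue_tcons A)%E.
Proof. by rewrite /lebesgue_tcons /pushforward; exact: measure_ge0. Qed.

Let lebesgue_tcons_sigma_additive : semi_sigma_additive lebesgue_tcons.
Proof.
have mt := @measurable_tcons n.
move=> F mF tF mUF; rewrite /lebesgue_tcons /pushforward preimage_bigcup.
apply: measure_semi_sigma_additive.
- by move=> k; rewrite -[X in measurable X]setTI; exact: mt.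
- apply/trivIsetP => /= i j _ _ ij; rewrite -preimage_setI.
  by move/trivIsetP : tF => /(_ _ _ _ _ ij) ->//; rewrite preimage_set0.
- by rewrite -preimage_bigcup -[X in measurable X]setTI; exact: mt.
Qed.

HB.instance Definition _ := isMeasure.Build _ _ _ lebesgue_tcons
  lebesgue_tcons0 lebesgue_tcons_ge0 lebesgue_tcons_sigma_additive.

Let lebesgue_tcons_sigma_finite : sigma_finite setT lebesgue_tcons.
Proof.
pose u (x : n.+1.-tuple R) : measurableTypeR R * n.-tuple R :=
  (thead x, [tuple of behead x]).
have mu_ : measurable_fun [set: _] u.
  apply/measurable_fun_pairP; split; first exact: measurable_tnth.
  exact: measurable_behead.
have uK x : u (tcons x) = x.
  by case: x => t x; rewrite /u /tcons theadE; congr pair; exact/val_inj.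
have /sigma_finiteP[F [TF ndF Foo]] := sigma_finiteT (@lebesgue_measure R).
have /sigma_finiteP[G [TG ndG Goo]] := sigma_finiteT mu.
have mFG k : measurable (F k `*` G k).
  by apply: measurableX; [exact: (Foo k).1|exact: (Goo k).1].
exists (fun k => u @^-1` (F k `*` G k)).
  rewrite -preimage_bigcup -[LHS](preimage_setT u); congr (_ @^-1` _).
  rewrite -setXTT TF TG predeqE => -[x y]; split.
    move=> [/= [k _ Fkx] [l _ Gly]]; exists (maxn k l) => //; split.
    - by move: x Fkx; exact/subsetPset/ndF/leq_maxl.
    - by move: y Gly; exact/subsetPset/ndG/leq_maxr.
  by move=> [k _ []/= ? ?]; split; exists k.
move=> k; have [? ?] := Foo k; have [? ?] := Goo k; split.
  by rewrite -[X in measurable X]setTI; exact: mu_.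
rewrite /lebesgue_tcons /pushforward (_ : _ @^-1` _ = F k `*` G k).
  by rewrite product_measure1E// lte_mul_pinfty// ge0_fin_numE.
by apply/seteqP; split => x; rewrite /preimage /mkset uK.
Qed.

HB.instance Definition _ := Measure_isSigmaFinite.Build _ _ _ lebesgue_tcons
  lebesgue_tcons_sigma_finite.

End step.

Fixpoint lebesgue_tuple n : {sigma_finite_measure set (n.-tuple R) -> \bar R} :=
  match n with
  | 0 => [the {sigma_finite_measure set (0.-tuple R) -> \bar R} of
          dirac [tuple]]
  | k.+1 => [the {sigma_finite_measure set (k.+1.-tuple R) -> \bar R} of
          lebesgue_tcons (lebesgue_tuple k)]
  end.

Lemma lebesgue_tuple_prod n (A : 'I_n -> set R) :
  (forall i, measurable (A i)) ->
  lebesgue_tuple n [set x | forall i, A i (tnth x i)] =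
  (\prod_(i < n) @lebesgue_measure R (A i))%E.
Proof.
elim: n A => [|n ih] A mA.
  by rewrite /= diracE big_ord0 mem_set// => -[].
pose A' := [set x : n.-tuple R | forall i : 'I_n, A (lift ord0 i) (tnth x i)].
have mA' : measurable A'.
  have -> : A' = \bigcap_i ((@tnth n R ^~ i) @^-1` A (lift ord0 i)).
    by apply/seteqP; split => [x xA i _|x xA i]; exact: xA.
  apply: fin_bigcap_measurable => // i _.
  by rewrite -[X in measurable X]setTI; exact: measurable_tnth.
rewrite big_ord_recl -ih// -product_measure1E//.
rewrite /= /lebesgue_tcons /pushforward; congr ((_ \x _)%E _).
apply/seteqP; split => [[t x]/= H|[t x]/= [At Ax] i].
  split; first by have := H ord0; rewrite tnth0.
  by move=> i; have := H (lift ord0 i); rewrite tnthS.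
case: (unliftP ord0 i) => [j ->|->]; first by rewrite tnthS; exact: Ax.
by rewrite tnth0.
exact: (mA ord0).
Qed.

End lebesgue_tuple.

Section simplex.
Context {R : realType}.
Local Notation I01 := (`[0%R, 1%R]%classic : set R).

Definition simplex d : set (d.-tuple R) :=
  [set x | (forall i, 0 <= tnth x i <= 1) /\
           (forall i j : 'I_d, (i <= j)%N -> tnth x i <= tnth x j)].

Definition pdensity d (g : d.-tuple R -> R) : Prop :=
  [/\ measurable_fun [set: _] g, forall x, 0 <= g x,
      forall x, ~ simplex x -> g x = 0 &
      (\int[lebesgue_tuple d]_(x in @simplex d) (g x)%:E = 1)%E].

(* The operations on \bar R give the integrand its usual conventions: it is 0
   where g = 0 and +oo where h = 0 < g. *)
Definition KL d (g h : d.-tuple R -> R) : \bar R :=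
  (\int[lebesgue_tuple d]_(x in @simplex d)
     ((g x)%:E * lne ((g x)%:E / (h x)%:E)))%E.

(* h_[i] *)
Definition coord_fun d (i : 'I_d) (h : R -> R) (x : d.-tuple R) : R :=
  h (tnth x i) * \1_(@simplex d) x.

Definition log_mass d (u : d.-tuple R -> R) : R :=
  ln (\int[lebesgue_tuple d]_(x in @simplex d) expR (u x)).

Definition exp_density d (u : d.-tuple R -> R) (x : d.-tuple R) : R :=
  expR (u x - log_mass u) * \1_(@simplex d) x.

(* In q, rho and phi the index i is 1-based (1 <= i <= d); elsewhere the i-th
   coordinate is i : 'I_d, and such an i is passed to them as i.+1. *)
Definition q (d i : nat) (t : R) : R :=
  ((d - i)`!%:R * (i - 1)`!%:R)^-1 * (1 - t) ^+ (d - i) * t ^+ (i - 1) *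
  \1_I01 t.

(* Rodrigues' formula; the division of polynomials is exact. *)
Definition jacobi (a b k : nat) : {poly R} :=
  let w := (1 - 'X) ^+ a * (1 + 'X) ^+ b in
  ((-1) ^+ k / (2 ^+ k * k`!%:R)) *: (derivn k (w * (1 - 'X ^+ 2) ^+ k) %/ w).

Definition rho (d i k : nat) : R :=
  Num.sqrt ((2 * k + d)%:R * k`!%:R * (k + d - 1)`!%:R /
            ((k + d - i)`!%:R * (k + i - 1)`!%:R)).

Definition phi (d i k : nat) (t : R) : R :=
  rho d i k * Num.sqrt ((d - i)`!%:R * (i - 1)`!%:R) *
  (jacobi (d - i) (i - 1) k).[2 * t - 1].

End simplex.

Section sobolev.
Context {R : realType}.
Local Notation mu := (@lebesgue_measure R).
Local Notation I01 := (`[0%R, 1%R]%classic : set R).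

Definition absolutely_continuous (D : set R) (f : R -> R) : Prop :=
  forall e, 0 < e -> exists2 delta, 0 < delta &
    forall (n : nat) (a b : 'I_n -> R),
      (forall i, a i <= b i) ->
      (forall i, `[a i, b i]%classic `<=` D) ->
      trivIset [set: 'I_n] (fun i => `]a i, b i[%classic) ->
      \sum_i (b i - a i) < delta ->
      \sum_i `|f (b i) - f (a i)| < e.

Definition L2 (w : R -> R) (h : R -> R) : Prop :=
  measurable_fun I01 h /\
  (\int[mu]_(t in I01) (h t ^+ 2 * w t)%:E < +oo)%E.

(* W^2_r(w), for a weight w that is positive on ]0, 1[ and r > 0.  An element
   of L^2(w) is a class of functions modulo a.e. equality, hence the
   representative g.  As g is a total function on R, its derivatives are taken
   on ]0, 1[, where they do not depend on the values of g outside [0, 1];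
   g^(r-1) is absolutely continuous on ]0, 1[ iff it extends to an absolutely
   continuous function on [0, 1]. *)
Definition sobolev2 (w : R -> R) (r : nat) (h : R -> R) : Prop :=
  L2 w h /\
  exists g : R -> R,
    [/\ {ae mu, forall t, 0 <= t <= 1 -> h t = g t},
        (forall k t, (k < r.-1)%N -> 0 < t < 1 ->
           derivable (derive1n k g) t 1),
        absolutely_continuous `]0, 1[%classic (derive1n r.-1 g) &
        L2 w (derive1n r g)].

End sobolev.

Section model.
Context {R : realType} {d : nat}.
Variable m : 'I_d -> nat.

Local Notation "|m|" := (\sum_i m i)%N.
Local Notation phim i k := (coord_fun i (@phi R d i.+1 k.+1)).

(* The vectors of R^|m| are made of blocks indexed by i : 'I_d; the entry k of
   block i is the one written (i, k+1). *)
Definition phi_vec (x : d.-tuple R) : 'rV[R]_|m| :=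
  \mxrow_(i < d) \row_(k < m i) phim i k x.

Definition log_model (theta : 'rV[R]_|m|) (x : d.-tuple R) : R :=
  \sum_(i < d) \sum_(k < m i) submxrow theta i 0 k * phim i k x.

Definition f_model (theta : 'rV[R]_|m|) : d.-tuple R -> R :=
  exp_density (log_model theta).

Definition A_map (theta : 'rV[R]_|m|) : 'rV[R]_|m| :=
  \row_j \int[lebesgue_tuple d]_(x in @simplex R d)
           (phi_vec x 0 j * f_model theta x).

(* The preimage of v under the injective map A_map if v is in its range, and
   theta0 otherwise. *)
Definition Theta (theta0 v : 'rV[R]_|m|) : 'rV[R]_|m| :=
  xget theta0 [set theta | A_map theta = v].

Definition mu_hat (n : nat) (x : nat -> d.-tuple R) : 'rV[R]_|m| :=
  n%:R^-1 *: \sum_(j < n) phi_vec (x j).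

Definition f_hat (theta0 : 'rV[R]_|m|) (n : nat) (x : nat -> d.-tuple R) :
    d.-tuple R -> R :=
  f_model (Theta theta0 (mu_hat n x)).

End model.

Section probability.
Context {R : realType} {disp disp' : measure_display}.
Context {Omega : measurableType disp} {E : measurableType disp'}.
Variable P : probability Omega R.

Definition mutually_independent (I : choiceType) (X : I -> Omega -> E) : Prop :=
  forall (s : seq I) (B : I -> set E), uniq s ->
    (forall i, measurable (B i)) ->
    P (\bigcap_(i in [set` s]) (X i @^-1` B i)) =
    (\prod_(i <- s) P (X i @^-1` B i))%E.

(* Sequences are indexed by the positive integers; their term 0 is ignored. *)
Definition cvg_in_probability0 (Y : nat -> Omega -> \bar R) : Prop :=
  forall e : R, 0 < e ->
    (P [set o | (e%:E < `|Y n o|)%E] @[n --> \oo] --> 0)%E.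

Definition bigO_P (Y : nat -> Omega -> \bar R) (a : nat -> R) : Prop :=
  forall e : R, 0 < e -> exists2 C : R, 0 < C &
    forall n, (0 < n)%N ->
      (P [set o | (C%:E < `|Y n o / (a n)%:E|)%E] < e%:E)%E.

End probability.

(* Main.v *)
Require Import Defs.
From HB Require Import structures.
From mathcomp Require Import all_boot all_order all_algebra.
From mathcomp Require Import all_classical all_reals all_analysis.
From mathcomp Require Import measurable_realfun ring lra zify.

(** Write [u] for the exponent of [f0] and [lin phi_vec th] for the exponent of
    the density of the model with parameter [th].

    The equation [A_map th = mu_hat] that defines the estimator says that the
    gradient of the convex function [psi th - th . mu_hat] vanishes.  Let [ths]
    collect the first coefficients of the expansions of the [ell i] in the
    bases [phi].  Two quantities control the distance of the estimator to [f0]: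
    the bias [e2], the squared distance in L2 between [u] and the exponent of
    parameter [ths], and the noise [e1], the squared Euclidean distance between
    [mu_hat] and its expectation.  Around [ths] the convex function is strongly
    convex, with a constant that does not depend on the number of parameters:
    the log-densities stay bounded there, and the functions of the model,
    although they are not orthogonal on the simplex, satisfy two-sided norm
    inequalities modulo constants ([gram_upper], [gram_lower], the latter from
    [simplex_variance]).  The squared norm of its gradient at [ths] is
    [O(e1 + e2)].  So it has a critical point at squared distance [O(e1 + e2)]
    from [ths], whose divergence from [f0] is [O(e1 + e2)]: this is [mle_near].
    The log-densities stay bounded as long as the parameter moves by a vector of
    sup norm at most 1 on the simplex, and Nikolskii's inequality
    ([nikolskii], [lin_sqr_le]) makes the square of that norm at most a constant
    times [|m|^(2 d)] times the squared Euclidean norm; the two limits assumed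
    for [m] say that [|m|^(2 d) (e1 + e2)] tends to [0].

    Bias.  By [r] integrations by parts the Jacobi coefficients of a function of
    regularity [r] are those of its [r]-th derivative, for the weight with both
    exponents increased by [r], up to a factor of order [k^(-r)]
    ([sobolev_coef]).  Bessel's inequality then gives the rate [m^(-2 r)], and
    [r > d] makes the partial sums bounded ([sobolev_phi_approx]).  As only the
    derivative of order [r - 1] is absolutely continuous, the last integration
    by parts rests on the fundamental theorem of calculus for absolutely
    continuous functions ([ac_density]).

    Noise.  The functions of the model have norm one on the simplex and [f0] is
    bounded, so the expectation of [e1] is [O(|m| / n)]; Markov's inequality
    concludes ([empirical_mean_deviation]).

    This bounds the divergence in probability for all large [n]
    ([mle_risk_tail]).  For each of the remaining [n] it is enough that the
    divergence is a random variable with finite values.  Its measurability is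
    not obvious, because the estimator is an arbitrary choice among the
    solutions of an equation; but two solutions define the same density, and the
    existence of a solution with a given bound on the divergence can be tested
    on parameters with rational coordinates ([measurable_solution_value]). *)

Set Implicit Arguments.
Unset Strict Implicit.
Unset Printing Implicit Defensive.

Import Order.TTheory GRing.Theory Num.Theory.
Import numFieldNormedType.Exports.

Local Open Scope classical_set_scope.
Local Open Scope ring_scope.

(** * Bounded measurable functions on a set of finite measure *)

Section bounded_integrals.
Context d (T : measurableType d) (R : realType).
Variables (mu : {measure set T -> \bar R}) (D : set T).
Hypotheses (mD : measurable D) (muD : (mu D < +oo)%E).

(** Boundedness on a set of finite measure makes all integrals finite, and the
    class is closed under all operations used on densities. *)
Definition bmf (f : T -> R) :=
  measurable_fun D f /\ exists M : R, forall x, D x -> `|f x| <= M.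

Lemma eq_bmf f g : (forall x, D x -> g x = f x) -> bmf f -> bmf g.
Proof.
move=> fg [mf [M Mf]]; split; last by exists M => x Dx; rewrite fg// Mf.
by apply: eq_measurable_fun mf => x /set_mem Dx; rewrite fg.
Qed.

Lemma bmf_cst c : bmf (fun=> c).
Proof. by split=> //; exists `|c|. Qed.

Lemma bmfD f g : bmf f -> bmf g -> bmf (fun x => f x + g x).
Proof.
move=> [mf [M Mf]] [mg [M' Mg]]; split; first exact: measurable_funD.
exists (M + M') => x Dx; apply: (le_trans (ler_normD _ _)).
by rewrite lerD ?Mf ?Mg.
Qed.

Lemma bmfM f g : bmf f -> bmf g -> bmf (fun x => f x * g x).
Proof.
move=> [mf [M Mf]] [mg [M' Mg]]; split; first exact: measurable_funM.
by exists (M * M') => x Dx; rewrite normrM ler_pM ?Mf ?Mg.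
Qed.

Lemma bmfN f : bmf f -> bmf (fun x => - f x).
Proof.
move=> [mf [M Mf]]; split; first exact: measurableT_comp.
by exists M => x Dx; rewrite normrN Mf.
Qed.

Lemma bmfB f g : bmf f -> bmf g -> bmf (fun x => f x - g x).
Proof. by move=> bf bg; apply: bmfD => //; exact: bmfN. Qed.

Lemma bmfX f n : bmf f -> bmf (fun x => f x ^+ n).
Proof.
move=> bf; elim: n => [|n ih]; first exact: bmf_cst.
by under eq_fun do rewrite exprS; exact: bmfM.
Qed.

Lemma bmf_sum (I : Type) (s : seq I) (F : I -> T -> R) :
  (forall i, bmf (F i)) -> bmf (fun x => \sum_(i <- s) F i x).
Proof.
move=> bF; elim: s => [|i s ih].
  by under eq_fun do rewrite big_nil; exact: bmf_cst.
by under eq_fun do rewrite big_cons; exact: bmfD.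
Qed.

Lemma bmf_exp f : bmf f -> bmf (fun x => expR (f x)).
Proof.
move=> [mf [M Mf]]; split; first exact: measurableT_comp.
exists (expR M) => x Dx; rewrite ger0_norm ?expR_ge0// ler_expR.
exact: le_trans (ler_norm _) (Mf x Dx).
Qed.

Lemma bmf_integrable f : bmf f -> mu.-integrable D (EFin \o f).
Proof.
move=> [mf [M Mf]]; apply: measurable_bounded_integrable => //.
exists M; split; first exact: num_real.
by move=> y My x /= Dx; apply: le_trans (ltW My); exact: Mf.
Qed.

Lemma bintE f : bmf f ->
  (\int[mu]_(x in D) (f x)%:E = (\int[mu]_(x in D) f x)%:E)%E.
Proof. by move=> bf; rewrite fineK//; exact/integrable_fin_num/bmf_integrable. Qed.

Local Notation "'I' f" := (\int[mu]_(x in D) f x) (at level 10).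

Lemma bintD f g : bmf f -> bmf g ->
  \int[mu]_(x in D) (f x + g x) = I f + I g.
Proof. by move=> bf bg; apply: RintegralD => //; exact: bmf_integrable. Qed.

Lemma bintB f g : bmf f -> bmf g ->
  \int[mu]_(x in D) (f x - g x) = I f - I g.
Proof. by move=> bf bg; apply: RintegralB => //; exact: bmf_integrable. Qed.

Lemma bintZ c f : bmf f -> \int[mu]_(x in D) (c * f x) = c * I f.
Proof. by move=> bf; apply: RintegralZl => //; exact: bmf_integrable. Qed.

Lemma bint_le f g : bmf f -> bmf g -> (forall x, D x -> f x <= g x) -> I f <= I g.
Proof. by move=> bf bg; apply: le_Rintegral => //; exact: bmf_integrable. Qed.

Lemma bint_sum (J : Type) (s : seq J) (F : J -> T -> R) :
  (forall i, bmf (F i)) ->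
  \int[mu]_(x in D) (\sum_(i <- s) F i x) = \sum_(i <- s) I (F i).
Proof.
move=> bF; elim: s => [|i s ih].
  rewrite big_nil; under eq_Rintegral do rewrite big_nil.
  by rewrite Rintegral_cst// mul0r.
rewrite big_cons -ih -bintD//; last exact: bmf_sum.
by apply: eq_Rintegral => x _; rewrite big_cons.
Qed.

Lemma bint_eq f g : (forall x, D x -> f x = g x) -> I f = I g.
Proof. by move=> fg; apply: eq_Rintegral => x /set_mem/fg. Qed.

(** The integral of [(V f - I f)^2], where [V] is the measure of [D], is
    nonnegative. *)
Lemma sqr_bint_le f : bmf f -> (I f) ^+ 2 <= fine (mu D) * \int[mu]_(x in D) f x ^+ 2.
Proof.
move=> bf; set V := fine (mu D); set m := I f.
have V0 : 0 <= V by rewrite fine_ge0.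
have H : 0 <= V ^+ 2 * (\int[mu]_(x in D) f x ^+ 2) - V * m ^+ 2.
  have -> : V ^+ 2 * (\int[mu]_(x in D) f x ^+ 2) - V * m ^+ 2 =
      \int[mu]_(x in D) (V * f x - m) ^+ 2.
    rewrite [RHS](_ : _ = \int[mu]_(x in D) ((V ^+ 2 * f x ^+ 2 - (2 * V * m) * f x) + m ^+ 2)); last first.
      by apply: bint_eq => x _; ring.
    have b1 : bmf (fun x => V ^+ 2 * f x ^+ 2) by apply: bmfM; [exact: bmf_cst|exact: bmfX].
    have b2 : bmf (fun x => 2 * V * m * f x) by apply: bmfM => //; exact: bmf_cst.
    have b3 : bmf (fun=> m ^+ 2) by exact: bmf_cst.
    rewrite bintD//; last exact: bmfB.
    rewrite bintB// bintZ; last exact: bmfX.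
    by rewrite bintZ// Rintegral_cst// -/V -/m; ring.
  by apply: Rintegral_ge0 => x _; rewrite sqr_ge0.
(* dividing by [V] is impossible on a null set, where both sides vanish *)
have [V00|Vn0] := eqVneq V 0; last first.
  rewrite -subr_ge0 -(pmulr_rge0 _ (_ : 0 < V)) ?lt0r ?Vn0//.
  by rewrite mulrBr mulrA -expr2.
have D0 : mu D = 0%E.
  by rewrite -[mu D]fineK ?ge0_fin_numE// -/V V00.
suff -> : m = 0 by rewrite V00 mul0r expr0n.
by rewrite /m /Rintegral null_set_integral//; have /integrableP[] := bmf_integrable bf.
Qed.

(** A function whose square has integral [0] vanishes almost everywhere; in this
    form almost everywhere equalities are deduced from variances that vanish. *)
Lemma bint_ae_eq (h f g : T -> R) : bmf h -> bmf f -> bmf g ->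
  \int[mu]_(x in D) h x ^+ 2 = 0 -> (forall x, D x -> h x = 0 -> f x = g x) ->
  \int[mu]_(x in D) f x = \int[mu]_(x in D) g x.
Proof.
move=> bh bf bg h0 fg; congr fine; apply: ae_eq_integral => //.
- by have /integrableP[] := bmf_integrable bf.
- by have /integrableP[] := bmf_integrable bg.
have bh2 := bmfX 2 bh; have /integrableP[mh _] := bmf_integrable bh2.
have /(ae_eq_integral_abs _ mD mh) : (\int[mu]_(x in D) `|(h x ^+ 2)%R%:E| = 0)%E.
  rewrite (_ : (\int[mu]_(x in D) _)%E = (\int[mu]_(x in D) (h x ^+ 2)%:E)%E); last first.
    by apply: eq_integral => x _ /=; rewrite ger0_norm ?sqr_ge0.
  by rewrite -[LHS]fineK//; [congr EFin|exact: integrable_fin_num (bmf_integrable bh2)].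
apply: filterS => x /= H Dx; move: (H Dx) => [] /eqP; rewrite sqrf_eq0 => /eqP hx.
by rewrite fg.
Qed.

End bounded_integrals.

(** * Inequalities for the exponential and the logarithm *)

Section scalar_inequalities.
Context (R : realType).
Implicit Types x y : R.

Lemma expR_mul_onem y : expR y * (1 - y) <= 1.
Proof.
have := expR_ge1Dx (- y); rewrite expRN -(ler_pM2l (expR_gt0 y)) mulfV//.
by rewrite gt_eqF ?expR_gt0.
Qed.

Lemma expR_quad_ub y : expR y - 1 - y <= y ^+ 2 * expR `|y|.
Proof.
have h := expR_mul_onem y.
apply: (@le_trans _ _ (y * (expR y - 1))); first by lra.
have [y0|y0] := leP 0 y.
  by rewrite ger0_norm// expr2 -mulrA ler_wpM2l//; lra.
have e1 : 1 <= expR `|y| by rewrite -expR0 ler_expR.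
have := expR_ge1Dx y => e2.
apply: (@le_trans _ _ (y ^+ 2)); last by rewrite ler_peMr// sqr_ge0.
by rewrite expr2 ler_nM2l//; lra.
Qed.

Lemma expR_quad_lb y : - 2 <= y -> 1 + y + y ^+ 2 / 4 <= expR y.
Proof.
move=> y2; have -> : expR y = expR (y / 2) ^+ 2 by rewrite expr2 -expRD; congr expR; lra.
have h := expR_ge1Dx (y / 2).
have -> : 1 + y + y ^+ 2 / 4 = (1 + y / 2) ^+ 2 by field.
by rewrite ler_pXn2r// nnegrE ?expR_ge0//; lra.
Qed.

Lemma ln_ge_onemV y : 0 < y -> 1 - y^-1 <= ln y.
Proof.
move=> y0; have := @le_ln1Dx R (y^-1 - 1); rewrite [1 + _]addrC subrK lnV ?posrE//.
have : 0 < y^-1 by rewrite invr_gt0.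
by move=> ? h; have := h _; lra.
Qed.

Lemma ln_le_subr1 y : 0 < y -> ln y <= y - 1.
Proof.
by move=> y0; have := @le_ln1Dx R (y - 1); rewrite [1 + _]addrC subrK; apply; lra.
Qed.

Lemma ln1Dx_ge_half y : 0 <= y <= 1 -> y / 2 <= ln (1 + y).
Proof.
move=> /andP[y0 y1]; apply: le_trans (ln_ge_onemV _); last by lra.
have -> : 1 - (1 + y)^-1 = y * (1 + y)^-1 by field; lra.
by rewrite ler_wpM2l// lef_pV2 ?posrE; lra.
Qed.

Lemma expR_lip B x y : x <= B -> y <= B -> `|expR x - expR y| <= expR B * `|x - y|.
Proof.
wlog xy : x y / x <= y.
  by move=> H xB yB; have [/H->//|/ltW/H] := leP x y; rewrite distrC [`|x - y|]distrC; apply.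
move=> _ yB; rewrite ler0_norm; last by rewrite subr_le0 ler_expR.
rewrite ler0_norm ?subr_le0// !opprB.
have -> : expR y - expR x = expR y * (1 - expR (x - y)).
  by rewrite mulrBr mulr1 -expRD; congr (_ - expR _); lra.
have := expR_ge1Dx (x - y) => h.
apply: ler_pM => //; rewrite ?expR_ge0 ?ler_expR//; last by lra.
by rewrite subr_ge0 -expR0 ler_expR; lra.
Qed.

End scalar_inequalities.

(** * Exponential tilting and Kullback-Leibler divergence *)

HB.lock Definition lnmass d (T : measurableType d) (R : realType)
    (mu : {measure set T -> \bar R}) (D : set T) (u : T -> R) : R :=
  ln (\int[mu]_(x in D) expR (u x)).

HB.lock Definition tilt d (T : measurableType d) (R : realType)
    (mu : {measure set T -> \bar R}) (D : set T) (u : T -> R) (x : T) : R :=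
  expR (u x - lnmass mu D u).

(** the Kullback-Leibler divergence of [tilt u] from [tilt v], with the logarithm
    of the quotient of the two densities computed *)
HB.lock Definition rKL d (T : measurableType d) (R : realType)
    (mu : {measure set T -> \bar R}) (D : set T) (u v : T -> R) : R :=
  \int[mu]_(x in D)
    (tilt mu D u x * ((u x - v x) - (lnmass mu D u - lnmass mu D v))).

Section exponential_tilting.
Context d (T : measurableType d) (R : realType).
Variables (mu : {measure set T -> \bar R}) (D : set T).
Hypotheses (mD : measurable D) (muD : (mu D < +oo)%E) (muD0 : (0 < mu D)%E).

Local Notation bmf := (bmf D).
Local Notation V := (fine (mu D)).

Local Notation lnmass := (lnmass mu D).
Local Notation tilt := (tilt mu D).
Local Notation rKL := (rKL mu D).

Lemma lnmassE u : lnmass u = ln (\int[mu]_(x in D) expR (u x)).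
Proof. by rewrite lnmass.unlock. Qed.

Lemma tilt_expR u x : tilt u x = expR (u x - lnmass u).
Proof. by rewrite tilt.unlock. Qed.

Lemma rKL_def u v : rKL u v =
  \int[mu]_(x in D) (tilt u x * ((u x - v x) - (lnmass u - lnmass v))).
Proof. by rewrite rKL.unlock. Qed.

Lemma tilt_gt0 u x : 0 < tilt u x.
Proof. by rewrite tilt_expR expR_gt0. Qed.

Lemma tilt_ge0 u x : 0 <= tilt u x.
Proof. exact/ltW/tilt_gt0. Qed.

Lemma bmf_tilt u : bmf u -> bmf (tilt u).
Proof.
move=> bu; rewrite (_ : tilt u = fun x => expR (u x - lnmass u)); last first.
  by apply/funext => x; rewrite tilt_expR.
by apply: bmf_exp; apply: bmfB => //; exact: bmf_cst. Qed.

Let V0 : 0 < V. Proof. by rewrite fine_gt0// muD0 muD. Qed.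

Lemma mass_gt0 u : bmf u -> 0 < \int[mu]_(x in D) expR (u x).
Proof.
move=> bu; have [mu_ [M Mu]] := bu.
apply: (@lt_le_trans _ _ (\int[mu]_(x in D) expR (- M))).
  by rewrite Rintegral_cst// mulr_gt0 ?expR_gt0.
apply: bint_le => //; [exact: bmf_cst|exact: bmf_exp|].
move=> x Dx; rewrite ler_expR; have := Mu x Dx.
by rewrite ler_norml => /andP[].
Qed.

Lemma expR_lnmass u : bmf u -> expR (lnmass u) = \int[mu]_(x in D) expR (u x).
Proof. by move=> bu; rewrite lnmassE lnK// posrE mass_gt0. Qed.

Lemma tiltE u x : bmf u -> tilt u x = (\int[mu]_(x in D) expR (u x))^-1 * expR (u x).
Proof. by move=> bu; rewrite !tilt_expR expRD expRN expR_lnmass// mulrC. Qed.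

Lemma int_tilt u : bmf u -> \int[mu]_(x in D) tilt u x = 1.
Proof.
move=> bu; under eq_Rintegral do rewrite tiltE//.
rewrite bintZ//; last exact: bmf_exp.
by rewrite mulVf// gt_eqF// mass_gt0.
Qed.

Lemma int_tilt_cst u c : bmf u -> \int[mu]_(x in D) (c * tilt u x) = c.
Proof. by move=> bu; rewrite bintZ ?int_tilt ?mulr1//; exact: bmf_tilt. Qed.

Lemma lnmass_diff u v : bmf u -> bmf v ->
  lnmass v - lnmass u = ln (\int[mu]_(x in D) (expR (v x - u x) * tilt u x)).
Proof.
move=> bu bv; have -> : \int[mu]_(x in D) (expR (v x - u x) * tilt u x) =
   (\int[mu]_(x in D) expR (u x))^-1 * \int[mu]_(x in D) expR (v x).
  rewrite -(@bintZ _ _ _ mu D mD muD _ (fun x => expR (v x))); last exact: bmf_exp.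
  apply: eq_Rintegral => x _; rewrite tiltE// mulrCA -expRD; congr (_ * expR _); lra.
rewrite lnM ?posrE ?invr_gt0 ?mass_gt0// lnV ?posrE ?mass_gt0//.
by rewrite !lnmassE addrC.
Qed.

Lemma bmf_cross u v : bmf u -> bmf v -> bmf (fun x => expR (v x - u x) * tilt u x).
Proof. by move=> bu bv; apply: bmfM; [apply/bmf_exp/bmfB|exact: bmf_tilt]. Qed.

Lemma cross_gt0 u v : bmf u -> bmf v ->
  0 < \int[mu]_(x in D) (expR (v x - u x) * tilt u x).
Proof.
move=> bu bv; have -> : \int[mu]_(x in D) (expR (v x - u x) * tilt u x) =
  expR (- lnmass u) * \int[mu]_(x in D) expR (v x).
  rewrite -(@bintZ _ _ _ mu D mD muD _ (fun x => expR (v x))); last exact: bmf_exp.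
  by apply: eq_Rintegral => x _; rewrite !tilt_expR -!expRD; congr expR; lra.
by rewrite mulr_gt0 ?expR_gt0 ?mass_gt0.
Qed.

Lemma lnmass_diff_le u v : bmf u -> bmf v ->
  lnmass v - lnmass u <= \int[mu]_(x in D) (expR (v x - u x) * tilt u x) - 1.
Proof. by move=> bu bv; rewrite lnmass_diff//; apply: ln_le_subr1; exact: cross_gt0. Qed.

(** The density [tilt u] averages [expR (v - u)], which lies between
    [expR (- c)] and [expR c]. *)
Lemma lnmass_lip u v (c : R) : bmf u -> bmf v -> (forall x, D x -> `|v x - u x| <= c) ->
  `|lnmass v - lnmass u| <= c.
Proof.
suff H w z : bmf w -> bmf z -> (forall x, D x -> `|z x - w x| <= c) -> lnmass z - lnmass w <= c.
  move=> bu bv uv; rewrite ler_norml H// andbT lerNl opprB H// => x Dx.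
  by rewrite distrC uv.
move=> bw bz wz; rewrite lnmass_diff// -[leRHS]expRK ler_ln ?posrE ?expR_gt0 ?cross_gt0//.
rewrite -[leRHS](int_tilt_cst _ bw); apply: bint_le => //; first exact: bmf_cross.
  by apply: bmfM; [exact: bmf_cst|exact: bmf_tilt].
move=> x Dx; rewrite ler_wpM2r ?tilt_ge0// ler_expR.
exact: le_trans (ler_norm _) (wz x Dx).
Qed.

Lemma lnmass_bound u (B : R) : bmf u -> (forall x, D x -> `|u x| <= B) ->
  `|lnmass u - ln V| <= B.
Proof.
move=> bu uB; have -> : ln V = lnmass (fun=> 0).
  by rewrite !lnmassE expR0 Rintegral_cst// mul1r.
by apply: lnmass_lip => //; [exact: bmf_cst|move=> x Dx; rewrite subr0 uB].
Qed.

Lemma tilt_bounds u (B : R) x : bmf u -> (forall x, D x -> `|u x| <= B) -> D x ->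
  expR (- (2 * B)) / V <= tilt u x <= expR (2 * B) / V.
Proof.
move=> bu uB Dx; have := lnmass_bound bu uB.
have := uB x Dx; rewrite !ler_norml => /andP[h1 h2] /andP[h3 h4].
have VE : V^-1 = expR (- ln V) by rewrite expRN lnK// posrE.
by rewrite VE tilt_expR -!expRD !ler_expR; apply/andP; split; lra.
Qed.

Lemma rKLE u v : bmf u -> bmf v ->
  rKL u v = \int[mu]_(x in D) (tilt u x * (u x - v x)) + (lnmass v - lnmass u).
Proof.
move=> bu bv; have bt := bmf_tilt bu.
rewrite -[in RHS](int_tilt_cst (lnmass v - lnmass u) bu).
rewrite -bintD//; last by apply: bmfM => //; exact: bmf_cst.
  by rewrite rKL_def; apply: eq_Rintegral => x _; move: (lnmass u) (lnmass v) => a b; ring.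
by apply: bmfM => //; exact: bmfB.
Qed.

(** The linear terms cancel in the difference between the logarithm of the mean
    of [expR (v - u)] and the mean of [v - u]; the remainder is quadratic. *)
Lemma rKL_ub u v (C : R) : bmf u -> bmf v -> (forall x, D x -> `|u x - v x| <= C) ->
  rKL u v <= expR C * \int[mu]_(x in D) ((u x - v x) ^+ 2 * tilt u x).
Proof.
move=> bu bv uvC; have bt := bmf_tilt bu; rewrite rKLE//.
have b1 : bmf (fun x => (u x - v x) ^+ 2 * tilt u x).
  by apply: bmfM => //; apply: bmfX; exact: bmfB.
apply: (@le_trans _ _ (\int[mu]_(x in D) ((expR (v x - u x) - 1 - (v x - u x)) * tilt u x))).
  rewrite [leRHS](_ : _ = \int[mu]_(x in D) (tilt u x * (u x - v x)) +
     (\int[mu]_(x in D) (expR (v x - u x) * tilt u x) - 1)); last first.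
    rewrite -[X in _ - X](int_tilt bu) -bintB//; last exact: bmf_cross.
    rewrite -bintD//; last by apply: bmfB => //; exact: bmf_cross.
      by apply: eq_Rintegral => x _; ring.
    by apply: bmfM => //; exact: bmfB.
  by rewrite lerD2l lnmass_diff_le.
rewrite -bintZ//; apply: bint_le => //.
- apply: bmfM => //; apply: bmfB; last exact: bmfB.
  by apply: bmfB; [exact/bmf_exp/bmfB|exact: bmf_cst].
- by apply: bmfM => //; exact: bmf_cst.
move=> x Dx; rewrite mulrA ler_wpM2r ?tilt_ge0//.
apply: (le_trans (expR_quad_ub _)); rewrite [expR C * _]mulrC -[(u x - v x) ^+ 2]sqrrN opprB.
by rewrite ler_wpM2l ?sqr_ge0// ler_expR distrC uvC.
Qed.

(** Pointwise, [e^a (a - b) >= e^a - e^b], and both densities have total mass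
    one. *)
Lemma rKL_ge0 u v : bmf u -> bmf v -> 0 <= rKL u v.
Proof.
move=> bu bv; have [bt bs] := (bmf_tilt bu, bmf_tilt bv).
rewrite rKL_def.
have := @bintB _ _ R mu D mD muD _ _ bt bs.
rewrite !int_tilt// subrr => <-; apply: bint_le => //.
- exact: bmfB.
- by apply: bmfM => //; apply: bmfB; [exact: bmfB|exact: bmf_cst].
move=> x Dx; rewrite -subr_ge0.
rewrite !tilt_expR.
set a := u x - _; set b := v x - _.
have -> : u x - v x - (lnmass u - lnmass v) = a - b by rewrite /a /b; ring.
have -> : expR b = expR a * expR (b - a) by rewrite -expRD addrC subrK.
have -> : expR a * (a - b) - (expR a - expR a * expR (b - a)) =
  expR a * (expR (b - a) - (1 + (b - a))) by ring.
by rewrite mulr_ge0 ?expR_ge0// subr_ge0 expR_ge1Dx.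
Qed.

(** Strong convexity of the normalising constant along bounded centred
    directions: the second derivative is the variance. *)
Lemma lnmass_convex_lb u h : bmf u -> bmf h -> (forall x, D x -> `|h x| <= 2) ->
  \int[mu]_(x in D) (h x * tilt u x) = 0 ->
  (\int[mu]_(x in D) (h x ^+ 2 * tilt u x)) / 8 <= lnmass (fun x => u x + h x) - lnmass u.
Proof.
move=> bu bh h2 h0; have bt := bmf_tilt bu.
have bh2 : bmf (fun x => h x ^+ 2 * tilt u x) by apply: bmfM => //; exact: bmfX.
set W := \int[mu]_(x in D) (h x ^+ 2 * tilt u x).
have W0 : 0 <= W by apply: Rintegral_ge0 => x _; rewrite mulr_ge0 ?sqr_ge0 ?tilt_ge0.
have W4 : W <= 4.
  rewrite -[leRHS](int_tilt_cst _ bu); apply: bint_le => //.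
    by apply: bmfM => //; exact: bmf_cst.
  move=> x Dx; rewrite ler_wpM2r ?tilt_ge0//.
  have := h2 x Dx; rewrite ler_norml => /andP[? ?].
  have -> : 4 = 2 ^+ 2 :> R by ring.
  by rewrite -[h x ^+ 2]real_normK ?num_real// ler_pXn2r ?nnegrE ?h2.
rewrite lnmass_diff//; last exact: bmfD.
apply: (@le_trans _ _ (ln (1 + W / 4))).
  by apply: le_trans (ln1Dx_ge_half _); lra.
have bD := bmfD bu bh.
rewrite ler_ln ?posrE; [|lra|exact: cross_gt0].
have -> : 1 + W / 4 = \int[mu]_(x in D) ((1 + h x + h x ^+ 2 / 4) * tilt u x).
  have b1 : bmf (fun x => h x * tilt u x) by exact: bmfM.
  transitivity (\int[mu]_(x in D) tilt u x + \int[mu]_(x in D) (h x * tilt u x) + 4^-1 * W).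
    by rewrite int_tilt// h0 addr0 mulrC.
  rewrite -bintD// /W -bintZ// -bintD//.
  - by apply: eq_Rintegral => x _; ring.
  - exact: bmfD.
  - by apply: bmfM => //; exact: bmf_cst.
apply: bint_le => //; first apply: bmfM => //.
- apply: bmfD; first by apply: bmfD => //; exact: bmf_cst.
  by apply: bmfM; [exact: bmfX|exact: bmf_cst].
- exact: bmf_cross.
move=> x Dx; rewrite ler_wpM2r ?tilt_ge0// [u x + h x]addrC addrK expR_quad_lb//.
by have := h2 x Dx; rewrite ler_norml => /andP[].
Qed.

Lemma lnmass_addc u c : bmf u -> lnmass (fun x => u x + c) = lnmass u + c.
Proof.
move=> bu; rewrite !lnmassE; under eq_Rintegral do rewrite expRD mulrC.
by rewrite bintZ//; [rewrite lnM ?posrE ?expR_gt0 ?mass_gt0// expRK addrC|exact: bmf_exp].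
Qed.

(** Two exponents that differ by a constant define the same density. *)
Lemma rKL_ae_shift u v w c : bmf u -> bmf v -> bmf w ->
  \int[mu]_(x in D) (w x - v x - c) ^+ 2 = 0 -> rKL u v = rKL u w.
Proof.
move=> bu bv bw h0; have bt := bmf_tilt bu.
have bh : bmf (fun x => w x - v x - c) by apply: bmfB; [exact: bmfB|exact: bmf_cst].
have bvc : bmf (fun x => v x + c) by apply: bmfD => //; exact: bmf_cst.
have E : lnmass w = lnmass v + c.
  rewrite -(lnmass_addc c bv) !lnmassE; congr ln; apply: (bint_ae_eq mD muD bh); [exact: bmf_exp|exact: bmf_exp|exact: h0|].
  by move=> x _ wv; congr expR; move: wv; clear; move: (w x) (v x) => a b ?; lra.
rewrite !rKL_def; apply: (bint_ae_eq mD muD bh).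
- by apply: bmfM => //; apply: bmfB; [exact: bmfB|exact: bmf_cst].
- by apply: bmfM => //; apply: bmfB; [exact: bmfB|exact: bmf_cst].
- exact: h0.
by move=> x _ wv; rewrite E; congr (_ * _); move: wv; clear; move: (w x) (v x) (u x) (lnmass u) (lnmass v) => ? ? ? ? ? ?; lra.
Qed.

(** Monotonicity of [expR] turns the equality of the two means into the
    vanishing of the variance of [w - v]. *)
Lemma mean_eq_ae_shift v w : bmf v -> bmf w ->
  \int[mu]_(x in D) ((w x - v x) * tilt v x) = \int[mu]_(x in D) ((w x - v x) * tilt w x) ->
  exists c, \int[mu]_(x in D) (w x - v x - c) ^+ 2 = 0.
Proof.
move=> bv bw E.
have [c Ec] : exists c, \int[mu]_(x in D) ((w x - v x) * tilt v x) = c by eexists.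
have Ew := etrans (esym E) Ec.
exists c; have [btv btw] := (bmf_tilt bv, bmf_tilt bw).
pose h x := w x - v x - c.
have bh : bmf h by apply: bmfB; [exact: bmfB|exact: bmf_cst].
have [_ [M hM]] := bh; have [_ [Mv hMv]] := bv.
have I0 u : bmf u -> \int[mu]_(x in D) ((w x - v x) * tilt u x) = c ->
    \int[mu]_(x in D) (h x * tilt u x) = 0.
  move=> bu Eu; have bt := bmf_tilt bu.
  transitivity (\int[mu]_(x in D) ((w x - v x) * tilt u x - c * tilt u x)).
    by apply: eq_Rintegral => x _; rewrite /h mulrBl.
  rewrite (@bintB _ _ _ mu D mD muD (fun x => (w x - v x) * tilt u x) (fun x => c * tilt u x)).
  - by rewrite Eu (int_tilt_cst c bu) subrr.
  - by apply: bmfM => //; exact: bmfB.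
  - by apply: bmfM => //; exact: bmf_cst.
(* the factor between the density [tilt w] and [expR h] times [tilt v] *)
pose K := expR (lnmass w - lnmass v - c).
have tw x : K * tilt w x = expR (h x) * tilt v x.
  by rewrite /K !tilt_expR -!expRD; congr expR; rewrite /h; move: (lnmass w) (lnmass v) => a b; ring.
have bhe : bmf (fun x => h x * (expR (h x) - 1) * tilt v x).
  by apply: bmfM => //; apply: bmfM => //; apply: bmfB; [exact: bmf_exp|exact: bmf_cst].
have bh2 : bmf (fun x => h x ^+ 2) by exact: bmfX.
have Z : \int[mu]_(x in D) (h x * (expR (h x) - 1) * tilt v x) = 0.
  transitivity (K * \int[mu]_(x in D) (h x * tilt w x) - \int[mu]_(x in D) (h x * tilt v x)).
    rewrite -bintZ//; last exact: bmfM.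
    rewrite -bintB//; [|by apply: bmfM; [exact: bmf_cst|exact: bmfM]|exact: bmfM].
    by apply: eq_Rintegral => x _; rewrite mulrCA tw; ring.
  by rewrite (I0 v bv Ec) (I0 w bw Ew) mulr0 subrr.
(* [expR] increases at rate at least [expR (- M)] on [[- M, M]] *)
have Mh x : D x -> expR (- M) * h x ^+ 2 <= h x * (expR (h x) - 1).
  move=> Dx; have := hM x Dx; rewrite ler_norml => /andP[h1 h2].
  have a1 : expR (- M) <= 1 by rewrite -expR0 ler_expR; lra.
  have [h0|h0] := leP 0 (h x).
    have := expR_ge1Dx (h x) => e1; rewrite expr2 mulrCA ler_wpM2l//.
    apply: (@le_trans _ _ (h x)); last by lra.
    by rewrite ler_piMl.
  rewrite expr2 mulrCA ler_wnM2l// ?(ltW h0)//.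
  have := expR_mul_onem (h x) => e1.
  have : expR (- M) <= expR (h x) by rewrite ler_expR.
  by move=> e2; nra.
have [tl tl0 tlP] : exists2 l : R, 0 < l & forall x, D x -> l <= tilt v x.
  exists (expR (- (2 * Mv)) / V); first by rewrite divr_gt0 ?expR_gt0.
  by move=> x Dx; have /andP[] := tilt_bounds bv hMv Dx.
have ge0 : 0 <= \int[mu]_(x in D) h x ^+ 2 by apply: Rintegral_ge0 => x _; exact: sqr_ge0.
suff le0 : \int[mu]_(x in D) h x ^+ 2 <= 0 by exact: (le_anti (introT andP (conj le0 ge0))).
rewrite -(pmulr_rle0 _ (_ : 0 < expR (- M) * tl)) ?mulr_gt0 ?expR_gt0//.
rewrite -bintZ// -[leRHS]Z; apply: bint_le => //; first by apply: bmfM => //; exact: bmf_cst.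
move=> x Dx; rewrite mulrAC; apply: ler_pM.
- by rewrite mulr_ge0 ?expR_ge0 ?sqr_ge0.
- exact: ltW.
- exact: Mh.
- exact: tlP.
Qed.

End exponential_tilting.

(** * Log-linear models and their moment equations *)

Section row_vectors.
Context (R : realType) (N : nat).

Lemma row_coord_le (a : 'rV[R]_N) j : `|a 0 j| <= `|a|.
Proof.
by rewrite [leRHS]/Num.norm/= mx_normrE; apply: (le_bigmax _ (fun ij => `|a ij.1 ij.2|) (0, j)).
Qed.

Lemma row_norm_le (a : 'rV[R]_N) (M : R) : 0 <= M -> (forall j, `|a 0 j| <= M) -> `|a| <= M.
Proof.
move=> M0 aM; rewrite [leLHS]/Num.norm/= mx_normrE; apply: bigmax_le => // -[i j] _ /=.
by rewrite (ord1 i).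
Qed.

(** Continuity for the sup norm.  The epsilon-delta form is the one in which the
    explicit Lipschitz bounds of this development are used. *)
Definition econt (f : 'rV[R]_N -> R) := forall (a : 'rV[R]_N) (e : R), 0 < e ->
  exists2 de : R, 0 < de & forall b, `|a - b| <= de -> `|f a - f b| <= e.

Lemma econt_lip f (K : R) : 0 <= K -> (forall a b, `|f a - f b| <= K * `|a - b|) -> econt f.
Proof.
move=> K0 fK a e e0; have K1 : 0 < K + 1 by rewrite ltr_wpDl.
exists (e / (K + 1)) => [|b]; first by rewrite divr_gt0.
rewrite ler_pdivlMr// => hb; apply: (le_trans (fK a b)); apply: le_trans hb.
by rewrite mulrC ler_wpM2l//; lra.
Qed.

Lemma econtB f g : econt f -> econt g -> econt (fun x => f x - g x).
Proof.
move=> cf cg a e e0; have e2 : 0 < e / 2 by lra.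
have [df df0 Hf] := cf a _ e2; have [dg dg0 Hg] := cg a _ e2.
exists (Num.min df dg) => [|b]; first by rewrite lt_min df0.
rewrite le_min => /andP[/Hf hf /Hg hg].
have -> : f a - g a - (f b - g b) = (f a - f b) - (g a - g b) by ring.
by rewrite (le_trans (ler_normB _ _))//; lra.
Qed.

Lemma econt_continuous f : econt f -> continuous (f : 'rV[R]_N -> R).
Proof.
move=> cf a; apply/(@cvgrPdist_le _ _ _ (nbhs (a : 'rV[R]_N))) => e e0.
have [de de0 H] := cf a e e0.
have : nbhs (a : 'rV[R]_N) (ball (a : 'rV[R]_N) de) by exact: nbhsx_ballx.
apply: filterS => b; rewrite -ball_normE /= => h; apply: H; exact: ltW.
Qed.

End row_vectors.

Section loglinear.
Context d (T : measurableType d) (R : realType).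
Variables (mu : {measure set T -> \bar R}) (D : set T).
Hypotheses (mD : measurable D) (muD : (mu D < +oo)%E) (muD0 : (0 < mu D)%E).
Variables (N : nat) (phi : T -> 'rV[R]_N).
Hypothesis bphi : forall j, bmf D (fun x => phi x 0 j).

Local Notation bmf := (bmf D).
Local Notation V := (fine (mu D)).
Local Notation tilt := (tilt mu D).
Local Notation lnmass := (lnmass mu D).

Definition lin (th : 'rV[R]_N) (x : T) : R := \sum_j th 0 j * phi x 0 j.
Definition dot (a b : 'rV[R]_N) : R := \sum_j a 0 j * b 0 j.
(** the gradient of the logarithm of the mass, that is, the mean of [phi] under
    the density with parameter [th] *)
Definition mean_map (th : 'rV[R]_N) : 'rV[R]_N :=
  \row_j \int[mu]_(x in D) (phi x 0 j * tilt (lin th) x).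

Lemma bmf_lin th : bmf (lin th).
Proof. by apply: bmf_sum => j; apply: bmfM => //; exact: bmf_cst. Qed.

Lemma linD a b x : lin (a + b) x = lin a x + lin b x.
Proof. by rewrite -big_split; apply: eq_bigr => j _; rewrite mxE mulrDl. Qed.

Lemma linZ c a x : lin (c *: a) x = c * lin a x.
Proof. by rewrite mulr_sumr; apply: eq_bigr => j _; rewrite mxE mulrA. Qed.

Lemma linB a b x : lin (a - b) x = lin a x - lin b x.
Proof. by rewrite -scaleN1r linD linZ mulN1r. Qed.

Lemma int_lin g th : bmf g ->
  \int[mu]_(x in D) (lin th x * g x) =
  \sum_j th 0 j * \int[mu]_(x in D) (phi x 0 j * g x).
Proof.
move=> bg; have b1 j : bmf (fun x => phi x 0 j * g x) by exact: bmfM.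
under [RHS]eq_bigr do rewrite -bintZ//.
rewrite -bint_sum//; last by move=> j; apply: bmfM => //; exact: bmf_cst.
apply: eq_Rintegral => x _; rewrite mulr_suml; apply: eq_bigr => j _.
by rewrite mulrA.
Qed.

Lemma dot_mean_map a th :
  dot a (mean_map th) = \int[mu]_(x in D) (lin a x * tilt (lin th) x).
Proof.
rewrite int_lin; last exact/bmf_tilt/bmf_lin.
by apply: eq_bigr => j _; rewrite mxE.
Qed.

Lemma dotDr a b c : dot a (b + c) = dot a b + dot a c.
Proof. by rewrite -big_split; apply: eq_bigr => j _; rewrite mxE mulrDr. Qed.
Lemma dotNr a b : dot a (- b) = - dot a b.
Proof. by rewrite /dot -sumrN; apply: eq_bigr => j _; rewrite mxE mulrN. Qed.
Lemma dotBr a b c : dot a (b - c) = dot a b - dot a c.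
Proof. by rewrite dotDr dotNr. Qed.
Lemma dotC a b : dot a b = dot b a.
Proof. by apply: eq_bigr => j _; rewrite mulrC. Qed.
Lemma dotDl a b c : dot (a + b) c = dot a c + dot b c.
Proof. by rewrite !(dotC _ c) dotDr. Qed.
Lemma dotZl k a b : dot (k *: a) b = k * dot a b.
Proof. by rewrite /dot mulr_sumr; apply: eq_bigr => j _; rewrite mxE mulrA. Qed.
Lemma dot_ge0 a : 0 <= dot a a.
Proof. by apply: sumr_ge0 => j _; rewrite -expr2 sqr_ge0. Qed.
Lemma dot_eq0 a : dot a a <= 0 -> a = 0.
Proof.
move=> h; apply/rowP => j; rewrite mxE; apply/eqP; rewrite -sqrf_eq0 expr2.
have /psumr_eq0P : \sum_j a 0 j * a 0 j = 0.
  by apply/eqP; rewrite eq_le h dot_ge0.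
by move=> ->//= i _; rewrite -expr2 sqr_ge0.
Qed.
Lemma dot_young k a b : 0 < k -> dot a b <= k * dot a a / 2 + dot b b / (2 * k).
Proof.
move=> k0; rewrite -subr_ge0.
have -> : k * dot a a / 2 + dot b b / (2 * k) - dot a b =
   (2 * k)^-1 * dot (k *: a - b) (k *: a - b).
  rewrite dotBr !(dotC _ (k *: a)) !(dotC _ b) !dotBr !dotZl !(dotC _ (k *: a)) !dotZl (dotC b a).
  by field; rewrite gt_eqF.
by rewrite mulr_ge0 ?dot_ge0// invr_ge0; lra.
Qed.

Lemma dot_sqrD a b : dot (a + b) (a + b) <= 2 * dot a a + 2 * dot b b.
Proof.
rewrite dotDl !dotDr (dotC b a); have := @dot_young 1 a b ltr01.
by rewrite mul1r mulr1; lra.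
Qed.

Lemma econt_sqdist (c : 'rV[R]_N) : econt (fun th => dot (th - c) (th - c)).
Proof.
move=> a e e0; pose M := N%:R * (2 * `|a - c| + 1) + 1.
have M0 : 0 < M by rewrite ltr_wpDl// mulr_ge0// addr_ge0// mulr_ge0.
exists (Num.min 1 (e / M)) => [|b]; first by rewrite lt_min ltr01 divr_gt0.
rewrite le_min => /andP[ab1]; rewrite ler_pdivlMr// => abe.
apply: (@le_trans _ _ (`|a - b| * (N%:R * (2 * `|a - c| + 1)))); last first.
  by apply: le_trans abe; rewrite ler_wpM2l// lerDl.
rewrite /dot -sumrB; apply: (le_trans (ler_norm_sum _ _ _)).
apply: (@le_trans _ _ (\sum_(j < N) `|a - b| * (2 * `|a - c| + 1))); last first.
  by rewrite sumr_const card_ord -[leLHS]mulr_natl mulrCA.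
apply: ler_sum => j _; rewrite -!expr2 subr_sqr normrM; apply: ler_pM => //.
  by have := row_coord_le (a - b) j; rewrite !mxE; congr (_ <= _); congr `|_|; ring.
have -> : (a - c) 0 j + (b - c) 0 j = 2 * (a - c) 0 j - (a - b) 0 j by rewrite !mxE; ring.
rewrite (le_trans (ler_normB _ _))// lerD//; last exact: le_trans (row_coord_le _ _) ab1.
by rewrite normrM ger0_norm// ler_wpM2l// row_coord_le.
Qed.

(** The parameter of a density need not be unique, but the density with a given
    mean is. *)
Lemma rKL_mean_map u th1 th2 : bmf u -> mean_map th1 = mean_map th2 ->
  rKL mu D u (lin th1) = rKL mu D u (lin th2).
Proof.
move=> bu E.
suff [c c0] : exists c, \int[mu]_(x in D) (lin th2 x - lin th1 x - c) ^+ 2 = 0.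
  by apply: (rKL_ae_shift mD muD muD0 bu _ _ c0); exact: bmf_lin.
apply: (mean_eq_ae_shift mD muD muD0 (bmf_lin _) (bmf_lin _)).
have H th : \int[mu]_(x in D) ((lin th2 x - lin th1 x) * tilt (lin th) x) = dot (th2 - th1) (mean_map th).
  by rewrite dot_mean_map; apply: eq_Rintegral => x _; rewrite linB.
by rewrite !H E.
Qed.

(** the opposite of the log-likelihood of a sample of mean [v], divided by the
    size of the sample *)
Definition objective v th := lnmass (lin th) - dot th v.

(** An interior minimiser of the objective solves the normal equations:
    moving towards the residual would decrease the objective. *)
Lemma critical_point v th : (\forall t \near (0:R)^'+,
    objective v th <= objective v (th + t *: (v - mean_map th))) -> mean_map th = v.
Proof.
set de := v - mean_map th => H.
have bl := bmf_lin th; have bd := bmf_lin de.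
have [_ [M hM]] := bd.
have M0 : 0 <= M.
  have [x Dx] : D !=set0.
    by apply/set0P/eqP => D0; move: muD0; rewrite D0 measure0 ltxx.
  exact: le_trans (normr_ge0 _) (hM x Dx).
(* the objective along the residual: a negative slope plus a quadratic term *)
have up t : 0 <= t <= 1 -> objective v (th + t *: de) - objective v th <=
    - t * dot de de + t ^+ 2 * (M ^+ 2 * expR M).
  move=> /andP[t0 t1].
  have linE : lin (th + t *: de) = fun x => lin th x + t * lin de x.
    by apply/funext => x; rewrite linD linZ.
  have btd : bmf (fun x => t * lin de x) by apply: bmfM => //; exact: bmf_cst.
  have E1 : lnmass (lin (th + t *: de)) - lnmass (lin th) <=
      t * dot de (mean_map th) + t ^+ 2 * (M ^+ 2 * expR M).
    apply: (le_trans (lnmass_diff_le mD muD muD0 bl (bmf_lin _))).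
    rewrite dot_mean_map -bintZ//; last by apply: bmfM => //; exact: bmf_tilt.
    have b1 : bmf (fun x => t * (lin de x * tilt (lin th) x)).
      by apply: bmfM; [exact: bmf_cst|apply: bmfM => //; exact: bmf_tilt].
    have b2 : bmf (fun x => t ^+ 2 * (M ^+ 2 * expR M) * tilt (lin th) x).
      by apply: bmfM; [exact: bmf_cst|exact: bmf_tilt].
    rewrite lerBlDr.
    rewrite -(int_tilt_cst mD muD muD0 (t ^+ 2 * _) bl) -bintD// -(int_tilt mD muD muD0 bl).
    rewrite -bintD//; [|exact: bmfD|exact: bmf_tilt].
    apply: bint_le => //; first exact: bmf_cross (bmf_lin _).
      by apply: bmfD; [exact: bmfD|exact: bmf_tilt].
    move=> x Dx; rewrite linE [lin th x + _]addrC addrK.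
    have -> a b c' : t * (a * c') + t ^+ 2 * b * c' + c' = (t * a + t ^+ 2 * b + 1) * c' by ring.
    rewrite ler_wpM2r ?tilt_ge0//.
    have := expR_quad_ub (t * lin de x) => e1.
    have hx := hM x Dx.
    suff : (t * lin de x) ^+ 2 * expR `|t * lin de x| <= t ^+ 2 * (M ^+ 2 * expR M) by lra.
    rewrite exprMn -mulrA ler_wpM2l ?sqr_ge0//.
    apply: ler_pM; rewrite ?sqr_ge0 ?expR_ge0//.
      by rewrite -[_ ^+ 2]real_normK ?num_real// ler_pXn2r ?nnegrE.
    by rewrite ler_expR normrM ger0_norm//; apply: le_trans hx; rewrite ler_piMl.
  rewrite /objective dotDl dotZl; move: E1.
  have -> : dot de de = dot de v - dot de (mean_map th) by rewrite {2}/de dotBr.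
  move: (lnmass _) (lnmass _) => a b; rewrite mulNr mulrBr; lra.
suff d0 : dot de de <= 0 by move/dot_eq0/eqP: d0; rewrite subr_eq0 => /eqP.
rewrite leNgt; apply/negP => d0.
set C := M ^+ 2 * expR M + 1 in up.
have C0 : 0 < M ^+ 2 * expR M + 1 by rewrite ltr_wpDl// mulr_ge0 ?sqr_ge0 ?expR_ge0.
near (0:R)^'+ => t.
have t0 : 0 < t by near: t; exact: nbhs_right_gt.
have t1 : t <= 1 by near: t; exact: nbhs_right_le.
have t2 : t < dot de de / (M ^+ 2 * expR M + 1).
  by near: t; apply: nbhs_right_lt; rewrite divr_gt0.
have := up t; rewrite (ltW t0) t1 => /(_ isT).
have : objective v th <= objective v (th + t *: de) by near: t.
move=> h1 h2; move: t2; rewrite ltr_pdivlMr// => t2.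
have : 0 <= - t * dot de de + t ^+ 2 * (M ^+ 2 * expR M) by lra.
rewrite mulNr expr2 -mulrA -mulrN -mulrDr pmulr_rge0// => h3.
have : t * (M ^+ 2 * expR M) <= t * (M ^+ 2 * expR M + 1) by rewrite ler_wpM2l ?(ltW t0)//; lra.
by lra.
Unshelve. all: by end_near.
Qed.

Lemma lin_norm_bound : exists2 K : R, 0 <= K & forall th x, D x -> `|lin th x| <= K * `|th|.
Proof.
have /choice[M hM] : forall j, exists M : R, forall x, D x -> `|phi x 0 j| <= M.
  by move=> j; have [_] := bphi j.
exists (\sum_j `|M j|); first exact: sumr_ge0.
move=> th x Dx; rewrite mulr_suml; apply: (le_trans (ler_norm_sum _ _ _)).
apply: ler_sum => j _; rewrite normrM mulrC; apply: ler_pM => //.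
  exact: le_trans (hM j x Dx) (ler_norm _).
exact: row_coord_le.
Qed.

Lemma econt_lnmass_lin : econt (fun th => lnmass (lin th)).
Proof.
have [K K0 hK] := lin_norm_bound; apply: (@econt_lip _ _ _ K) => // a b.
apply: lnmass_lip => //; [exact: bmf_lin|exact: bmf_lin|].
by move=> x Dx; rewrite -linB; exact: hK.
Qed.

Lemma econt_dot v : econt (fun th : 'rV[R]_N => dot th v).
Proof.
apply: (@econt_lip _ _ _ (\sum_j `|v 0 j|)); first exact: sumr_ge0.
move=> a b; rewrite -sumrB; apply: (le_trans (ler_norm_sum _ _ _)).
rewrite mulr_suml; apply: ler_sum => j _; rewrite -mulrBl normrM mulrC.
by rewrite ler_wpM2l//; have := row_coord_le (a - b) j; rewrite !mxE.
Qed.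

Lemma econt_objective v : econt (objective v).
Proof. by apply: econtB; [exact: econt_lnmass_lin|exact: econt_dot]. Qed.

(** Up to a constant, the divergence is the objective at the mean of [tilt u]. *)
Lemma rKL_linE u th : bmf u -> rKL mu D u (lin th) =
  \int[mu]_(x in D) (tilt u x * u x)  - lnmass u + objective
    (\row_j \int[mu]_(x in D) (phi x 0 j * tilt u x)) th.
Proof.
move=> bu; have bt := bmf_tilt mu bu; have bl := bmf_lin th.
rewrite rKLE// /objective.
have -> : dot th (\row_j \int[mu]_(x in D) (phi x 0 j * tilt u x)) =
    \int[mu]_(x in D) (tilt u x * lin th x).
  under [RHS]eq_Rintegral do rewrite mulrC.
  by rewrite int_lin//; apply: eq_bigr => j _; rewrite mxE.
have -> : \int[mu]_(x in D) (tilt u x * (u x - lin th x)) =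
   \int[mu]_(x in D) (tilt u x * u x) - \int[mu]_(x in D) (tilt u x * lin th x).
  by rewrite -bintB//; [apply: eq_Rintegral => x _; rewrite mulrBr|exact: bmfM|exact: bmfM].
by move: (lnmass u) (lnmass _) => a b; ring.
Qed.

Lemma econt_rKL_lin u : bmf u -> econt (fun th => rKL mu D u (lin th)).
Proof.
move=> bu; set v := \row_j \int[mu]_(x in D) (phi x 0 j * tilt u x).
move=> a e e0; have [de de0 H] := econt_objective v a e0; exists de => // b /H.
rewrite !rKL_linE//; move: (_ - lnmass u) (objective v a) (objective v b) => k p q.
by have -> : k + p - (k + q) = p - q by ring.
Qed.

(** The quotient of two densities whose exponents are close is close to [1]. *)
Lemma econt_mean_map j : econt (fun th => mean_map th 0 j).
Proof.
have [K K0 hK] := lin_norm_bound; have [_ [M hM]] := bphi j.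
pose M' := `|M|; have hM' x : D x -> `|phi x 0 j| <= M'.
  by move=> Dx; apply: le_trans (hM x Dx) (ler_norm _).
move=> a e e0.
have ba := bmf_lin a; have bta := bmf_tilt mu ba.
pose C := M' * (expR (2 * K) * (2 * K)) + 1.
have C0 : 0 < C.
  by rewrite /C ltr_wpDl// mulr_ge0 ?normr_ge0// mulr_ge0 ?expR_ge0// mulr_ge0.
exists (Num.min 1 (e / C)); first by rewrite lt_min ltr01 divr_gt0.
move=> b; rewrite le_min => /andP[ab1 abe].
have bb := bmf_lin b; have btb := bmf_tilt mu bb.
rewrite !mxE -bintB//; [|exact: bmfM|exact: bmfM].
have b1 : bmf (fun x => phi x 0 j * tilt (lin a) x - phi x 0 j * tilt (lin b) x).
  by apply: bmfB; exact: bmfM.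
apply: (le_trans (le_normr_Rintegral mD (bmf_integrable mD muD b1))).
apply: (@le_trans _ _ (\int[mu]_(x in D) (M' * (expR (2 * K) * (2 * K * `|a - b|)) * tilt (lin a) x))); last first.
  rewrite int_tilt_cst//; move: abe; rewrite ler_pdivlMr// => abe.
  apply: le_trans abe.
  have -> : M' * (expR (2 * K) * (2 * K * `|a - b|)) = `|a - b| * (M' * (expR (2 * K) * (2 * K))) by ring.
  by rewrite /C mulrDr mulr1 lerDl.
apply: bint_le => //.
- have [mb [B hB]] := b1; split; first exact: measurableT_comp.
  by exists B => x Dx; rewrite normr_id hB.
- by apply: bmfM => //; exact: bmf_cst.
move=> x Dx; rewrite -mulrBr normrM -mulrA; apply: ler_pM => //; first exact: hM'.
have lab : `|lnmass (lin b) - lnmass (lin a)| <= K * `|a - b|.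
  rewrite distrC; apply: lnmass_lip => //.
  by move=> y Dy; rewrite -linB; exact: hK.
have hx : `|lin a x - lin b x| <= K * `|a - b| by rewrite -linB hK.
pose w := (lin b x - lin a x) - (lnmass (lin b) - lnmass (lin a)).
have hw : `|w| <= 2 * K * `|a - b|.
  by rewrite /w (le_trans (ler_normB _ _))// -mulrA mulr_natl mulr2n lerD// distrC.
have hw1 : `|w| <= 2 * K.
  by apply: (le_trans hw); rewrite ler_piMr// mulr_ge0.
have -> : tilt (lin a) x - tilt (lin b) x = tilt (lin a) x * (expR 0 - expR w).
  rewrite expR0 mulrBr mulr1; congr (_ - _); rewrite !tilt_expR -expRD; congr expR.
  by rewrite /w; move: (lnmass (lin b)) (lnmass (lin a)) => c1 c2; ring.
rewrite normrM [`|tilt _ _|]ger0_norm ?tilt_ge0// [leRHS]mulrC ler_wpM2l ?tilt_ge0//.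
apply: (le_trans (@expR_lip _ (2 * K) 0 w _ _)).
- by rewrite mulr_ge0.
- exact: le_trans (ler_norm _) hw1.
by rewrite sub0r normrN ler_wpM2l ?expR_ge0.
Qed.

(** The constant of [mle_near], made explicit because it must be the same for all
    models: it involves the measure [v] of the domain, the bound [B] on the
    exponents and the constants [G] and [G'] of the two norm inequalities, but
    neither the number of parameters nor the functions [phi].  There [L] and [U]
    bound the densities, [C0] bounds the squared distance of two densities by
    that of their exponents, [C2] the squared norm of the gradient, and [K1] the
    squared distance of the solution. *)
Definition mle_constant (v B G G' : R) : R :=
  let L := expR (- (2 * B)) / v in
  let U := expR (2 * B) / v in
  let C0 := 2 * U ^+ 2 * (1 + expR (2 * B) ^+ 2 * U ^+ 2 * v ^+ 2) in
  let C2 := 2 + 2 * (G' * C0) in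
  let K1 := 2 * C2 / (L / (8 * G)) ^+ 2 in
  K1 + expR (2 * B + 1) * U * (2 + 2 * G' * K1).

(** Barron and Sheu's argument.  On a ball around [ths] the objective is
    strongly convex, uniformly because the log-densities stay bounded there,
    and its gradient at [ths] is small; hence it has a minimiser nearby. *)
Lemma mle_near (B G G' : R) : 0 < G -> 0 < G' ->
  0 < mle_constant V B G G' /\
  forall (u : T -> R) (ths v : 'rV[R]_N) (k2 e1 e2 : R),
    bmf u -> (forall x, D x -> `|u x| <= B) ->
    (forall x, D x -> `|lin ths x| <= B) ->
    (forall h c, dot h h <= G * \int[mu]_(x in D) (lin h x - c) ^+ 2) ->
    (forall h, \int[mu]_(x in D) lin h x ^+ 2 <= G' * dot h h) ->
    (forall h x, D x -> lin h x ^+ 2 <= k2 * dot h h) ->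
    \int[mu]_(x in D) (u x - lin ths x) ^+ 2 <= e2 ->
    let mu0 := \row_j \int[mu]_(x in D) (phi x 0 j * tilt u x) in
    dot (v - mu0) (v - mu0) <= e1 -> 0 < e1 -> 0 <= k2 ->
    mle_constant V B G G' * k2 * (e1 + e2) <= 1 ->
    (exists th, mean_map th = v) /\
    forall th, mean_map th = v -> rKL mu D u (lin th) <= mle_constant V B G G' * (e1 + e2).
Proof.
move=> G0 G'0.
have V0 : 0 < V by rewrite fine_gt0// muD0 muD.
have [L LE] : exists x : R, x = expR (- (2 * B)) / V by eexists.
have [U UE] : exists x : R, x = expR (2 * B) / V by eexists.
have L0 : 0 < L by rewrite LE divr_gt0 ?expR_gt0.
have U0 : 0 < U by rewrite UE divr_gt0 ?expR_gt0.
have [C0 C0E] : exists x : R, x = 2 * U ^+ 2 * (1 + expR (2 * B) ^+ 2 * U ^+ 2 * V ^+ 2) by eexists.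
have C00 : 0 < C0.
  have p1 : 0 < 2 * U ^+ 2 by rewrite mulr_gt0 ?exprn_gt0.
  have p2 : 0 <= expR (2 * B) ^+ 2 * U ^+ 2 * V ^+ 2 by rewrite -!exprMn sqr_ge0.
  by rewrite C0E mulr_gt0//; lra.
have [C2 C2E] : exists x : R, x = 2 + 2 * (G' * C0) by eexists.
have C20 : 2 <= C2 by rewrite C2E lerDl !mulr_ge0// ltW.
have [c cE] : exists x : R, x = L / (8 * G) by eexists.
have c0 : 0 < c by rewrite cE divr_gt0// mulr_gt0.
have [K1 K1E] : exists x : R, x = 2 * C2 / c ^+ 2 by eexists.
have K10 : 0 < K1 by rewrite K1E !divr_gt0 ?exprn_gt0//; lra.
have [K2 K2E] : exists x : R, x = expR (2 * B + 1) * U * (2 + 2 * G' * K1) by eexists.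
have K20 : 0 < K2 by rewrite K2E !mulr_gt0 ?expR_gt0 ?addr_gt0 ?mulr_gt0.
have -> : mle_constant V B G G' = K1 + K2 by rewrite K2E K1E cE C2E C0E LE UE.
split; first by rewrite addr_gt0.
move=> u ths v k2 e1 e2 bu uB lB Glow Gup Gk e2P mu0 e1P e10 k20 small.
have e20 : 0 <= e2 by apply: le_trans e2P; apply: Rintegral_ge0 => x _; exact: sqr_ge0.
have e0 : 0 < e1 + e2 by lra.
have small1 : k2 * (K1 * (e1 + e2)) <= 1.
  apply: le_trans small; rewrite mulrCA -[leRHS]mulrA ler_wpM2r//; last by rewrite lerDl ltW.
  by rewrite mulr_ge0// ltW.
have bls := bmf_lin ths.
have [bt bts] := (bmf_tilt mu bu, bmf_tilt mu bls).
pose w x := u x - lin ths x.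
have bw : bmf w by exact: bmfB.
have bw2 : bmf (fun x => w x ^+ 2) by exact: bmfX.
set W := \int[mu]_(x in D) w x ^+ 2.
have W0 : 0 <= W by apply: Rintegral_ge0 => x _; exact: sqr_ge0.
have B0 : 0 <= B.
  have [x Dx] : D !=set0.
    by apply/set0P/eqP => D0; move: muD0; rewrite D0 measure0 ltxx.
  exact: le_trans (normr_ge0 _) (uB x Dx).
pose de := lnmass u - lnmass (lin ths).
have tubd x : D x -> tilt u x <= U by move=> Dx; have := tilt_bounds mD muD muD0 bu uB Dx; rewrite -UE => /andP[].
have tsbd x : D x -> L <= tilt (lin ths) x <= U by move=> Dx; rewrite LE UE; exact: tilt_bounds.
have dele : de ^+ 2 <= expR (2 * B) ^+ 2 * U ^+ 2 * V * W.
  pose a x := `|w x|.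
  have ba : bmf a.
    have [mw [M hM]] := bw; split; first exact: measurableT_comp.
    by exists M => x Dx; rewrite /a normr_id hM.
  have Ia : (\int[mu]_(x in D) a x) ^+ 2 <= V * W.
    apply: (le_trans (sqr_bint_le mD muD ba)); rewrite le_eqVlt; apply/orP; left.
    by apply/eqP; congr (_ * _); apply: eq_Rintegral => x _; rewrite /a real_normK ?num_real.
  have Ia0 : 0 <= \int[mu]_(x in D) a x by apply: Rintegral_ge0 => x _; exact: normr_ge0.
  suff H (u1 u2 : T -> R) : bmf u1 -> bmf u2 -> (forall x, D x -> tilt u1 x <= U) ->
      (forall x, D x -> `|u2 x - u1 x| <= a x) -> (forall x, D x -> `|u2 x - u1 x| <= 2 * B) ->
      lnmass u2 - lnmass u1 <= expR (2 * B) * U * \int[mu]_(x in D) a x.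
    have hB x : D x -> `|u x - lin ths x| <= 2 * B.
      by move=> Dx; rewrite (le_trans (ler_normB _ _))// mulr_natl mulr2n lerD ?uB ?lB.
    have : `|de| <= expR (2 * B) * U * \int[mu]_(x in D) a x.
      rewrite ler_norml; apply/andP; split; last first.
        by apply: H => // x Dx; have /andP[] := tsbd x Dx.
      rewrite lerNl opprB; apply: H => // x Dx; first by rewrite distrC.
      by rewrite distrC hB.
    move=> h; rewrite -[de ^+ 2]real_normK ?num_real//.
    apply: (@le_trans _ _ ((expR (2 * B) * U * \int[mu]_(x in D) a x) ^+ 2)).
      by rewrite ler_pXn2r ?nnegrE// !mulr_ge0 ?expR_ge0// ltW.
    rewrite [leLHS]exprMn -[leRHS]mulrA; apply: ler_pM; [exact: sqr_ge0|exact: sqr_ge0| |exact: Ia].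
    by rewrite exprMn.
  move=> b1 b2 t1U aP a2B; apply: (le_trans (lnmass_diff_le mD muD muD0 b1 b2)).
  have bt1 := bmf_tilt mu b1.
  rewrite -[X in _ - X](int_tilt mD muD muD0 b1) -bintB//; last exact: bmf_cross.
  rewrite -bintZ//; apply: bint_le => //.
  - by apply: bmfB => //; exact: bmf_cross.
  - by apply: bmfM => //; exact: bmf_cst.
  move=> x Dx; set z := u2 x - u1 x.
  have -> : expR z * tilt u1 x - tilt u1 x = (expR z - expR 0) * tilt u1 x by rewrite expR0; ring.
  have -> : expR (2 * B) * U * a x = (expR (2 * B) * a x) * U by ring.
  apply: (le_trans (ler_norm _)); rewrite normrM [`|tilt _ _|]ger0_norm ?tilt_ge0//.
  apply: ler_pM => //; [exact: tilt_ge0| |exact: t1U].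
  have z2 : z <= 2 * B by apply: le_trans (ler_norm _) (a2B x Dx).
  apply: (le_trans (@expR_lip _ (2 * B) z 0 z2 _)); first by rewrite mulr_ge0.
  by rewrite subr0 ler_wpM2l ?expR_ge0// /z aP.
(* the densities are close because [expR] is Lipschitz on bounded sets *)
pose fd x := tilt u x - tilt (lin ths) x.
have bfd : bmf fd by exact: bmfB.
have fdP : \int[mu]_(x in D) fd x ^+ 2 <= C0 * W.
  have fdx x : D x -> fd x ^+ 2 <= 2 * U ^+ 2 * w x ^+ 2 + 2 * U ^+ 2 * de ^+ 2.
    move=> Dx; have : `|fd x| <= U * `|w x - de|.
      pose M := ln U.
      have UM : U = expR M by rewrite lnK ?posrE.
      have h1 : u x - lnmass u <= M by rewrite -ler_expR -UM -tilt_expR tubd.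
      have h2 : lin ths x - lnmass (lin ths) <= M.
        by rewrite -ler_expR -UM -tilt_expR; have /andP[] := tsbd x Dx.
      rewrite /fd !tilt_expR UM; apply: (le_trans (expR_lip h1 h2)).
      rewrite ler_wpM2l ?expR_ge0// le_eqVlt; apply/orP; left; apply/eqP; congr `|_|.
      by rewrite /w /de; move: (lnmass u) (lnmass (lin ths)) => ? ?; ring.
    move=> h; rewrite -[_ ^+ 2 in leLHS]real_normK ?num_real//.
    apply: (@le_trans _ _ ((U * `|w x - de|) ^+ 2)).
      by rewrite ler_pXn2r ?nnegrE// mulr_ge0// ltW.
    rewrite exprMn real_normK ?num_real//.
    have -> : 2 * U ^+ 2 * w x ^+ 2 + 2 * U ^+ 2 * de ^+ 2 = U ^+ 2 * (2 * w x ^+ 2 + 2 * de ^+ 2) by ring.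
    rewrite ler_wpM2l ?sqr_ge0// -subr_ge0.
    have -> : 2 * w x ^+ 2 + 2 * de ^+ 2 - (w x - de) ^+ 2 = (w x + de) ^+ 2 by ring.
    exact: sqr_ge0.
  apply: (@le_trans _ _ (\int[mu]_(x in D) (2 * U ^+ 2 * w x ^+ 2 + 2 * U ^+ 2 * de ^+ 2))).
    apply: bint_le => //; first exact: bmfX.
    by apply: bmfD; [apply: bmfM => //; exact: bmf_cst|exact: bmf_cst].
  rewrite bintD//; [|by apply: bmfM => //; exact: bmf_cst|exact: bmf_cst].
  rewrite bintZ// Rintegral_cst// -/W.
  have -> : C0 * W = 2 * U ^+ 2 * W + 2 * U ^+ 2 * (expR (2 * B) ^+ 2 * U ^+ 2 * V * W) * V.
    by rewrite C0E; ring.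
  rewrite lerD2l ler_wpM2r ?(ltW V0)// ler_wpM2l//.
  by rewrite mulr_ge0 ?sqr_ge0.
(* by duality: [dot dl dl] is the integral of [lin dl] against [fd] *)
pose mus := mean_map ths.
have d0 : dot (mu0 - mus) (mu0 - mus) <= G' * C0 * W.
  set dl := mu0 - mus.
  have bl := bmf_lin dl.
  have E : dot dl dl = \int[mu]_(x in D) (lin dl x * fd x).
    rewrite int_lin//; apply: eq_bigr => j _; congr (_ * _); rewrite !mxE -bintB//.
    - by apply: eq_Rintegral => x _; rewrite mulrBr.
    - exact: bmfM.
    - exact: bmfM.
  have H : dot dl dl <= (2 * G')^-1 * \int[mu]_(x in D) lin dl x ^+ 2 + G' / 2 * \int[mu]_(x in D) fd x ^+ 2.
    rewrite {1}E -!bintZ//; [|exact: bmfX|exact: bmfX].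
    have b1 : bmf (fun x => (2 * G')^-1 * lin dl x ^+ 2).
      by apply: bmfM; [exact: bmf_cst|exact: bmfX].
    have b2 : bmf (fun x => G' / 2 * fd x ^+ 2).
      by apply: bmfM; [exact: bmf_cst|exact: bmfX].
    rewrite -bintD//; apply: bint_le => //; [exact: bmfM|exact: bmfD|].
    move=> x Dx; rewrite -subr_ge0.
    have -> : (2 * G')^-1 * lin dl x ^+ 2 + G' / 2 * fd x ^+ 2 - lin dl x * fd x =
       (2 * G')^-1 * (lin dl x - G' * fd x) ^+ 2 by field; rewrite gt_eqF.
    by rewrite mulr_ge0 ?sqr_ge0// invr_ge0 mulr_ge0// ltW.
  have H2 : (2 * G')^-1 * \int[mu]_(x in D) lin dl x ^+ 2 <= dot dl dl / 2.
    have -> : dot dl dl / 2 = (2 * G')^-1 * (G' * dot dl dl) by field; rewrite gt_eqF.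
    by rewrite ler_wpM2l// invr_ge0 mulr_ge0// ltW.
  have H3 : G' / 2 * \int[mu]_(x in D) fd x ^+ 2 <= G' / 2 * (C0 * W).
    by rewrite ler_wpM2l// divr_ge0// ltW.
  by rewrite -mulrA; lra.
have dv : dot (v - mus) (v - mus) <= C2 * (e1 + e2).
  have -> : v - mus = (v - mu0) + (mu0 - mus) by rewrite addrA subrK.
  set a := v - mu0; set b := mu0 - mus in d0 *.
  have := dot_sqrD a b.
  have WC : G' * C0 * W <= G' * C0 * e2.
    by rewrite ler_wpM2l// mulr_ge0// ltW.
  have : 0 <= G' * C0 * e1 by rewrite !mulr_ge0// ltW.
  move: (dot a a) (dot (a + b) (a + b)) (dot b b) d0 e1P WC => x y z d0 e1P WC h1 h2.
  by rewrite C2E; lra.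
have convex h : k2 * dot h h <= 1 ->
    c * dot h h <= objective v (ths + h) - objective v ths + dot h (v - mus).
  move=> hk; have bh := bmf_lin h.
  have lh1 x : D x -> `|lin h x| <= 1.
    move=> Dx; rewrite -(@ler_pXn2r _ 2)// ?nnegrE// expr1n real_normK ?num_real//.
    exact: le_trans (Gk h x Dx) hk.
  pose m := dot h mus.
  have m1 : `|m| <= 1.
    rewrite /m /mus dot_mean_map//.
    apply: (le_trans (le_normr_Rintegral mD (bmf_integrable mD muD _))); first exact: bmfM.
    rewrite -[leRHS](int_tilt mD muD muD0 bls); apply: bint_le => //.
      have [mb [B' hB]] := bmfM bh bts; split; first exact: measurableT_comp.
      by exists B' => x Dx; rewrite normr_id hB.
    move=> x Dx; rewrite normrM [`|tilt _ _|]ger0_norm ?tilt_ge0// ler_piMl ?tilt_ge0//.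
    exact: lh1.
  pose g x := lin h x - m.
  have bg : bmf g by apply: bmfB => //; exact: bmf_cst.
  have g2 x : D x -> `|g x| <= 2.
    by move=> Dx; rewrite (le_trans (ler_normB _ _))//; have := lh1 x Dx; lra.
  have g0 : \int[mu]_(x in D) (g x * tilt (lin ths) x) = 0.
    transitivity (\int[mu]_(x in D) (lin h x * tilt (lin ths) x - m * tilt (lin ths) x)).
      by apply: eq_Rintegral => x _; rewrite mulrBl.
    rewrite bintB//; [|exact: bmfM|by apply: bmfM => //; exact: bmf_cst].
    by rewrite (int_tilt_cst mD muD muD0 m bls) -dot_mean_map// subrr.
  have E : lnmass (fun x => lin ths x + g x) = lnmass (lin (ths + h)) - m.
    rewrite -(lnmass_addc mD muD muD0 (- m) (bmf_lin (ths + h))); rewrite !lnmassE; congr ln.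
    by apply: eq_Rintegral => x _; congr expR; rewrite /g linD; ring.
  have := lnmass_convex_lb mD muD muD0 bls bg g2 g0.
  rewrite E => H.
  have : c * dot h h <= (\int[mu]_(x in D) (g x ^+ 2 * tilt (lin ths) x)) / 8.
    have : L * \int[mu]_(x in D) g x ^+ 2 <= \int[mu]_(x in D) (g x ^+ 2 * tilt (lin ths) x).
      rewrite -bintZ//; last exact: bmfX.
      apply: bint_le => //; [by apply: bmfM; [exact: bmf_cst|exact: bmfX]|by apply: bmfM => //; exact: bmfX|].
      by move=> x Dx; rewrite mulrC ler_wpM2l ?sqr_ge0//; have /andP[] := tsbd x Dx.
    have := Glow h m; rewrite -/g => h1 h2.
    have : c * dot h h <= c * (G * \int[mu]_(x in D) g x ^+ 2) by rewrite ler_wpM2l// ltW.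
    have -> : c * (G * \int[mu]_(x in D) g x ^+ 2) = L * \int[mu]_(x in D) g x ^+ 2 / 8.
      by rewrite cE; field; rewrite gt_eqF.
    by lra.
  rewrite /objective dotDl dotBr -/m; move: H.
  by move: (lnmass _) (lnmass _) => a b; lra.
pose rho := K1 * (e1 + e2).
have rho0 : 0 < rho by rewrite mulr_gt0.
pose A := [set th : 'rV[R]_N | dot (th - ths) (th - ths) <= rho].
have cdist : econt (fun th : 'rV[R]_N => dot (th - ths) (th - ths)) by exact: econt_sqdist.
have [th thA thmin] : exists2 th, A th & forall t, A t -> objective v th <= objective v t.
  have A0 : A !=set0 by exists ths; rewrite /A /= subrr /dot big1 ?ltW// => j _; rewrite mxE mul0r.
  have cA : compact A.
    apply: bounded_closed_compact; last first.
      have /continuous_closedP := econt_continuous cdist.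
      by move=> H; exact: (H _ (@closed_le _ rho)).
    exists (`|ths| + (rho + 1)); split; first exact: num_real.
    move=> y hy th /= Ath; apply: le_trans (ltW hy).
    rewrite -[th](subrK ths) addrC (le_trans (ler_normD _ _))// lerD2l.
    apply: row_norm_le => [|j]; first by rewrite addr_ge0// ltW.
    rewrite -(@ler_pXn2r _ 2)// ?nnegrE// ?addr_ge0 ?(ltW rho0)// real_normK ?num_real//.
    apply: (@le_trans _ _ rho); last first.
      have -> : (rho + 1) ^+ 2 = rho + (rho ^+ 2 + rho + 1) by ring.
      by rewrite lerDl addr_ge0// addr_ge0 ?sqr_ge0// ltW.
    apply: le_trans Ath; rewrite /dot (bigD1 j)//= expr2 lerDl.
    by apply: sumr_ge0 => i _; rewrite -expr2 sqr_ge0.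
  have [th /set_mem Ath H] := EVT_min_rV A0 cA (continuous_subspaceT (econt_continuous (econt_objective v))).
  by exists th => // t At; apply: H; exact/mem_set.
(* on the sphere of squared radius [rho] the quadratic growth beats the gradient *)
have int : dot (th - ths) (th - ths) < rho.
  rewrite lt_neqAle thA andbT; apply/eqP => thr.
  have := convex (th - ths); rewrite thr => /(_ small1).
  have -> : ths + (th - ths) = th by rewrite addrC subrK.
  move=> H1.
  have H2 : objective v th <= objective v ths.
    by apply: thmin; rewrite /A /= subrr /dot big1 ?ltW// => j _; rewrite mxE mul0r.
  have := dot_young (th - ths) (v - mus) c0; rewrite thr => H3.
  have H4 : dot (v - mus) (v - mus) / (2 * c) <= C2 * (e1 + e2) / (2 * c).
    by rewrite ler_wpM2r// invr_ge0 mulr_ge0// ltW.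
  have H5 : C2 * (e1 + e2) / (2 * c) = c * rho / 4.
    by rewrite /rho K1E; field; rewrite gt_eqF.
  have : 0 < c * rho by rewrite mulr_gt0.
  move: H1 H2 H3; rewrite H5 in H4; move: H4.
  move: (objective v th) (objective v ths) (dot _ (v - mus)) (dot (v - mus) (v - mus) / _) (c * rho).
  by move=> a1 a2 a3 a4 a5; lra.
have thv : mean_map th = v.
  apply: critical_point.
  set dl := v - mean_map th.
  have gap : 0 < rho - dot (th - ths) (th - ths) by rewrite subr_gt0.
  have [dd dd0 H] := cdist th _ gap.
  have dl1 : 0 < `|dl| + 1 by rewrite ltr_wpDl.
  near=> t; apply: thmin; rewrite /A /=.
  have t0 : 0 < t by near: t; exact: nbhs_right_gt.
  have t1 : t <= dd / (`|dl| + 1) by near: t; apply: nbhs_right_le; rewrite divr_gt0.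
  have := H (th + t *: dl); rewrite opprD addNKr normrN normrZ (gtr0_norm t0).
  have -> : t * `|dl| <= dd.
    move: t1; rewrite ler_pdivlMr// => t1; apply: le_trans t1.
    by rewrite ler_wpM2l ?(ltW t0)//; lra.
  by move=> /(_ isT); rewrite ler_norml => /andP[]; lra.
split; first by exists th.
(* any other solution defines the same density as [th] *)
move=> th' th'v; rewrite (@rKL_mean_map u th' th)//; last by rewrite th'v.
have bth := bmf_lin th.
have wle x : D x -> `|u x - lin th x| <= 2 * B + 1.
  move=> Dx; have -> : u x - lin th x = u x - lin ths x - lin (th - ths) x by rewrite linB; ring.
  rewrite (le_trans (ler_normB _ _))// lerD//.
    by rewrite (le_trans (ler_normB _ _))// mulr_natl mulr2n lerD ?uB ?lB.
  rewrite -(@ler_pXn2r _ 2)// ?nnegrE// expr1n real_normK ?num_real//.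
  apply: (le_trans (Gk _ _ Dx)); apply: le_trans small1; rewrite ler_wpM2l//; exact: ltW.
apply: (le_trans (rKL_ub mD muD muD0 bu bth wle)).
have bd2 : bmf (fun x => (u x - lin th x) ^+ 2) by apply: bmfX; exact: bmfB.
have S1 : \int[mu]_(x in D) ((u x - lin th x) ^+ 2 * tilt u x) <= U * \int[mu]_(x in D) (u x - lin th x) ^+ 2.
  rewrite -bintZ//; apply: bint_le => //; [exact: bmfM|by apply: bmfM => //; exact: bmf_cst|].
  by move=> x Dx; rewrite mulrC ler_wpM2r ?sqr_ge0// tubd.
have S2 : \int[mu]_(x in D) (u x - lin th x) ^+ 2 <= 2 * W + 2 * (G' * rho).
  have bl := bmf_lin (th - ths); have bl2 : bmf (fun x => lin (th - ths) x ^+ 2) by exact: bmfX.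
  apply: (@le_trans _ _ (2 * W + 2 * \int[mu]_(x in D) lin (th - ths) x ^+ 2)).
    rewrite -!bintZ// -bintD//; [|by apply: bmfM => //; exact: bmf_cst|by apply: bmfM => //; exact: bmf_cst].
    apply: bint_le => //.
      by apply: bmfD; apply: bmfM => //; exact: bmf_cst.
    move=> x Dx; have -> : u x - lin th x = w x - lin (th - ths) x by rewrite /w linB; ring.
    rewrite -subr_ge0; set z := lin (th - ths) x.
    have -> : 2 * w x ^+ 2 + 2 * z ^+ 2 - (w x - z) ^+ 2 = (w x + z) ^+ 2 by ring.
    exact: sqr_ge0.
  rewrite lerD2l ler_wpM2l//; apply: (le_trans (Gup _)).
  by rewrite ler_wpM2l// ltW.
have S3 : U * \int[mu]_(x in D) (u x - lin th x) ^+ 2 <= U * (2 * W + 2 * (G' * rho)).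
  by rewrite ler_wpM2l// ltW.
have S4 : 2 * W + 2 * (G' * rho) <= (2 + 2 * G' * K1) * (e1 + e2).
  have -> : (2 + 2 * G' * K1) * (e1 + e2) = 2 * (e1 + e2) + 2 * (G' * rho) by rewrite /rho; ring.
  by rewrite lerD2r ler_wpM2l//; apply: (le_trans (e2P : W <= e2)); rewrite lerDr ltW.
apply: (@le_trans _ _ (expR (2 * B + 1) * (U * ((2 + 2 * G' * K1) * (e1 + e2))))).
  rewrite ler_wpM2l ?expR_ge0//; apply: (le_trans S1); apply: (le_trans S3).
  by rewrite ler_wpM2l// ltW.
rewrite K2E [leRHS]mulrDl -[leLHS]add0r; apply: lerD; last by rewrite !mulrA.
by apply: mulr_ge0; exact: ltW.
Unshelve. all: by end_near.
Qed.

End loglinear.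

(** * Lebesgue measure of the simplex and of its slices *)

Section tuple_insertion.
Context {R : realType} {n : nat}.
Local Notation mu := (@lebesgue_measure R).

Definition ins_fun (i : 'I_n.+1) (t : R) (y : n.-tuple R) (j : 'I_n.+1) : R :=
  oapp (fun k => tnth y k) t (unlift i j).

Definition ins (i : 'I_n.+1) (p : measurableTypeR R * n.-tuple R) : n.+1.-tuple R :=
  [tuple ins_fun i p.1 p.2 j | j < n.+1].

Lemma tnth_ins_lift i p k : tnth (ins i p) (lift i k) = tnth p.2 k.
Proof. by rewrite tnth_mktuple /ins_fun liftK. Qed.

Lemma tnth_ins i p : tnth (ins i p) i = p.1.
Proof. by rewrite tnth_mktuple /ins_fun unlift_none. Qed.

Lemma measurable_ins i : measurable_fun [set: _] (ins i).
Proof.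
apply/measurable_fun_tnthP => j.
case: (unliftP i j) => [k ->|->].
  rewrite (_ : _ \o _ = (@tnth n R ^~ k) \o snd); last first.
    by apply/funext => p /=; rewrite tnth_ins_lift.
  by apply: measurableT_comp; [exact: measurable_tnth|exact: measurable_snd].
rewrite (_ : _ \o _ = fst); last by apply/funext => p /=; rewrite tnth_ins.
exact: measurable_fst.
Qed.

End tuple_insertion.

Section lebesgue_tuple_insertion.
Context {R : realType}.
Local Notation mu := (@lebesgue_measure R).

Definition box n (A : 'I_n -> set R) : set (n.-tuple R) :=
  [set x | forall i, A i (tnth x i)].

Definition boxes n : set (set (n.-tuple R)) :=
  [set B | exists A : 'I_n -> set R, (forall i, measurable (A i)) /\ B = box A].

Lemma measurable_box n (A : 'I_n -> set R) :
  (forall i, measurable (A i)) -> measurable (box A).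
Proof.
move=> mA; have -> : box A = \bigcap_i ((@tnth n R ^~ i) @^-1` A i).
  by apply/seteqP; split => [x xA i _|x xA i]; exact: xA.
apply: fin_bigcap_measurable => // i _.
by rewrite -[X in measurable X]setTI; exact: measurable_tnth.
Qed.

Lemma measurable_tuple_boxes n : @measurable _ (n.-tuple R) = <<s @boxes n >>.
Proof.
apply/seteqP; split.
  apply: smallest_sub; first exact: smallest_sigma_algebra.
  case: n => [|n]; first by rewrite big_ord0.
  rewrite -bigcup_mkord_ord; apply: bigcup_sub => i Ii _ [B mB <-].
  apply: sub_sigma_algebra; exists (fun j => if j == inord i then B else setT); split.
    by move=> j; case: ifPn.
  apply/seteqP; split => [x [_ Bx] j|x xB]; rewrite /box /=.
    by case: ifPn => // /eqP ->.
  by split => //; have := xB (inord i); rewrite eqxx.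
apply: smallest_sub; first exact: sigma_algebra_measurable.
by move=> _ [A [mA ->]]; exact: measurable_box.
Qed.

Lemma boxesI n : setI_closed (@boxes n).
Proof.
move=> _ _ [A [mA ->]] [B [mB ->]]; exists (fun i => A i `&` B i); split.
  by move=> i; exact: measurableI.
apply/seteqP; split => x /=; first by move=> [xA xB] i; split; [exact: xA|exact: xB].
by move=> xAB; split => i; have [] := xAB i.
Qed.

(** Lebesgue measure is defined by adding the first coordinate; a measure is
    determined by its values on boxes, so any coordinate can be added last. *)
Lemma lebesgue_tuple_ins n (i : 'I_n.+1) (B : set (n.+1.-tuple R)) : measurable B ->
  lebesgue_tuple n.+1 B = (mu \x lebesgue_tuple n)%E (ins i @^-1` B).
Proof.
have mf := @measurable_ins R n i.
pose m2 : {measure set (n.+1.-tuple R) -> \bar R} :=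
  measure_function_pushforward__canonical__measure_function_Measure (mu \x lebesgue_tuple n)%E mf.
move=> mB; pose g k : set (n.+1.-tuple R) := box (fun=> `[- k%:R, k%:R]%classic).
apply: (@measure_unique _ _ _ (@boxes n.+1) g _ _ _ _ (lebesgue_tuple n.+1) m2) => //.
- exact: measurable_tuple_boxes.
- exact: boxesI.
- by move=> k; exists (fun=> `[- k%:R, k%:R]%classic); split.
- rewrite -subTset => x _.
  have [k hk] : exists k : nat, forall j, `|tnth x j| <= k%:R.
    exists (\max_j Num.truncn (`|tnth x j|)).+1 => j.
    apply: (le_trans (ltW (truncnS_gt _))).
    by rewrite ler_nat ltnS; exact: (leq_bigmax j).
  by exists k => // j; rewrite /= in_itv /= -ler_norml.
- move=> _ [A [mA ->]]; rewrite [LHS](lebesgue_tuple_prod mA).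
  rewrite /= /pushforward (_ : _ @^-1` _ = A i `*` box (fun k => A (lift i k))); last first.
    apply/seteqP; split => [[t y] H|[t y] [/= H1 H2] j].
      split; first by have := H i; rewrite tnth_ins.
      by move=> k; have := H (lift i k); rewrite tnth_ins_lift.
    case: (unliftP i j) => [k ->|->]; first by rewrite tnth_ins_lift; exact: H2.
    by rewrite tnth_ins.
  rewrite product_measure1E//; [|exact: mA|by apply: measurable_box => k; exact: mA].
  rewrite [X in _ = (_ * X)%E](lebesgue_tuple_prod (fun k => mA (lift i k))).
  by rewrite (bigD1_ord i).
- move=> k; rewrite [X in (X < _)%E](@lebesgue_tuple_prod R n.+1 (fun=> `[- k%:R, k%:R]%classic))//.
  under eq_bigr do rewrite lebesgue_measure_itv/=.
  elim: n.+1 => [|p ih]; first by rewrite big_ord0 ltry.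
  rewrite big_ord_recl lte_mul_pinfty//; last first.
    by case: ifP.
  by case: ifP => // h; rewrite -EFinB lee_fin subr_ge0; exact: ltW.
Qed.

Lemma ge0_integral_ins n (i : 'I_n.+1) (F : n.+1.-tuple R -> \bar R) :
  measurable_fun [set: _] F -> (forall x, (0 <= F x)%E) ->
  (\int[lebesgue_tuple n.+1]_x F x =
   \int[mu]_t \int[lebesgue_tuple n]_y F (ins i (t, y)))%E.
Proof.
move=> mF F0; have mf := @measurable_ins R n i.
pose m2 : {measure set (n.+1.-tuple R) -> \bar R} :=
  measure_function_pushforward__canonical__measure_function_Measure (mu \x lebesgue_tuple n)%E mf.
transitivity (\int[m2]_x F x)%E.
  by apply: eq_measure_integral => A mA _; exact: lebesgue_tuple_ins.
rewrite (ge0_integral_pushforward mf)//= preimage_setT fubini_tonelli1//.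
exact: measurableT_comp.
Qed.

Lemma measurable_fun_ins_int n (i : 'I_n.+1) (F : n.+1.-tuple R -> \bar R) :
  measurable_fun [set: _] F -> (forall x, (0 <= F x)%E) ->
  measurable_fun [set: R] (fun t => \int[lebesgue_tuple n]_y F (ins i (t, y)))%E.
Proof.
move=> mF F0; have mf := @measurable_ins R n i.
apply: (@measurable_fun_fubini_tonelli_F _ _ _ _ _ (lebesgue_tuple n) (F \o ins i)).
  exact: measurableT_comp.
by move=> x; exact: F0.
Qed.

Lemma measurable_le_set d (T : measurableType d) (f g : T -> R) :
  measurable_fun setT f -> measurable_fun setT g -> measurable [set x | f x <= g x].
Proof.
move=> mf mg; have := measurable_fun_ler mf mg.
move=> /(_ measurableT [set true]); rewrite setTI; apply.
by [].
Qed.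

Lemma lebesgue_tuple_cons n (S : set (n.+1.-tuple R)) : measurable S ->
  lebesgue_tuple n.+1 S = (\int[mu]_x lebesgue_tuple n [set y | S (tcons (x, y))])%E.
Proof.
move=> mS; rewrite /= /lebesgue_tcons /pushforward /= /product_measure1 /=.
apply: eq_integral => x _ /=; congr (lebesgue_tuple n _).
by rewrite /xsection; apply/seteqP; split => y /=; rewrite in_setE.
Qed.

Lemma integral_deriv_poly (p : {poly R}) (a b : R) : a <= b ->
  (\int[mu]_(x in `[a, b]) (p^`().[x])%:E = (p.[b] - p.[a])%:E)%E.
Proof.
rewrite le_eqVlt => /predU1P[->|ab].
  by rewrite set_itv1 integral_set1 subrr.
rewrite EFinB; apply: continuous_FTC2 => //.
- by apply: continuous_subspaceT; exact: continuous_horner.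
- split.
  + by move=> x _; case: (is_derive_poly p x).
  + by apply: cvg_at_right_filter; exact: continuous_horner.
  + by apply: cvg_at_left_filter; exact: continuous_horner.
- by move=> x _; rewrite derive1E; case: (is_derive_poly p x).
Qed.

End lebesgue_tuple_insertion.

Section polynomials_on_unit_interval.
Context {R : realType}.
Local Notation I01 := (`[0%R, 1%R]%classic : set R).

Lemma bmf_horner (p : {poly R}) : bmf I01 (horner p).
Proof.
split.
  apply: (@measurable_funS _ _ _ _ setT) => //.
  by apply: continuous_measurable_fun; exact: continuous_horner.
exists (\sum_(i < size p) `|p`_i|) => x /=; rewrite in_itv /= => /andP[x0 x1].
rewrite horner_coef; apply: (le_trans (ler_norm_sum _ _ _)); apply: ler_sum => i _.
by rewrite normrM ler_piMr// normrX exprn_ile1// ger0_norm.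
Qed.

End polynomials_on_unit_interval.

Section ordered_volume.
Context {R : realType}.
Local Notation mu := (@lebesgue_measure R).

(** The other coordinates of a point of the simplex whose coordinate [i] may move
    from [s] to [t], see [ins_simplex2]; the lower end [lo] is there for the
    induction on the dimension. *)
Definition ordered_in n (lo s t : R) (i : nat) : set (n.-tuple R) :=
  [set y | (forall k : 'I_n, if (k < i)%N then lo <= tnth y k <= s else t <= tnth y k <= 1) /\
           (forall k l : 'I_n, (k <= l)%N -> tnth y k <= tnth y l)].

Lemma measurable_ordered_in n lo s t i : measurable (@ordered_in n lo s t i).
Proof.
have mt k : measurable_fun setT (fun y : n.-tuple R => tnth y k) := measurable_tnth k.
have -> : @ordered_in n lo s t i =
   (\bigcap_(k in [set: 'I_n]) ([set y | (if (k < i)%N then lo else t) <= tnth y k] `&`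
      [set y | tnth y k <= (if (k < i)%N then s else 1)])) `&`
   (\bigcap_(k in [set: 'I_n]) \bigcap_(l in [set: 'I_n])
      (if (k <= l)%N then [set y : n.-tuple R | tnth y k <= tnth y l] else setT)).
  apply/seteqP; split => y /= [H1 H2]; split.
  - by move=> k _; have := H1 k; case: ifP => _ /andP[].
  - by move=> k _ l _; case: ifP => //= /H2.
  - by move=> k; have [] := H1 k I; case: ifP => /= _ -> ->.
  - by move=> k l kl; have := H2 k I l I; rewrite kl.
apply: measurableI.
  apply: fin_bigcap_measurable => // k _; apply: measurableI; exact: measurable_le_set.
apply: fin_bigcap_measurable => // k _; apply: fin_bigcap_measurable => // l _.
by case: ifP => // _; exact: measurable_le_set.
Qed.

Lemma ordered_in_cons0 n lo s t x (y : n.-tuple R) :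
  ordered_in lo s t 0 (tcons (x, y)) <-> t <= x <= 1 /\ ordered_in lo s x 0 y.
Proof.
split=> [[H1 H2]|[x01 [H1 H2]]].
  have hx := H1 ord0; rewrite /= tnth0 in hx; split => //; split => [k|k l kl] /=.
    have := H1 (lift ord0 k); rewrite /= tnthS => /andP[_ ->]; rewrite andbT.
    by have := H2 ord0 (lift ord0 k) (leq0n _); rewrite tnth0 tnthS.
  by have := H2 (lift ord0 k) (lift ord0 l); rewrite !tnthS; apply; rewrite !lift0.
have /andP[tx x1] := x01.
split => [k|k l] /=.
  case: (unliftP ord0 k) => [k' ->|->]; last by rewrite tnth0.
  by rewrite tnthS; have /andP[xk ->] := H1 k'; rewrite andbT (le_trans tx).
case: (unliftP ord0 k) => [k' ->|->]; case: (unliftP ord0 l) => [l' ->|->]; rewrite ?tnthS ?tnth0 ?lift0//.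
  exact: H2.
by move=> _; have /andP[] := H1 l'.
Qed.

Lemma ordered_in_consS n lo s t i x (y : n.-tuple R) : s <= t ->
  ordered_in lo s t i.+1 (tcons (x, y)) <-> lo <= x <= s /\ ordered_in x s t i y.
Proof.
move=> st; split=> [[H1 H2]|[x01 [H1 H2]]].
  have hx := H1 ord0; rewrite /= tnth0 in hx; split => //; split => [k|k l kl] /=.
    have := H1 (lift ord0 k); rewrite /= tnthS ?lift0 ?ltnS; case: ifP => // _ /andP[_ ->]; rewrite andbT.
    by have := H2 ord0 (lift ord0 k) (leq0n _); rewrite tnth0 tnthS.
  by have := H2 (lift ord0 k) (lift ord0 l); rewrite !tnthS; apply; rewrite !lift0.
have /andP[tx x1] := x01.
split => [k|k l] /=.
  case: (unliftP ord0 k) => [k' ->|->]; last by rewrite tnth0.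
  rewrite tnthS ?lift0 ?ltnS; have := H1 k'; case: ifP => // _ /andP[xk ->].
  by rewrite andbT (le_trans tx).
case: (unliftP ord0 k) => [k' ->|->]; case: (unliftP ord0 l) => [l' ->|->]; rewrite ?tnthS ?tnth0 ?lift0//.
  exact: H2.
move=> _; have := H1 l'; case: ifP => _ /andP[h _] //.
by rewrite (le_trans x1)// (le_trans st).
Qed.

Lemma integral_monomial (c a b : R) n : a <= b ->
  (\int[mu]_(x in `[a, b]) ((c - x) ^+ n / n`!%:R)%:E =
   (((c - a) ^+ n.+1 - (c - b) ^+ n.+1) / n.+1`!%:R)%:E)%E.
Proof.
move=> ab; pose p : {poly R} := (- (n.+1)`!%:R^-1) *: (c%:P - 'X) ^+ n.+1.
have n0 : n`!%:R != 0 :> R by rewrite pnatr_eq0 -lt0n fact_gt0.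
have n1 : n.+1%:R != 0 :> R by rewrite pnatr_eq0.
have pE x : p.[x] = - (c - x) ^+ n.+1 / n.+1`!%:R by rewrite /p !hornerE; ring.
have := integral_deriv_poly p ab; rewrite !pE.
have -> : - (c - b) ^+ n.+1 / n.+1`!%:R - - (c - a) ^+ n.+1 / n.+1`!%:R =
   ((c - a) ^+ n.+1 - (c - b) ^+ n.+1) / n.+1`!%:R by ring.
move=> <-; apply: eq_integral => x _; congr EFin.
rewrite /p derivZ deriv_exp derivB derivC derivX sub0r /= -[_ *+ n.+1]scaler_nat.
rewrite !(hornerZ, hornerM, horner_exp, hornerD, hornerN, hornerC, hornerX) factS natrM.
by move: (n.+1%:R : R) n1 => k n1; field; rewrite n0 n1.
Qed.

Lemma integral_restrict_itv (S : R -> \bar R) (f : R -> R) (a b : R) :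
  (forall x, S x = if a <= x <= b then (f x)%:E else 0%E) ->
  (\int[mu]_x S x = \int[mu]_(x in `[a, b]) (f x)%:E)%E.
Proof.
move=> H; rewrite [RHS]integral_mkcond; apply: eq_integral => x _.
by rewrite H patchE mem_setE in_itv.
Qed.

(** Integrating out the first entry [x] leaves a set of the same form: the lower
    end becomes [x] when [i > 0], and [t] becomes [x] when [i = 0]. *)
Lemma volume_ordered_in n lo s t i : (i <= n)%N -> lo <= s -> s <= t -> t <= 1 ->
  lebesgue_tuple n (@ordered_in n lo s t i) =
  ((s - lo) ^+ i / i`!%:R * ((1 - t) ^+ (n - i) / (n - i)`!%:R))%:E.
Proof.
elim: n lo s t i => [|n ih] lo s t i.
  rewrite leqn0 => /eqP -> _ _ _; rewrite /= diracE mem_set ?expr0 ?fact0 ?invr1 ?mul1r//.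
  by split => -[].
move=> iN los st t1; rewrite lebesgue_tuple_cons; last exact: measurable_ordered_in.
case: i iN => [_|i]; last rewrite ltnS => iN.
  rewrite (@integral_restrict_itv _ (fun x => (1 - x) ^+ n / n`!%:R) t 1).
    by rewrite integral_monomial// subrr expr0n subr0 expr0 fact0 invr1 !mul1r.
  move=> x; case: ifPn => [/andP[tx x1]|tx].
    rewrite (_ : [set y | _] = ordered_in x x x 0); last first.
      apply/seteqP; split => y /=; rewrite ordered_in_cons0.
        by move=> [_ [h1 h2]]; split.
      by move=> [h1 h2]; split; [rewrite tx|split].
    by rewrite ih// expr0 fact0 invr1 !mul1r subn0.
  rewrite (_ : [set y | _] = set0) ?measure0//.
  by apply/seteqP; split => y //=; rewrite ordered_in_cons0 => -[]; rewrite (negbTE tx).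
rewrite (@integral_restrict_itv _ (fun x => (1 - t) ^+ (n - i) / (n - i)`!%:R * ((s - x) ^+ i / i`!%:R)) lo s).
  under eq_integral do rewrite EFinM.
  rewrite integralZl//=; last first.
    apply: continuous_compact_integrable; first exact: segment_compact.
    apply: continuous_subspaceT.
    rewrite (_ : (fun x : R => (s - x) ^+ i / i`!%:R) = horner (i`!%:R^-1 *: (s%:P - 'X) ^+ i)).
      exact: continuous_horner.
    by apply/funext => x; rewrite !hornerE mulrC.
  by rewrite integral_monomial// subrr expr0n subr0 -EFinM subSS mulrC.
move=> x; case: ifPn => [/andP[lox xs]|tx].
  rewrite (_ : [set y | _] = ordered_in x s t i); last first.
    apply/seteqP; split => y /=; rewrite ordered_in_consS//; first by move=> [].
    by move=> h; split => //; rewrite lox.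
  by rewrite ih// mulrC.
rewrite (_ : [set y | _] = set0) ?measure0//.
by apply/seteqP; split => y //=; rewrite ordered_in_consS// => -[]; rewrite (negbTE tx).
Qed.

End ordered_volume.

Section simplex_slices.
Context {R : realType} {n : nat}.
Local Notation mu := (@lebesgue_measure R).
Local Notation Delta := (@simplex R n.+1).

(** The simplex is convex in each coordinate, so it is enough to look at both ends
    of [[s, t]]: the other entries lie below [s] or above [t]. *)
Lemma ins_simplex2 (i : 'I_n.+1) s t (y : n.-tuple R) : 0 <= s -> s <= t -> t <= 1 ->
  (Delta (ins i (s, y)) /\ Delta (ins i (t, y))) <-> ordered_in 0 s t i y.
Proof.
move=> s0 st t1; split.
  move=> [[s01 sinc] [t01 tinc]]; split => [k|k l kl].
    have sk := s01 (lift i k); rewrite tnth_ins_lift in sk.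
    case: ifPn => ki.
      have := sinc (lift i k) i; rewrite tnth_ins tnth_ins_lift /= => H.
      by move: sk => /andP[-> _] /=; apply: H; rewrite /bump (leqNgt i k) ki add0n ltnW.
    have := tinc i (lift i k); rewrite tnth_ins tnth_ins_lift /= => H.
    move: sk => /andP[_ ->]; rewrite andbT; apply: H.
    by rewrite /bump (leqNgt i k) ki add1n ltnW// ltnS leqNgt.
  have := sinc (lift i k) (lift i l); rewrite !tnth_ins_lift; apply.
  by rewrite /= leq_bump2.
move=> [H1 H2].
suff P u : s <= u <= t -> Delta (ins i (u, y)).
  by split; apply: P; rewrite lexx ?st.
move=> /andP[su ut]; split => [j|j l].
  case: (unliftP i j) => [k ->|->].
    rewrite tnth_ins_lift; have := H1 k; case: ifP => _ /andP[h1 h2].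
      by rewrite h1 (le_trans h2)// (le_trans st).
    by rewrite h2 andbT (le_trans _ h1)// (le_trans s0).
  by rewrite tnth_ins /= (le_trans s0)//= (le_trans ut).
case: (unliftP i j) => [k ->|->]; case: (unliftP i l) => [k' ->|->].
- rewrite !tnth_ins_lift /= leq_bump2; exact: H2.
- rewrite tnth_ins_lift tnth_ins /=; have := H1 k; case: ifPn => [_ /andP[_ h] _|ki _].
    exact: le_trans h su.
  by rewrite /bump (leqNgt i k) ki add1n => h; rewrite h in ki.
- rewrite tnth_ins_lift tnth_ins /=; have := H1 k'; case: ifPn => [ki _|_ /andP[h _] _].
    by rewrite /bump (leqNgt i k') ki add0n leqNgt ki.
  exact: le_trans ut h.
- by rewrite tnth_ins.
Qed.

Lemma ins_simplex_01 (i : 'I_n.+1) t (y : n.-tuple R) : Delta (ins i (t, y)) -> 0 <= t <= 1.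
Proof. by move=> [H _]; have := H i; rewrite tnth_ins. Qed.

Lemma measurable_simplex : measurable (@simplex R n).
Proof.
rewrite (_ : @simplex R n = ordered_in 0 1 0 n).
  exact: measurable_ordered_in.
by apply/seteqP; split => x [H1 H2]; split => // k; have := H1 k; rewrite ltn_ord.
Qed.

Lemma qE (i : 'I_n.+1) (t : R) : q n.+1 i.+1 t =
  (t ^+ i / i`!%:R * ((1 - t) ^+ (n - i) / (n - i)`!%:R)) * \1_(`[0%R, 1%R]%classic : set R) t.
Proof. by rewrite /q subSS subn1 invfM /=; ring. Qed.

Lemma q_ge0 (i : 'I_n.+1) (t : R) : 0 <= q n.+1 i.+1 t.
Proof.
rewrite qE indicE mem_setE in_itv /=; have [/andP[t0 t1]|_] := boolP (0 <= t <= 1); last by rewrite mulr0.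
by rewrite mulr1 !mulr_ge0// ?exprn_ge0// ?invr_ge0// subr_ge0.
Qed.

End simplex_slices.

Section simplex_marginals.
Context {R : realType} {n : nat}.
Local Notation mu := (@lebesgue_measure R).
Local Notation Delta := (@simplex R n.+1).
Local Notation lam := (@lebesgue_tuple R).
Implicit Types (i : 'I_n.+1).

Lemma bmf_q i : bmf (`[0%R, 1%R]%classic : set R) (@q R n.+1 i.+1).
Proof.
pose p : {poly R} := ((n.+1 - i.+1)`!%:R * (i.+1 - 1)`!%:R)^-1 *: ((1 - 'X) ^+ (n.+1 - i.+1) * 'X ^+ (i.+1 - 1)).
apply: (eq_bmf _ (bmf_horner p)) => t t01.
by rewrite /q indicE mem_set// /p !hornerE /=; ring.
Qed.

Lemma measurable_slice i t : measurable [set y : n.-tuple R | Delta (ins i (t, y))].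
Proof.
have h := @measurable_ins R n i.
have h2 : measurable_fun setT (fun y : n.-tuple R => (t, y) : measurableTypeR R * n.-tuple R).
  exact: measurable_pair1.
have := measurableT_comp h h2 => /(_ measurableT _ (@measurable_simplex R n.+1)).
by rewrite setTI.
Qed.

Lemma slice_volume i t : 0 <= t <= 1 ->
  lam n [set y | Delta (ins i (t, y))] = (q n.+1 i.+1 t)%:E.
Proof.
move=> /andP[t0 t1]; rewrite (_ : [set y | _] = ordered_in 0 t t i).
  rewrite volume_ordered_in ?subr0 -1?ltnS//.
  by rewrite qE indicE mem_setE in_itv /= t0 t1 mulr1.
by apply/seteqP; split => y /=; [move=> H|]; rewrite -?ins_simplex2//; move=> [].
Qed.

(** For [s <= t] the volume is [s^i / i! (1 - t)^(n - i) / (n - i)!], and the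
    product of the marginals has two more factors, which are at most [1]. *)
Lemma slice_volume2_ge i s t : 0 <= s <= 1 -> 0 <= t <= 1 ->
  ((q n.+1 i.+1 s * q n.+1 i.+1 t)%:E <=
   lam n [set y | Delta (ins i (s, y)) /\ Delta (ins i (t, y))])%E.
Proof.
wlog st : s t / s <= t => [H s01 t01|].
  have [st|/ltW ts] := leP s t; first exact: H.
  rewrite mulrC (_ : [set y | _] = [set y | Delta (ins i (t, y)) /\ Delta (ins i (s, y))]); first exact: H.
  by apply/seteqP; split => y /= [].
move=> /andP[s0 s1] /andP[t0 t1].
rewrite (_ : [set y | _] = ordered_in 0 s t i); last first.
  by apply/seteqP; split => y /=; rewrite ins_simplex2.
rewrite volume_ordered_in ?subr0 -1?ltnS// lee_fin !qE !indicE !mem_setE !in_itv /= s0 s1 t0 t1 !mulr1.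
have f1 k : (k`!%:R^-1 : R) <= 1.
  by rewrite invf_le1 ?ltr0n ?fact_gt0// ler1n fact_gt0.
have f0 k : 0 <= (k`!%:R^-1 : R) by rewrite invr_ge0.
set a := s ^+ i / i`!%:R; set b := (1 - s) ^+ (n - i) / _.
set c := t ^+ i / i`!%:R; set e := (1 - t) ^+ (n - i) / _.
have a0 : 0 <= a by rewrite mulr_ge0// exprn_ge0.
have e0 : 0 <= e by rewrite mulr_ge0// exprn_ge0// subr_ge0.
have b0 : 0 <= b by rewrite mulr_ge0// exprn_ge0// subr_ge0.
have c0 : 0 <= c by rewrite mulr_ge0// exprn_ge0.
have b1 : b <= 1 by rewrite mulr_ile1 ?f1 ?f0// ?exprn_ge0 ?exprn_ile1// ?subr_ge0//; lra.
have c1 : c <= 1 by rewrite mulr_ile1 ?f1 ?f0// ?exprn_ge0 ?exprn_ile1.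
have -> : a * b * (c * e) = (b * c) * (a * e) by ring.
clearbody a b c e.
by rewrite ler_piMl ?mulr_ge0// mulr_ile1.
Qed.

Lemma ge0_simplex_marginal i (g : R -> R) :
  measurable_fun [set: R] g -> (forall t, 0 <= g t) ->
  (\int[lam n.+1]_(x in Delta) (g (tnth x i))%:E =
   \int[mu]_(t in `[0%R, 1%R]) (g t * q n.+1 i.+1 t)%:E)%E.
Proof.
move=> mg g0; have mD := @measurable_simplex R n.+1.
have mF : measurable_fun setT ((fun x : n.+1.-tuple R => (g (tnth x i))%:E) \_ Delta).
  apply/(measurable_restrictT _ mD)/measurable_EFinP; apply: (@measurable_funS _ _ _ _ setT) => //.
  by apply: measurableT_comp => //; exact: measurable_tnth.
rewrite integral_mkcond (ge0_integral_ins i mF); last first.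
  by move=> x; rewrite patchE; case: ifP => // _; rewrite lee_fin.
rewrite [RHS]integral_mkcond; apply: eq_integral => t _.
rewrite patchE mem_setE in_itv /=.
transitivity (\int[lam n]_(y in [set y | Delta (ins i (t, y))]) (g t)%:E)%E.
  rewrite [RHS]integral_mkcond; apply: eq_integral => y _; rewrite !patchE tnth_ins /=.
  by congr (if _ then _ else _); apply/idP/idP; rewrite !in_setE.
rewrite integral_cst; last exact: measurable_slice.
case: ifPn => t01; first by rewrite EFinM; congr (_ * _)%E; exact: slice_volume.
rewrite [X in (_ * X)%E](_ : _ = 0%E) ?mule0//.
rewrite (_ : mkset _ = set0) ?measure0//.
by apply/seteqP; split => y //= /ins_simplex_01; rewrite (negbTE t01).
Qed.

(** Two points of the simplex that differ in their [i]-th coordinate only: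
    their joint volume dominates the product of the marginals, so a function
    of the [i]-th coordinate cannot be compensated by the other coordinates. *)
Lemma simplex_variance i (g : R -> R) (S : n.+1.-tuple R -> R) :
  measurable_fun [set: R] g -> (exists M, forall t, `|g t| <= M) ->
  measurable_fun [set: _] S ->
  (forall s t y, S (ins i (s, y)) - S (ins i (t, y)) = g s - g t) ->
  \int[mu]_(t in `[0%R, 1%R]) (g t * q n.+1 i.+1 t) = 0 ->
  (((\int[mu]_(t in `[0%R, 1%R]) q n.+1 i.+1 t) *
   (\int[mu]_(t in `[0%R, 1%R]) (g t ^+ 2 * q n.+1 i.+1 t)))%:E <=
   2%:E * \int[lam n.+1]_(x in Delta) (S x ^+ 2)%:E)%E.
Proof.
move=> mg [M hM] mS Sg g0; have mD := @measurable_simplex R n.+1.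
pose I01 : set R := `[0%R, 1%R]%classic.
have mI : measurable I01 by exact: measurable_itv.
have muI : mu I01 = 1%E by rewrite /I01 lebesgue_measure_itv /= lte_fin ltr01 oppr0 adde0.
have muIoo : (mu I01 < +oo)%E by rewrite muI ltry.
set Q := \int[mu]_(t in I01) q n.+1 i.+1 t.
set A := \int[mu]_(t in I01) (g t ^+ 2 * q n.+1 i.+1 t).
pose F := (fun x : n.+1.-tuple R => (S x ^+ 2)%:E) \_ Delta.
have mF : measurable_fun setT F.
  apply/(measurable_restrictT _ mD)/measurable_EFinP; apply: (@measurable_funS _ _ _ _ setT) => //.
  exact: measurable_funX.
have F0 x : (0 <= F x)%E by rewrite /F patchE; case: ifP => // _; rewrite lee_fin sqr_ge0.
pose B t := (\int[lam n]_y F (ins i (t, y)))%E.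
have mB : measurable_fun setT B by exact: measurable_fun_ins_int.
have B0 t : (0 <= B t)%E by exact: integral_ge0.
have EB : (\int[lam n.+1]_(x in Delta) (S x ^+ 2)%:E = \int[mu]_t B t)%E.
  by rewrite integral_mkcond (ge0_integral_ins i mF).
set IS := (\int[lam n.+1]_(x in Delta) (S x ^+ 2)%:E)%E in EB *.
have IS0 : (0 <= IS)%E by apply: integral_ge0 => x _; rewrite lee_fin sqr_ge0.
have IB : (\int[mu]_(t in I01) B t <= IS)%E.
  by rewrite EB; apply: ge0_subset_integral.
have mFins t : measurable_fun setT (fun y : n.-tuple R => F (ins i (t, y))).
  apply: (measurableT_comp mF); apply: (measurableT_comp (@measurable_ins R n i)).
  exact: measurable_pair1.
(* [g s - g t] is a difference of two values of [S], so its square is at most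
   twice the sum of their squares, on the slice common to [s] and [t] *)
have key s t : 0 <= s <= 1 -> 0 <= t <= 1 ->
    (((g s - g t) ^+ 2 * (q n.+1 i.+1 s * q n.+1 i.+1 t))%:E <= 2%:E * B s + 2%:E * B t)%E.
  move=> s01 t01; pose W := [set y : n.-tuple R | Delta (ins i (s, y)) /\ Delta (ins i (t, y))].
  have mW : measurable W.
    rewrite (_ : W = [set y | Delta (ins i (s, y))] `&` [set y | Delta (ins i (t, y))])//.
    by apply: measurableI; exact: measurable_slice.
  apply: (@le_trans _ _ (((g s - g t) ^+ 2)%:E * lam n W)%E).
    by rewrite EFinM lee_wpmul2l ?lee_fin ?sqr_ge0// slice_volume2_ge.
  rewrite -integral_cst// /B -!ge0_integralZl//=.
  rewrite -ge0_integralD//=; last 4 first.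
  - by move=> y _; rewrite mule_ge0.
  - exact: measurable_funeM.
  - by move=> y _; rewrite mule_ge0.
  - exact: measurable_funeM.
  rewrite integral_mkcond; apply: ge0_le_integral => //=.
  - by move=> y _; rewrite patchE; case: ifP => // _; rewrite lee_fin sqr_ge0.
  - by apply/(measurable_restrictT _ mW).
  - by apply: emeasurable_funD; exact: measurable_funeM.
  move=> y _; rewrite patchE; case: ifPn => [/[!inE] -[Ds Dt]|_]; last first.
    by rewrite adde_ge0// mule_ge0.
  rewrite /F !patchE !mem_set// -!EFinM -EFinD lee_fin -(Sg s t y) -subr_ge0.
  set a := S _; set b := S _.
  have -> : 2 * a ^+ 2 + 2 * b ^+ 2 - (a - b) ^+ 2 = (a + b) ^+ 2 by ring.
  exact: sqr_ge0.
have bq : bmf I01 (q n.+1 i.+1) by exact: bmf_q.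
have bg : bmf I01 g by split; [exact: measurable_funS mg|exists M].
have bgq : bmf I01 (fun t => g t * q n.+1 i.+1 t) by exact: bmfM.
have bg2q : bmf I01 (fun t => g t ^+ 2 * q n.+1 i.+1 t) by apply: bmfM => //; exact: bmfX.
have A0 : 0 <= A by apply: Rintegral_ge0 => t _; rewrite mulr_ge0 ?sqr_ge0 ?q_ge0.
have Q0 : 0 <= Q by apply: Rintegral_ge0 => t _; rewrite q_ge0.
(* integrate in [t]; the cross term vanishes because [g] is centred *)
have inner s : 0 <= s <= 1 ->
    ((q n.+1 i.+1 s * (g s ^+ 2 * Q + A))%:E <= 2%:E * B s + 2%:E * IS)%E.
  move=> s01.
  have -> : (q n.+1 i.+1 s * (g s ^+ 2 * Q + A))%:E =
      (\int[mu]_(t in I01) ((g s - g t) ^+ 2 * (q n.+1 i.+1 s * q n.+1 i.+1 t))%:E)%E.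
    have b1 : bmf I01 (fun t => q n.+1 i.+1 s * g s ^+ 2 * q n.+1 i.+1 t).
      by apply: bmfM => //; exact: bmf_cst.
    have b2 : bmf I01 (fun t => 2 * q n.+1 i.+1 s * g s * (g t * q n.+1 i.+1 t)).
      by apply: bmfM => //; exact: bmf_cst.
    have b3 : bmf I01 (fun t => q n.+1 i.+1 s * (g t ^+ 2 * q n.+1 i.+1 t)).
      by apply: bmfM => //; exact: bmf_cst.
    transitivity (\int[mu]_(t in I01) (q n.+1 i.+1 s * g s ^+ 2 * q n.+1 i.+1 t
        - 2 * q n.+1 i.+1 s * g s * (g t * q n.+1 i.+1 t)
        + q n.+1 i.+1 s * (g t ^+ 2 * q n.+1 i.+1 t))%:E)%E; last first.
      by apply: eq_integral => t _; congr EFin; ring.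
    rewrite bintE//; last by apply: bmfD => //; exact: bmfB.
    rewrite bintD//; last exact: bmfB.
    rewrite bintB// !bintZ// g0 -/Q -/A; congr EFin; ring.
  apply: (@le_trans _ _ (\int[mu]_(t in I01) (2%:E * B s + 2%:E * B t))%E).
    apply: ge0_le_integral => //=.
    - by move=> t _; rewrite lee_fin; apply: mulr_ge0; [exact: sqr_ge0|apply: mulr_ge0; exact: q_ge0].
    - apply/measurable_EFinP; apply: measurable_funM; last first.
        by apply: measurable_funM => //; exact: bq.1.
      by apply: measurable_funX; apply: measurable_funB => //; exact: bg.1.
    - by apply: emeasurable_funD => //; apply: measurable_funeM; exact: measurable_funS mB.
    - by move=> t; rewrite /I01 /= in_itv /= => t01; exact: key.
  rewrite ge0_integralD//=; last 3 first.
  - by move=> t _; rewrite mule_ge0.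
  - by move=> t _; rewrite mule_ge0.
  - by apply: measurable_funeM; exact: measurable_funS mB.
  rewrite integral_cst// [X in (_ * X + _)%E]muI mule1 leeD2l// ge0_integralZl//=.
    by rewrite lee_wpmul2l.
  exact: measurable_funS mB.
(* integrate in [s] *)
have : ((2 * Q * A)%:E <= 4%:E * IS)%E.
  have -> : (2 * Q * A)%:E = (\int[mu]_(s in I01) (q n.+1 i.+1 s * (g s ^+ 2 * Q + A))%:E)%E.
    have b1 : bmf I01 (fun t => Q * (g t ^+ 2 * q n.+1 i.+1 t)).
      by apply: bmfM => //; exact: bmf_cst.
    have b2 : bmf I01 (fun t => A * q n.+1 i.+1 t).
      by apply: bmfM => //; exact: bmf_cst.
    transitivity (\int[mu]_(t in I01) (Q * (g t ^+ 2 * q n.+1 i.+1 t) + A * q n.+1 i.+1 t)%:E)%E; last first.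
      by apply: eq_integral => t _; congr EFin; ring.
    rewrite bintE//; last exact: bmfD.
    rewrite bintD// !bintZ// -/Q -/A; congr EFin; ring.
  apply: (@le_trans _ _ (\int[mu]_(s in I01) (2%:E * B s + 2%:E * IS))%E).
    apply: ge0_le_integral => //=.
    - by move=> t _; rewrite lee_fin mulr_ge0 ?q_ge0// addr_ge0// mulr_ge0// sqr_ge0.
    - apply/measurable_EFinP; apply: measurable_funM; first exact: bq.1.
      by apply: measurable_funD => //; apply: measurable_funM => //; apply: measurable_funX; exact: bg.1.
    - by apply: emeasurable_funD => //; apply: measurable_funeM; exact: measurable_funS mB.
  rewrite ge0_integralD//=; last 3 first.
  - by move=> t _; rewrite mule_ge0.
  - by apply: measurable_funeM; exact: measurable_funS mB.
  - by move=> t _; rewrite mule_ge0.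
  rewrite integral_cst// [X in (_ + _ * X)%E]muI mule1 ge0_integralZl//=; last exact: measurable_funS mB.
  rewrite (_ : 4%:E = 2%:E + 2%:E)%E; last by rewrite -EFinD; congr EFin; ring.
  rewrite ge0_muleDl// leeD2r//.
  by rewrite lee_wpmul2l.
case: IS IS0 {IB EB inner} => [r| |]//= _.
  by rewrite -!EFinM !lee_fin => h; lra.
by move=> _; rewrite mulry gtr0_sg// mul1e leey.
Qed.

End simplex_marginals.

(** * Jacobi polynomials on the unit interval *)

Section factored_derivatives.
Context {R : realType}.
Implicit Types (p u v : {poly R}).

Lemma product_rule_aux (A : comNzRingType) (u v p U V u' v' p' : A) i j :
  (u' * U *+ i * (v * V) + u * U * (v' * V *+ j)) * p + u * U * (v * V) * p' =
  U * V * (u' * v * p *+ i + u * v' * p *+ j + u * v * p').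
Proof.
rewrite -(mulr_natr (u' * U)) -(mulr_natr (v' * V)) -(mulr_natr (u' * v * p)) -(mulr_natr (u * v' * p)).
by move: (i%:R : A) (j%:R : A) => c e; ring.
Qed.

(** Leibniz's rule, keeping only what is needed: the [k]-th derivative of
    [u ^ (n + k) v ^ (m + k) p] is still divisible by [u ^ n v ^ m], and the
    quotient is explicit at the roots of [u]. *)
Lemma derivn_factored (u v p : {poly R}) n m k : exists2 S,
  (u ^+ (n + k) * v ^+ (m + k) * p)^`(k) = u ^+ n * v ^+ m * S &
  forall x, u.[x] = 0 -> S.[x] = ((n + k) ^_ k)%:R * (u^`().[x] * v.[x]) ^+ k * p.[x].
Proof.
elim: k p => [|k ih] p.
  by exists p => [|x _]; rewrite ?addn0 ?derivn0 ?ffactn0 ?expr0 ?mul1r.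
pose p1 := u^`() * v * p *+ (n + k).+1 + u * v^`() * p *+ (m + k).+1 + u * v * p^`().
have E : (u ^+ (n + k.+1) * v ^+ (m + k.+1) * p)^`() = u ^+ (n + k) * v ^+ (m + k) * p1.
  rewrite !addnS !derivM !deriv_exp /= /p1 !exprS.
  exact: product_rule_aux.
have [S S1 S2] := ih p1; exists S; first by rewrite derivSn E.
move=> x ux; rewrite S2// /p1 !(hornerD, hornerMn, hornerM) ux !mul0r mul0rn !addr0 addnS ffactSS natrM exprS.
rewrite -(mulr_natr (u^`().[x] * v.[x] * p.[x])); move: ((n + k).+1%:R : R) => c; ring.
Qed.

Lemma derivn_small p k : (size p <= k)%N -> p^`(k) = 0.
Proof.
move=> pk; apply/polyP => i; rewrite coef_derivn coef0 nth_default ?mul0rn//.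
by rewrite (leq_trans pk)// leq_addr.
Qed.

Lemma derivn_lead p k : size p = k.+1 -> p^`(k) = (lead_coef p * k`!%:R)%:P.
Proof.
move=> sp; apply/polyP => -[|i]; rewrite coef_derivn coefC /=.
  by rewrite addn0 ffactnn lead_coefE sp /= mulr_natr.
by rewrite nth_default ?mul0rn// sp addnS ltnS leq_addr.
Qed.

Lemma derivn_comp_affine p (c e : R) k :
  (p \Po (c *: 'X + e%:P))^`(k) = c ^+ k *: (p^`(k) \Po (c *: 'X + e%:P)).
Proof.
elim: k => [|k ih]; first by rewrite !derivn0 expr0 scale1r.
rewrite derivnS ih derivZ deriv_comp derivD derivZ derivX derivC addr0 derivnS.
by rewrite -mul_polyC -[c *: 1]mul_polyC -[RHS]mul_polyC exprS !rmorphM /=; ring.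
Qed.

Lemma poly_antiderivative p : exists A : {poly R}, A^`() = p.
Proof.
exists (\sum_(i < size p) (p`_i / i.+1%:R) *: 'X^(i.+1)).
rewrite -[RHS]coefK poly_def (raddf_sum deriv) /=.
apply: eq_bigr => i _; rewrite derivZ derivXn /= -['X^i *+ i.+1]scaler_nat scalerA mulrVK//.
by rewrite unitfE pnatr_eq0.
Qed.

End factored_derivatives.

HB.lock Definition pint (R : realType) (p : {poly R}) : R :=
  \int[@lebesgue_measure R]_(x in (`[0%R, 1%R]%classic : set R)) p.[x].

Section polynomial_integral.
Context {R : realType}.
Local Notation mu := (@lebesgue_measure R).
Local Notation I01 := (`[0%R, 1%R]%classic : set R).
Implicit Types (p u v : {poly R}).

Lemma mI01 : measurable I01. Proof. exact: measurable_itv. Qed.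

Lemma muI01 : mu I01 = 1%E.
Proof. by rewrite lebesgue_measure_itv /= lte_fin ltr01 oppr0 adde0. Qed.

Lemma muI01_lty : (mu I01 < +oo)%E. Proof. by rewrite muI01 ltry. Qed.

Lemma pintE p : pint p = \int[mu]_(x in I01) p.[x].
Proof. by rewrite pint.unlock. Qed.

Lemma EFin_pint p : (\int[mu]_(x in I01) (p.[x])%:E = (pint p)%:E)%E.
Proof. by rewrite pintE (@bintE _ _ _ mu I01 mI01 muI01_lty _ (bmf_horner p)). Qed.

Lemma pintD p u : pint (p + u) = pint p + pint u.
Proof.
rewrite !pintE -(@bintD _ _ _ mu I01 mI01 muI01_lty _ _ (bmf_horner p) (bmf_horner u)).
by apply: eq_Rintegral => x _; rewrite hornerD.
Qed.

Lemma pintZ c p : pint (c *: p) = c * pint p.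
Proof.
rewrite !pintE -(@bintZ _ _ _ mu I01 mI01 muI01_lty c _ (bmf_horner p)).
by apply: eq_Rintegral => x _; rewrite hornerZ.
Qed.

Lemma pint0 : pint (0 : {poly R}) = 0.
Proof. by rewrite -(scale0r (0 : {poly R})) pintZ mul0r. Qed.

Lemma pintN p : pint (- p) = - pint p.
Proof. by rewrite -scaleN1r pintZ mulN1r. Qed.

Lemma pint_sum (I : Type) (s : seq I) (F : I -> {poly R}) :
  pint (\sum_(i <- s) F i) = \sum_(i <- s) pint (F i).
Proof.
by elim: s => [|i s ih]; rewrite ?big_nil ?pint0// !big_cons pintD ih.
Qed.

Lemma pint_deriv p : pint p^`() = p.[1] - p.[0].
Proof.
by apply: EFin_inj; rewrite -EFin_pint; exact: integral_deriv_poly.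
Qed.

Lemma pint_le p u : (forall x, 0 <= x <= 1 -> p.[x] <= u.[x]) -> pint p <= pint u.
Proof.
move=> pu; rewrite !pintE; apply: bint_le.
- exact: mI01.
- exact: muI01_lty.
- exact: bmf_horner.
- exact: bmf_horner.
by move=> x; rewrite /= in_itv; exact: pu.
Qed.

Lemma pint_ge0 p : (forall x, 0 <= x <= 1 -> 0 <= p.[x]) -> 0 <= pint p.
Proof. by move=> H; rewrite -pint0; apply: pint_le => x x01; rewrite horner0 H. Qed.

Lemma pint_by_parts p u : pint (p^`() * u) = (p * u).[1] - (p * u).[0] - pint (p * u^`()).
Proof. by rewrite -pint_deriv derivM pintD addrK. Qed.

Lemma pint_by_parts_iter p u k :
  (forall j, (j < k)%N -> p^`(j).[0] = 0 /\ p^`(j).[1] = 0) ->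
  pint (p^`(k) * u) = (-1) ^+ k * pint (p * u^`(k)).
Proof.
elim: k u => [|k ih] u H; first by rewrite !derivn0 expr0 mul1r.
rewrite derivnS pint_by_parts !hornerM; have [-> ->] := H k (ltnSn k).
rewrite !mul0r subrr sub0r ih; last by move=> j jk; apply: H; rewrite ltnS ltnW.
by rewrite exprS -derivSn mulN1r mulNr.
Qed.

Lemma pint_beta m n : pint ((1 - 'X) ^+ m * 'X^n : {poly R}) = m`!%:R * n`!%:R / (m + n).+1`!%:R.
Proof.
elim: m n => [|m ih] n.
  rewrite expr0 mul1r add0n fact0 mul1r factS natrM invfM mulrCA.
  rewrite mulfV ?pnatr_eq0 -?lt0n ?fact_gt0// mulr1.
  have := pint_deriv ('X^(n.+1)); rewrite derivXn /= !hornerXn expr1n expr0n subr0.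
  have n0 : n.+1%:R != 0 :> R by rewrite pnatr_eq0.
  by rewrite -scaler_nat pintZ => h; apply: (mulfI n0); rewrite h mulfV.
have := pint_by_parts ('X^(n.+1)) ((1 - 'X) ^+ m.+1).
rewrite derivXn deriv_exp derivB derivC derivX sub0r /= !hornerE subrr !expr0n /= mulr0 mul0r subrr sub0r.
rewrite (_ : 'X^n *+ n.+1 * _ = n.+1%:R *: ((1 - 'X) ^+ m.+1 * 'X^n)); last first.
  by rewrite scaler_nat -mulrnAr mulrC.
rewrite (_ : 'X^(n.+1) * _ = - (m.+1%:R *: ((1 - 'X) ^+ m * 'X^(n.+1)))); last first.
  by rewrite scaler_nat mulN1r !mulrnAr mulrN mulNrn mulrC.
rewrite pintN opprK !pintZ ih => h.
have n0 : n.+1%:R != 0 :> R by rewrite pnatr_eq0.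
apply: (mulfI n0); rewrite h addnS addSn (factS m) (factS n) !natrM.
by move: (n.+1%:R : R) (m.+1%:R : R) => c e; ring.
Qed.

(** the substitution [t = c s] *)
Lemma pint_scale (p u : {poly R}) (c : R) : 0 < c -> c <= 1 ->
  (forall x, 0 <= x <= c -> p.[x] <= u.[x]) ->
  (forall x, 0 <= x <= 1 -> 0 <= u.[x]) -> c * pint (p \Po (c *: 'X)) <= pint u.
Proof.
move=> c0 c1 pu u0; have [A Ap] := poly_antiderivative p.
have [U Uu] := poly_antiderivative u.
have -> : c * pint (p \Po (c *: 'X)) = A.[c] - A.[0].
  have := pint_deriv (A \Po (c *: 'X)).
  rewrite deriv_comp Ap derivZ derivX -scalerAr mulr1 pintZ => ->.
  by rewrite !horner_comp !hornerE.
rewrite -Uu pint_deriv.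
have H1 : 0 <= U.[1] - U.[c].
  suff : (0 <= ((U.[1] - U.[c])%:E : \bar R))%E by rewrite lee_fin.
  rewrite -(integral_deriv_poly U c1) Uu; apply: integral_ge0 => x /=.
  rewrite in_itv /= => /andP[cx x1]; rewrite lee_fin u0// x1 andbT.
  by rewrite (le_trans (ltW c0)).
have H2 : 0 <= (U - A).[c] - (U - A).[0].
  suff : (0 <= (((U - A).[c] - (U - A).[0])%:E : \bar R))%E by rewrite lee_fin.
  rewrite -(integral_deriv_poly (U - A) (ltW c0)) derivB Uu Ap; apply: integral_ge0 => x /=.
  by rewrite in_itv /= => h; rewrite lee_fin hornerD hornerN subr_ge0 pu.
by move: H1 H2; rewrite !hornerD !hornerN; lra.
Qed.

Lemma pint_reflect (p : {poly R}) : pint (p \Po (1 - 'X)) = pint p.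
Proof.
have [A Ap] := poly_antiderivative p.
have := pint_deriv (A \Po (1 - 'X)).
rewrite deriv_comp Ap derivB derivC derivX sub0r mulrN1 pintN => /eqP.
rewrite eqr_oppLR => /eqP ->; rewrite -Ap pint_deriv !horner_comp !hornerE.
by rewrite subrr subr0 opprB.
Qed.

End polynomial_integral.

Section jacobi_polynomials.
Context {R : realType}.
Implicit Types (a b k : nat) (p : {poly R}).

(** the Jacobi weight on [[0, 1]] *)
Definition jw a b : {poly R} := (1 - 'X) ^+ a * 'X^b.

Definition jacobi01 a b k : {poly R} := jacobi a b k \Po (2 *: 'X - 1).

Lemma size_onemX : size (1 - 'X : {poly R}) = 2.
Proof. by rewrite -[1 - _]opprB size_polyN size_XsubC. Qed.

Lemma lead_coef_onemX : lead_coef (1 - 'X : {poly R}) = -1.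
Proof. by rewrite -[1 - _]opprB lead_coefN lead_coefXsubC. Qed.

Lemma jw_neq0 a b : jw a b != 0.
Proof. by rewrite mulf_neq0 ?expf_neq0 ?polyX_eq0// -size_poly_eq0 size_onemX. Qed.

(** The substitution maps [1 - 'X] and [1 + 'X] to [2 (1 - 'X)] and [2 'X]. *)
Lemma jacobi01_rodrigues a b k :
  jw a b * jacobi01 a b k = ((-1) ^+ k / k`!%:R) *: (jw (a + k) (b + k))^`(k).
Proof.
pose u : {poly R} := 1 - 'X; pose v : {poly R} := 1 + 'X.
have u0 : u != 0 by rewrite -size_poly_eq0 size_onemX.
have v0 : v != 0 by rewrite -size_poly_eq0 /v addrC -[1]opprK -polyCN size_XsubC.
have [S S1 _] := derivn_factored u v 1 a b k.
have EP : u ^+ a * v ^+ b * (1 - 'X ^+ 2) ^+ k = u ^+ (a + k) * v ^+ (b + k) * 1.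
  have -> : 1 - 'X ^+ 2 = u * v :> {poly R} by rewrite /u /v; ring.
  by rewrite mulr1 exprMn !exprD; ring.
have w0 : u ^+ a * v ^+ b != 0 by rewrite mulf_neq0 ?expf_neq0.
have EJ : jacobi a b k = ((-1) ^+ k / (2 ^+ k * k`!%:R)) *: S.
  by rewrite /jacobi -/u -/v EP S1 mulKp.
pose l : {poly R} := 2 *: 'X + (-1)%:P.
have lE : 2 *: 'X - 1 = l by rewrite /l polyCN.
have ul : u \Po l = 2 *: (1 - 'X).
  by rewrite /u /l rmorphB /= comp_polyX rmorph1 scalerBr polyCN; rewrite -!mul_polyC; ring.
have vl : v \Po l = 2 *: 'X.
  by rewrite /v /l rmorphD /= comp_polyX rmorph1 polyCN; ring.
have := derivn_comp_affine (u ^+ (a + k) * v ^+ (b + k) * 1) 2 (-1) k.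
rewrite -/l S1 !rmorphM /= !rmorphXn /= rmorph1 ul vl mulr1 !exprZn -!scalerAl -!scalerAr !scalerA derivnZ.
rewrite /jacobi01 EJ lE linearZ /= -/(jw (a + k) (b + k)) -/(jw a b) => H.
have t0 : (2 : R) != 0 by [].
have E2 : jw a b * (S \Po l) = 2 ^+ k *: (jw (a + k) (b + k))^`(k).
  apply: (@scalerI _ _ (2 ^+ k * 2 ^+ a * 2 ^+ b)); first by rewrite !mulf_neq0 ?expf_neq0.
  have c1 : 2 ^+ k * 2 ^+ a * 2 ^+ b * 2 ^+ k = 2 ^+ (a + k) * 2 ^+ (b + k) :> R by rewrite !exprD; ring.
  rewrite [RHS]scalerA c1 H -[_ *: jw a b * _]scalerAl scalerA.
  by [].
rewrite -scalerAr E2 scalerA; congr (_ *: _).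
have f0 : k`!%:R != 0 :> R by rewrite pnatr_eq0 -lt0n fact_gt0.
by field; rewrite f0 expf_neq0.
Qed.

(** The weight vanishes to order at least [k] at both ends; this removes the
    boundary terms of the integrations by parts. *)
Lemma jw_deriv_ends a b k j : (j < k)%N ->
  (jw (a + k) (b + k))^`(j).[0] = 0 /\ (jw (a + k) (b + k))^`(j).[1] = 0.
Proof.
move=> jk; have [S SE _] := derivn_factored (1 - 'X : {poly R}) 'X 1 (a + (k - j)) (b + (k - j)) j.
have -> : jw (a + k) (b + k) = (1 - 'X) ^+ (a + (k - j) + j) * 'X^(b + (k - j) + j) * 1.
  by rewrite mulr1 -!addnA !subnK ?(ltnW jk).
rewrite SE !hornerM !horner_exp; split.
  by rewrite hornerX expr0n addn_eq0 subn_eq0 leqNgt jk andbF mulr0 mul0r.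
rewrite (_ : (1 - 'X : {poly R}).[1] = 0); last by rewrite !hornerE subrr.
by rewrite expr0n addn_eq0 subn_eq0 leqNgt jk andbF !mul0r.
Qed.

Lemma size_jw a b : size (jw a b) = (a + b).+1.
Proof.
rewrite size_mul ?expf_neq0 ?polyX_eq0 -?size_poly_eq0 ?size_onemX//.
have := size_exp (1 - 'X : {poly R}) a; rewrite size_onemX mul1n size_polyXn addnS /=.
have : size ((1 - 'X : {poly R}) ^+ a) != 0%N by rewrite size_poly_eq0 expf_neq0// -size_poly_eq0 size_onemX.
by move: (size _) => s; lia.
Qed.

Lemma lead_coef_jw a b : lead_coef (jw a b) = (-1) ^+ a.
Proof. by rewrite lead_coefM lead_coefXn mulr1 lead_coef_exp lead_coef_onemX. Qed.

(** Integrating by parts [k] times in Rodrigues' formula; orthogonality to all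
    polynomials of smaller degree follows at once. *)
Lemma pint_jacobi01 a b k p : pint (jw a b * jacobi01 a b k * p) =
  k`!%:R^-1 * pint (jw (a + k) (b + k) * p^`(k)).
Proof.
rewrite jacobi01_rodrigues -scalerAl pintZ pint_by_parts_iter; last first.
  by move=> j; exact: jw_deriv_ends.
by rewrite mulrA [_ / _ * _]mulrAC -expr2 sqrr_sign mul1r.
Qed.

(** Both are read off Rodrigues' formula, in which the degree of the derivative
    is that of the weight minus [k]. *)
Lemma size_lead_jacobi01 a b k : size (jacobi01 a b k) = k.+1 /\
  lead_coef (jacobi01 a b k) = ((a + b + 2 * k) ^_ k)%:R / k`!%:R.
Proof.
have f0 : k`!%:R != 0 :> R by rewrite pnatr_eq0 -lt0n fact_gt0.
pose W := jw (a + k) (b + k); pose N := (a + b + 2 * k)%N.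
have sW : size W = N.+1 by rewrite size_jw /N; congr _.+1; lia.
have kN : (k <= N)%N by rewrite /N; lia.
have ff0 : (N ^_ k)%:R != 0 :> R by rewrite pnatr_eq0 -lt0n ffact_gt0.
have cW : W`_N = (-1) ^+ (a + k) by rewrite -(lead_coef_jw (a + k) (b + k)) lead_coefE -/W sW.
have cD : (W^`(k))`_(N - k) = (-1) ^+ (a + k) * (N ^_ k)%:R.
  by rewrite coef_derivn subnKC// cW mulr_natr.
have sD : size W^`(k) = (N - k).+1.
  apply/eqP; rewrite eqn_leq; apply/andP; split.
    apply/leq_sizeP => j hj; rewrite coef_derivn nth_default ?mul0rn// sW; lia.
  by rewrite ltnNge; apply/negP => /leq_sizeP/(_ _ (leqnn _)) /eqP; rewrite cD mulf_eq0 signr_eq0 (negbTE ff0).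
have c0 : (-1) ^+ k / k`!%:R != 0 :> R by rewrite mulf_neq0 ?invr_eq0// signr_eq0.
have E := jacobi01_rodrigues a b k; rewrite -/W in E.
have J0 : jacobi01 a b k != 0.
  apply: contraTneq isT => J0; move: E; rewrite J0 mulr0 => /esym/eqP.
  by rewrite scaler_eq0 (negbTE c0) -size_poly_eq0 sD.
split.
  have := congr1 (fun p : {poly R} => size p) E; rewrite size_mul ?jw_neq0// size_jw size_scale// sD /N.
  by move: (size _) => s; lia.
have := congr1 lead_coef E; rewrite lead_coefM lead_coef_jw lead_coefZ.
rewrite [lead_coef W^`(k)]lead_coefE sD /= cD exprD => h.
apply: (@mulfI _ ((-1) ^+ a)); first by rewrite signr_eq0.
rewrite h -/N; have := sqrr_sign R k; rewrite expr2 => hs.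
transitivity ((-1) ^+ a * ((-1) ^+ k * (-1) ^+ k) * ((N ^_ k)%:R / k`!%:R) : R); first by ring.
by rewrite hs mulr1.
Qed.

(** the squared norm of [jacobi01 a b k] for the weight [jw a b], by
    [pint_jacobi01_sqr] *)
Definition jnorm a b k : R :=
  (a + k)`!%:R * (b + k)`!%:R / ((a + b + k)`!%:R * k`!%:R * (2 * k + a + b).+1%:R).

Lemma fact_neq0 n : n`!%:R != 0 :> R.
Proof. by rewrite pnatr_eq0 -lt0n fact_gt0. Qed.

Lemma jnorm_gt0 a b k : 0 < jnorm a b k.
Proof. by rewrite divr_gt0 ?mulr_gt0 ?ltr0n ?fact_gt0. Qed.

Lemma pint_jacobi01_small a b k p : (size p <= k)%N -> pint (jw a b * jacobi01 a b k * p) = 0.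
Proof. by move=> pk; rewrite pint_jacobi01 derivn_small// mulr0 pint0 mulr0. Qed.

(** The [k]-th derivative of [jacobi01 a b k] is a constant, and what remains is
    a beta integral. *)
Lemma pint_jacobi01_sqr a b k : pint (jw a b * jacobi01 a b k * jacobi01 a b k) = jnorm a b k.
Proof.
have [sJ lJ] := size_lead_jacobi01 a b k.
rewrite pint_jacobi01 derivn_lead// lJ mulrVK ?unitfE ?fact_neq0//.
rewrite [jw _ _ * _]mulrC mul_polyC pintZ pint_beta /jnorm.
rewrite (_ : a + b + 2 * k = 2 * k + a + b)%N; last by lia.
rewrite (_ : (a + k + (b + k)).+1 = (2 * k + a + b).+1)%N; last by lia.
have H : ((2 * k + a + b) ^_ k)%:R * (a + b + k)`!%:R = (2 * k + a + b)`!%:R :> R.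
  rewrite -natrM -(@ffact_fact (2 * k + a + b) k); last by lia.
  by rewrite (_ : 2 * k + a + b - k = a + b + k)%N; last by lia.
rewrite factS natrM -H.
have f1 : ((2 * k + a + b) ^_ k)%:R != 0 :> R.
  by rewrite pnatr_eq0 -lt0n ffact_gt0; lia.
have f2 : (2 * k + a + b).+1%:R != 0 :> R by rewrite pnatr_eq0.
move: f1 f2 (fact_neq0 (a + b + k)) (fact_neq0 k).
move: (((2 * k + a + b) ^_ k)%:R : R) ((2 * k + a + b).+1%:R : R) ((a + b + k)`!%:R : R) (k`!%:R : R).
move: ((a + k)`!%:R : R) ((b + k)`!%:R : R) => x y z t v w z0 t0 v0 w0.
by field; rewrite z0 t0 v0 w0.
Qed.

End jacobi_polynomials.

(** the orthonormal polynomials for the weight [jw a b] *)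
HB.lock Definition jpoly (R : realType) (a b k : nat) : {poly R} :=
  (Num.sqrt (jnorm a b k))^-1 *: jacobi01 a b k.

Section orthonormal_jacobi_polynomials.
Context {R : realType}.
Implicit Types (a b k : nat) (p : {poly R}).
Local Notation jpoly := (@jpoly R).
Local Notation jw := (@jw R).
Local Notation jnorm := (@jnorm R).

Lemma jpolyE a b k : jpoly a b k = (Num.sqrt (jnorm a b k))^-1 *: jacobi01 a b k.
Proof. by rewrite jpoly.unlock. Qed.

Lemma sqrt_jnorm_neq0 a b k : Num.sqrt (jnorm a b k) != 0.
Proof. by rewrite gt_eqF// sqrtr_gt0 jnorm_gt0. Qed.

Lemma size_jpoly a b k : size (jpoly a b k) = k.+1.
Proof.
rewrite jpolyE size_scale ?invr_eq0 ?sqrt_jnorm_neq0//.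
by have [] := @size_lead_jacobi01 R a b k.
Qed.

Lemma pint_jpoly_small a b k p : (size p <= k)%N -> pint (jw a b * jpoly a b k * p) = 0.
Proof.
move=> pk; rewrite !jpolyE -scalerAr -scalerAl pintZ pint_jacobi01_small ?mulr0//.
Qed.

Lemma pint_jpoly a b k l : pint (jw a b * jpoly a b k * jpoly a b l) = (k == l)%:R.
Proof.
wlog kl : k l / (l <= k)%N => [H|].
  have [kl|/ltnW kl] := leqP l k; first exact: H.
  by rewrite mulrAC H// eq_sym.
have [<-|kneql] := eqVneq k l; last first.
  by rewrite pint_jpoly_small// size_jpoly ltn_neqAle eq_sym kneql.
rewrite !jpolyE -!(scalerAr, scalerAl) !pintZ pint_jacobi01_sqr mulrA -invfM -expr2.
by rewrite sqr_sqrtr ?mulVf ?gt_eqF ?jnorm_gt0// ltW// jnorm_gt0.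
Qed.

Definition jcoef a b p k : R := pint (jw a b * jpoly a b k * p).

Lemma jpoly_span a b p m : (size p <= m)%N ->
  p = \sum_(k < m) jcoef a b p k *: jpoly a b k.
Proof.
elim: m p => [|m ih] p.
  by rewrite leqn0 size_poly_eq0 => /eqP ->; rewrite big_ord0.
move=> pm; pose c := p`_m / (jpoly a b m)`_m.
have lj : (jpoly a b m)`_m != 0.
  have := size_jpoly a b m; have := lead_coef_eq0 (jpoly a b m); rewrite lead_coefE => h1 h2.
  by move: h1; rewrite h2 /= => ->; rewrite -size_poly_eq0 h2.
pose r := p - c *: jpoly a b m.
have sr : (size r <= m)%N.
  apply/leq_sizeP => j; rewrite leq_eqVlt => /predU1P[<-|mj].
    by rewrite coefB coefZ /c mulfVK// subrr.
  rewrite coefB coefZ !nth_default ?mulr0 ?subr0// ?size_jpoly//.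
  exact: leq_trans pm mj.
have pE : p = r + c *: jpoly a b m by rewrite /r subrK.
have cr k : jcoef a b p k = jcoef a b r k + c * (k == m)%:R.
  by rewrite /jcoef {1}pE mulrDr pintD -scalerAr pintZ pint_jpoly.
rewrite big_ord_recr /= {1}pE {1}(ih r sr); congr (_ + _).
  apply: eq_bigr => k _; rewrite cr; congr (_ *: _).
  by rewrite (ltn_eqF (ltn_ord k)) mulr0 addr0.
by rewrite cr eqxx mulr1 {1}/jcoef pint_jpoly_small// add0r.
Qed.

Lemma pint_sum_jpoly a b m (c c' : nat -> R) :
  pint (jw a b * (\sum_(k < m) c k *: jpoly a b k) * (\sum_(k < m) c' k *: jpoly a b k)) =
  \sum_(k < m) c k * c' k.
Proof.
rewrite [jw a b * _]mulr_sumr mulr_suml pint_sum; apply: eq_bigr => k _.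
rewrite mulr_sumr pint_sum (bigD1 k)//= big1 ?addr0 => [|j jk].
  by rewrite -(scalerAr (c' k)) -(scalerAr (c k)) -scalerAl !pintZ pint_jpoly eqxx mulr1 mulrC.
rewrite -(scalerAr (c' j)) -(scalerAr (c k)) -scalerAl !pintZ pint_jpoly.
have -> : (val k == val j) = false by rewrite val_eqE eq_sym; exact/negbTE.
by rewrite !mulr0.
Qed.

Lemma parseval_jpoly a b p m : (size p <= m)%N ->
  pint (jw a b * p * p) = \sum_(k < m) jcoef a b p k ^+ 2.
Proof.
move=> pm; rewrite {1 2}(jpoly_span a b pm) (pint_sum_jpoly a b m (jcoef a b p) (jcoef a b p)).
by apply: eq_bigr => k _; rewrite expr2.
Qed.

(** Only one term of Leibniz's rule survives at [1], a root of the first factor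
    of the weight. *)
Lemma jacobi01_end a b k : (@jacobi01 R a b k).[1] = ((a + k) ^_ k)%:R / k`!%:R.
Proof.
have [S SE S1] := derivn_factored (1 - 'X : {poly R}) 'X 1 a b k.
have E := @jacobi01_rodrigues R a b k.
have -> : @jacobi01 R a b k = ((-1) ^+ k / k`!%:R) *: S.
  apply: (mulfI (jw_neq0 a b)); rewrite E -scalerAr; congr (_ *: _).
  by rewrite /jw -SE mulr1.
rewrite hornerZ S1; last by rewrite !hornerE subrr.
have -> : (1 - 'X : {poly R})^`().[1] * ('X : {poly R}).[1] = -1.
  by rewrite derivB derivC derivX sub0r !hornerE.
rewrite (_ : (1 : {poly R}).[1] = 1) ?mulr1; last by rewrite hornerC.
have := sqrr_sign R k; rewrite expr2 => hs.
transitivity (((-1) ^+ k * (-1) ^+ k) * (((a + k) ^_ k)%:R / k`!%:R) : R); last by rewrite hs mul1r.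
by ring.
Qed.

Lemma cauchy_schwarz_sum m (f g : 'I_m -> R) :
  (\sum_k f k * g k) ^+ 2 <= (\sum_k f k ^+ 2) * (\sum_k g k ^+ 2).
Proof.
have [A AE] : exists A, A = \sum_k f k ^+ 2 by eexists.
have [B BE] : exists B, B = \sum_k g k ^+ 2 by eexists.
have [C CE] : exists C, C = \sum_k f k * g k by eexists.
have B0 : 0 <= B by rewrite BE; apply: sumr_ge0 => k _; exact: sqr_ge0.
have : 0 <= \sum_k (B * f k - C * g k) ^+ 2 by apply: sumr_ge0 => k _; exact: sqr_ge0.
have -> : \sum_k (B * f k - C * g k) ^+ 2 = B * (A * B - C ^+ 2).
  rewrite (eq_bigr (fun k : 'I_m => B ^+ 2 * f k ^+ 2 - 2 * B * C * (f k * g k) + C ^+ 2 * g k ^+ 2)); last first.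
    by move=> k _; ring.
  by rewrite big_split sumrB /= -!mulr_sumr -AE -BE -CE; ring.
rewrite -AE -BE -CE; have [B00|Bn0] := eqVneq B 0; last by rewrite pmulr_rge0 ?subr_ge0// lt0r Bn0.
suff -> : C = 0 by rewrite B00 mulr0 expr0n.
rewrite CE big1// => k _; suff -> : g k = 0 by rewrite mulr0.
apply/eqP; rewrite -sqrf_eq0; apply/eqP.
have /psumr_eq0P H : \sum_k g k ^+ 2 = 0 by rewrite -BE.
by apply: H => // j _; exact: sqr_ge0.
Qed.

Lemma fact_ratio_le n c : ((n + c)`!%:R : R) <= (n + c)%:R ^+ c * n`!%:R.
Proof.
elim: c => [|c ih]; first by rewrite addn0 expr0 mul1r.
rewrite addnS factS natrM exprS -mulrA ler_wpM2l//; apply: (le_trans ih).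
by rewrite ler_wpM2r// lerXn2r ?nnegrE ?ler0n// ler_nat.
Qed.

(** The growth in [k] of the values at the end [1] depends on the exponent [a]
    of the weight there. *)
Lemma jpoly_end_sqr a b k :
  (jpoly a b k).[1] ^+ 2 <= 2 * ((a + b).+1 * k.+1)%:R ^+ (2 * a).+1.
Proof.
have P n : 0 < (n`!%:R : R) by rewrite ltr0n fact_gt0.
have J0 := @jnorm_gt0 R a b k.
have H1 : (jpoly a b k).[1] ^+ 2 = (2 * k + a + b).+1%:R *
    ((b + k + a)`!%:R / (b + k)`!%:R) * ((k + a)`!%:R / k`!%:R) / (a`!%:R ^+ 2).
  rewrite jpolyE hornerZ exprMn exprVn sqr_sqrtr ?(ltW J0)// jacobi01_end /jnorm.
  have -> : ((a + k) ^_ k)%:R = (a + k)`!%:R / a`!%:R :> R.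
    by rewrite -(@ffact_fact (a + k) k) ?leq_addl// addnK natrM mulfK// gt_eqF.
  rewrite (_ : b + k + a = a + b + k)%N; last by lia.
  rewrite (addnC k a); move: (P (a + k)%N) (P (b + k)%N) (P (a + b + k)%N) (P a) (P k).
  have : 0 < ((2 * k + a + b).+1%:R : R) by rewrite ltr0n.
  move: ((2 * k + a + b).+1%:R : R) ((a + k)`!%:R : R) ((b + k)`!%:R : R) ((a + b + k)`!%:R : R) (a`!%:R : R) (k`!%:R : R).
  move=> x y z t v w x0 y0 z0 t0 v0 w0; field.
  by rewrite !gt_eqF.
pose M : R := ((a + b).+1 * k.+1)%:R.
have M1 n : (n <= (a + b).+1 * k.+1)%N -> (n%:R : R) <= M by move=> h; rewrite ler_nat.
have R1 n c : (n + c <= (a + b).+1 * k.+1)%N -> (n + c)`!%:R / n`!%:R <= M ^+ c.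
  move=> nc; rewrite ler_pdivrMr//; apply: (le_trans (fact_ratio_le n c)).
  by rewrite ler_wpM2r ?ler0n// lerXn2r ?nnegrE ?ler0n// M1.
rewrite H1 ler_pdivrMr ?exprn_gt0//.
apply: (@le_trans _ _ (2 * M * M ^+ a * M ^+ a)).
  apply: ler_pM; [by rewrite mulr_ge0// divr_ge0 ?ler0n|by rewrite divr_ge0 ?ler0n| |by apply: R1; nia].
  apply: ler_pM; [exact: ler0n|by rewrite divr_ge0 ?ler0n| |by apply: R1; nia].
  by rewrite /M -natrM ler_nat; nia.
have -> : 2 * M * M ^+ a * M ^+ a = 2 * M ^+ (2 * a).+1.
  by rewrite exprS mul2n -addnn exprD; ring.
by rewrite ler_peMr ?mulr_ge0 ?exprn_ge0 ?ler0n// exprn_ege1// ler1n fact_gt0.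
Qed.

(** Expand [p] in the orthonormal basis and apply the Cauchy-Schwarz inequality. *)
Lemma endpoint_nikolskii a b m p : (size p <= m.+1)%N ->
  p.[1] ^+ 2 <= 2 * (a + b).+1%:R ^+ (2 * a).+1 * m.+1%:R ^+ (2 * a).+2 * pint (jw a b * p * p).
Proof.
move=> pm; rewrite (parseval_jpoly a b pm) {1}(jpoly_span a b pm) horner_sum.
under eq_bigr do rewrite hornerZ.
apply: (le_trans (cauchy_schwarz_sum _ _)); rewrite mulrC; apply: ler_wpM2r.
  by apply: sumr_ge0 => k _; exact: sqr_ge0.
apply: (@le_trans _ _ (\sum_(k < m.+1) 2 * ((a + b).+1%:R ^+ (2 * a).+1 * m.+1%:R ^+ (2 * a).+1))).
  apply: ler_sum => k _; apply: (le_trans (jpoly_end_sqr a b k)).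
  rewrite ler_wpM2l// -exprMn -natrM lerXn2r ?nnegrE ?ler0n// ler_nat.
  by rewrite leq_mul2l ltn_ord orbT.
rewrite sumr_const card_ord -[leLHS]mulr_natl [m.+1%:R ^+ (2 * a).+2]exprS.
by rewrite le_eqVlt; apply/orP; left; apply/eqP; ring.
Qed.

(** Nikolskii's inequality at [x >= 1/2]: restrict to [[0, x]], where the weight
    [(x - t) ^ a t ^ b] is smaller than [(1 - t) ^ a t ^ b], and rescale. *)
Lemma nikolskii_right a b m p x : (size p <= m.+1)%N -> 1 / 2 <= x <= 1 ->
  p.[x] ^+ 2 <= 2 ^+ (a + b).+1 * (2 * (a + b).+1%:R ^+ (2 * a).+1 * m.+1%:R ^+ (2 * a).+2) *
                pint (jw a b * p * p).
Proof.
move=> pm /andP[x2 x1]; have x0 : 0 < x by apply: lt_le_trans x2; rewrite divr_gt0.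
pose px := p \Po (x *: 'X).
have spx : (size px <= m.+1)%N.
  rewrite /px; have : (size (p \Po (x *: 'X)) <= size p)%N; last by move=> /leq_trans; apply.
  have [->|] := eqVneq p 0; first by rewrite comp_poly0.
  rewrite -size_poly_gt0 => p0; apply: (leq_trans (size_comp_poly_leq _ _)).
  by rewrite size_scale ?gt_eqF// size_polyX /= muln1 prednK.
(* the point [x] becomes the end [1] of the rescaled polynomial *)
have pxE : px.[1] = p.[x] by rewrite horner_comp !hornerE.
have := endpoint_nikolskii a b spx; rewrite pxE.
have [K KE] : exists K : R, K = 2 * (a + b).+1%:R ^+ (2 * a).+1 * m.+1%:R ^+ (2 * a).+2 by eexists.
have K0 : 0 <= K by rewrite KE; apply: mulr_ge0; [apply: mulr_ge0 => //; apply: exprn_ge0; exact: ler0n|apply: exprn_ge0; exact: ler0n].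
rewrite -KE => h; apply: (le_trans h).
rewrite [X in X * pint (jw a b * p * p)]mulrC -[leRHS]mulrA; apply: ler_wpM2l => //.
have H1 : x ^+ (a + b).+1 * pint (jw a b * px * px) <= pint (jw a b * p * p).
  pose G : {poly R} := (x%:P - 'X) ^+ a * 'X^b * p * p.
  have E : G \Po (x *: 'X) = x ^+ (a + b) *: (jw a b * px * px).
    rewrite /G !rmorphM /= !rmorphXn /= rmorphB /= comp_polyX comp_polyC.
    rewrite (_ : x%:P - x *: 'X = x *: (1 - 'X)); last by rewrite scalerBr alg_polyC.
    by rewrite !exprZn -!(scalerAl, scalerAr) scalerA -exprD addnC.
  rewrite exprS -mulrA -pintZ -E; apply: pint_scale => // y /andP[y0 y1].
    rewrite /G /jw !hornerM -![in leLHS]mulrA -![in leRHS]mulrA.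
    apply: ler_wpM2r.
      by rewrite mulr_ge0// ?sqr_ge0// horner_exp hornerX exprn_ge0.
    by rewrite !horner_exp !hornerE lerXn2r ?nnegrE ?lerD2r ?subr_ge0// (le_trans y1).
  rewrite /jw !hornerM -mulrA mulr_ge0 -?expr2 ?sqr_ge0//.
  by rewrite !horner_exp !hornerE mulr_ge0// exprn_ge0// subr_ge0.
have J0 : 0 <= pint (jw a b * px * px).
  apply: pint_ge0 => y /andP[y0 y1].
  rewrite /jw !hornerM -mulrA mulr_ge0 -?expr2 ?sqr_ge0//.
  by rewrite !horner_exp !hornerE mulr_ge0// exprn_ge0// subr_ge0.
apply: (@le_trans _ _ (2 ^+ (a + b).+1 * (x ^+ (a + b).+1 * pint (jw a b * px * px)))); last first.
  by rewrite ler_wpM2l// exprn_ge0.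
rewrite mulrA -exprMn ler_peMl// exprn_ege1//; lra.
Qed.

(** Nikolskii's inequality; the half [x <= 1/2] follows by reflection, which
    exchanges the two exponents. *)
Lemma nikolskii a b m p x : (size p <= m.+1)%N -> 0 <= x <= 1 ->
  p.[x] ^+ 2 <= 2 ^+ (a + b).+1 * (2 * (a + b).+1%:R ^+ (2 * (a + b)).+1) *
                m.+1%:R ^+ (2 * (a + b)).+2 * pint (jw a b * p * p).
Proof.
wlog x2 : a b p x / 1 / 2 <= x => [H pm x01|pm /andP[x0 x1]].
  have [xl|xr] := leP (1 / 2) x; first exact: H.
  have s1 : size (1 - 'X : {poly R}) = 2 by rewrite size_onemX.
  have := H b a (p \Po (1 - 'X)) (1 - x); rewrite horner_comp !hornerE subKr addnC.
  rewrite (_ : jw b a * (p \Po (1 - 'X)) * (p \Po (1 - 'X)) = (jw a b * p * p) \Po (1 - 'X)); last first.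
    rewrite /jw !rmorphM /= !rmorphXn /= rmorphB /= comp_polyX comp_polyC subKr.
    by rewrite [X in X * _ * _]mulrC.
  rewrite pint_reflect; apply; [lra| |lra].
  have [->|] := eqVneq p 0; first by rewrite comp_poly0 size_poly0.
  rewrite -size_poly_gt0 => p0; apply: (leq_trans (size_comp_poly_leq _ _)).
  by rewrite s1 muln1 prednK.
have x12 : 1 / 2 <= x <= 1 by rewrite x2.
apply: (le_trans (nikolskii_right a b pm x12)).
apply: ler_wpM2r.
  apply: pint_ge0 => y /andP[y0 y1].
  rewrite /jw !hornerM -mulrA mulr_ge0 -?expr2 ?sqr_ge0//.
  by rewrite !horner_exp !hornerE mulr_ge0// exprn_ge0// subr_ge0.
rewrite -[leRHS]mulrA; apply: ler_wpM2l; first by rewrite exprn_ge0.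
apply: ler_pM.
- by apply: mulr_ge0 => //; apply: exprn_ge0; exact: ler0n.
- by apply: exprn_ge0; exact: ler0n.
- by rewrite ler_wpM2l// ler_weXn2l ?ler1n//; lia.
- by rewrite ler_weXn2l ?ler1n//; lia.
Qed.

End orthonormal_jacobi_polynomials.

Section jacobi_link.
Context {R : realType}.
Implicit Types (t : R).

Lemma phiE n (i : 'I_n.+1) k t :
  phi n.+1 i.+1 k t = Num.sqrt ((n - i)`!%:R * i`!%:R) * (@jpoly R (n - i) i k).[t].
Proof.
rewrite /phi subSS subn1 -pred_Sn.
have -> : (jacobi (n - i) i k).[2 * t - 1] = (@jacobi01 R (n - i) i k).[t].
  by rewrite /jacobi01 horner_comp !hornerE.
rewrite jpolyE hornerZ mulrA; congr (_ * _).
rewrite mulrC; congr (_ * _); rewrite /rho -sqrtrV ?(ltW (jnorm_gt0 _ _ _))//; congr Num.sqrt.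
rewrite /jnorm invf_div (_ : 2 * k + n.+1 = (2 * k + (n - i) + i).+1)%N; last by have := ltn_ord i; lia.
rewrite (_ : k + n.+1 - i.+1 = n - i + k)%N; last by have := ltn_ord i; lia.
rewrite (_ : k + i.+1 - 1 = i + k)%N; last by lia.
rewrite (_ : k + n.+1 - 1 = n - i + i + k)%N; last by have := ltn_ord i; lia.
by congr (_ / _); ring.
Qed.

Lemma q_jw n (i : 'I_n.+1) t : 0 <= t <= 1 ->
  q n.+1 i.+1 t = ((n - i)`!%:R * i`!%:R)^-1 * (@jw R (n - i) i).[t].
Proof.
move=> t01; rewrite /q subSS subn1 /= indicE mem_set ?mulr1; last by rewrite /= in_itv.
by rewrite -mulrA /jw hornerM !horner_exp !hornerE.
Qed.

(** Each factor of [k ^_ r] is at least [k / r]. *)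
Lemma ffact_ge_exp k r : (r <= k)%N -> (k ^ r <= r ^ r * k ^_ r)%N.
Proof.
move=> rk; rewrite -[X in (X ^ r <= _)%N]/k.
have H j : (j <= r)%N -> (k ^ j <= r ^ j * k ^_ j)%N.
  elim: j => [|j ih] jr //.
  rewrite ffactnSr expnSr expnSr mulnACA; apply: leq_mul; first by apply: ih; exact: ltnW.
  by nia.
exact: H.
Qed.

Lemma fact_ratio_ge n c : (n.+1%:R : R) ^+ c * n`!%:R <= (n + c)`!%:R.
Proof.
elim: c => [|c ih]; first by rewrite addn0 expr0 mul1r.
rewrite addnS factS natrM exprS -mulrA; apply: ler_pM; [exact: ler0n| |by rewrite ler_nat ltnS leq_addr|exact: ih].
by apply: mulr_ge0; [apply: exprn_ge0|]; exact: ler0n.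
Qed.

(** [r] integrations by parts turn the coefficient of order [k] for the weight
    [jw a b] into the coefficient of order [k - r] of the [r]-th derivative for
    the weight [jw (a + r) (b + r)]; this bounds the square of the factor. *)
Lemma jnorm_ratio a b r k : (0 < k)%N -> (r <= k)%N ->
  ((k - r)`!%:R / k`!%:R) ^+ 2 * @jnorm R (a + r) (b + r) (k - r) / jnorm a b k <=
  r%:R ^+ r / k%:R ^+ (2 * r).
Proof.
move=> k0 rk; have P n : 0 < (n`!%:R : R) by rewrite ltr0n fact_gt0.
have -> : ((k - r)`!%:R / k`!%:R) ^+ 2 * @jnorm R (a + r) (b + r) (k - r) / jnorm a b k =
    ((k - r)`!%:R / k`!%:R) * ((a + b + k)`!%:R / (a + b + k + r)`!%:R).
  rewrite /jnorm (_ : a + r + (k - r) = a + k)%N; last by lia.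
  rewrite (_ : b + r + (k - r) = b + k)%N; last by lia.
  rewrite (_ : a + r + (b + r) + (k - r) = a + b + k + r)%N; last by lia.
  rewrite (_ : 2 * (k - r) + (a + r) + (b + r) = 2 * k + a + b)%N; last by lia.
  have : 0 < ((2 * k + a + b).+1%:R : R) by rewrite ltr0n.
  move: (P (k - r)%N) (P k) (P (a + k)%N) (P (b + k)%N) (P (a + b + k + r)%N) (P (a + b + k)%N).
  move: ((k - r)`!%:R : R) (k`!%:R : R) ((a + k)`!%:R : R) ((b + k)`!%:R : R) ((a + b + k + r)`!%:R : R) ((a + b + k)`!%:R : R) ((2 * k + a + b).+1%:R : R).
  by move=> x y z t u v w x0 y0 z0 t0 u0 v0 w0; field; rewrite !gt_eqF.
have k0' : 0 < (k%:R : R) by rewrite ltr0n.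
have -> : (r%:R : R) ^+ r / k%:R ^+ (2 * r) = (r%:R ^+ r / k%:R ^+ r) * (k%:R ^+ r)^-1.
  by rewrite mul2n -addnn exprD invfM mulrA.
apply: ler_pM; rewrite ?divr_ge0 ?ler0n//.
  rewrite ler_pdivrMr// mulrAC ler_pdivlMr ?exprn_gt0//.
  rewrite -(ffact_fact rk) natrM mulrA -!natrX -natrM mulrC -natrM -natrM ler_nat.
  by rewrite leq_mul2l (ffact_ge_exp rk) orbT.
rewrite ler_pdivrMr// mulrC ler_pdivlMr ?exprn_gt0// mulrC.
apply: le_trans (fact_ratio_ge (a + b + k) r).
by rewrite ler_wpM2r ?ler0n// lerXn2r ?nnegrE ?ler0n// ler_nat; lia.
Qed.

Lemma jw_derivn_small a b r k : (r <= k)%N ->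
  (jw (a + k) (b + k))^`(k - r) =
  ((-1) ^+ (k - r) * (k - r)`!%:R) *: (@jw R (a + r) (b + r) * jacobi01 (a + r) (b + r) (k - r)).
Proof.
move=> rk; rewrite jacobi01_rodrigues scalerA.
rewrite (_ : a + r + (k - r) = a + k)%N; last by lia.
rewrite (_ : b + r + (k - r) = b + k)%N; last by lia.
have f0 : (k - r)`!%:R != 0 :> R := fact_neq0 _.
rewrite -[LHS]scale1r; congr (_ *: _).
have := sqrr_sign R (k - r); rewrite expr2 => hs.
transitivity (((-1) ^+ (k - r) * (-1) ^+ (k - r)) * ((k - r)`!%:R / (k - r)`!%:R) : R).
  by rewrite hs mulfV// mulr1.
by ring.
Qed.

End jacobi_link.

(** * Absolutely continuous functions *)

Section interval_families.
Context {R : realType}.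
Implicit Types (p : R * R) (s t : seq (R * R)) (F : R -> R).

Definition separated p p' : bool := (p.2 <= p'.1) || (p'.2 <= p.1).

Definition family_in (a b : R) s : bool :=
  all (fun p => (a <= p.1 <= p.2) && (p.2 <= b)) s && pairwise separated s.

Definition total_length s : R := \sum_(p <- s) (p.2 - p.1).
Definition total_jump F s : R := \sum_(p <- s) `|F p.2 - F p.1|.

(** Lists of intervals, unlike families indexed by ordinals, can be refined and
    concatenated. *)
Definition ac_on (a b : R) F := forall e : R, 0 < e -> exists2 dl : R, 0 < dl &
  forall s, family_in a b s -> total_length s < dl -> total_jump F s < e.

Lemma separatedC p p' : separated p p' = separated p' p.
Proof. by rewrite /separated orbC. Qed.

Lemma ac_on_absolutely_continuous F a b : 0 < a -> b < 1 ->
  Defs.absolutely_continuous `]0, 1[%classic F -> ac_on a b F.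
Proof.
move=> a0 b1 acF e e0; have [dl dl0 H] := acF e e0; exists dl => // s /andP[/allP ins sep] sdl.
have inn (i : 'I_(size s)) : nth 0 s i \in s by rewrite mem_nth.
pose lo (i : 'I_(size s)) := (nth 0 s i).1; pose hi (i : 'I_(size s)) := (nth 0 s i).2.
have := H (size s) lo hi; rewrite /total_jump (big_nth 0) big_mkord; apply.
- by move=> i; have /andP[/andP[]] := ins _ (inn i).
- move=> i x; rewrite /= !in_itv /= => /andP[lx xh].
  have /andP[/andP[al _] hb] := ins _ (inn i).
  by rewrite (lt_le_trans a0 (le_trans al lx)) (le_lt_trans (le_trans xh hb) b1).
- move=> i j _ _ [x []]; rewrite /= !in_itv /= => /andP[li hi'] /andP[lj hj].
  apply: contrapT => /eqP ij.
  have /(pairwiseP 0) psep := sep.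
  have {}psep : separated (nth 0 s i) (nth 0 s j).
    have [ltij|ltji|eij] := ltngtP i j.
    - by apply: psep => //; rewrite inE.
    - by rewrite separatedC; apply: psep => //; rewrite inE.
    - by move/negP : ij; case; apply/eqP/val_inj.
  by case/orP : psep => h; [have := lt_le_trans hi' (le_trans h (ltW lj))|have := lt_le_trans hj (le_trans h (ltW li))]; rewrite ltxx.
by move: sdl; rewrite /total_length (big_nth 0) big_mkord.
Qed.

Lemma total_length_cat s t : total_length (s ++ t) = total_length s + total_length t.
Proof. by rewrite /total_length big_cat. Qed.

Lemma total_jump_cat F s t : total_jump F (s ++ t) = total_jump F s + total_jump F t.
Proof. by rewrite /total_jump big_cat. Qed.

(** the intervals of a subdivision of [[c, d]] *)
Lemma itv_partition_family F c d l : itv_partition c d l ->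
  exists s, [/\ family_in c d s, total_length s = d - c & total_jump F s = variation c d F l].
Proof.
elim: l c => [|x l ih] c.
  move=> /itv_partition_nil <-; exists [::]; split => //.
    by rewrite /total_length big_nil subrr.
  by rewrite /total_jump /variation /= !big_nil.
move=> cxl; have xl := itv_partition_cons cxl; have [s [/andP[ins sep] ls js]] := ih _ xl.
have cx : c < x by case: cxl => /= /andP[].
have xd : x <= d by apply: itv_partition_le xl.
exists ((c, x) :: s); split.
- rewrite /family_in /= lexx (ltW cx) xd /= sep andbT; apply/andP; split.
    by apply: sub_all ins => p /andP[/andP[h1 h2] h3]; rewrite h2 h3 (le_trans (ltW cx) h1).
  by apply: sub_all ins => p /andP[/andP[h1 h2] h3]; rewrite /separated /= h1.
- by rewrite /total_length big_cons /= -/(total_length s) ls; ring.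
- rewrite /total_jump big_cons /= -/(total_jump F s) js.
  rewrite (_ : x :: l = [:: x] ++ l)// (@variation_cat _ x)//; [|exact: ltW|exact: itv_partition1].
  by rewrite /variation /= big_nat1.
Qed.

(** An absolutely continuous function has an absolutely continuous variation:
    subdivide the intervals of the family one after the other. *)
Lemma total_variation_family F a b (e dl : R) :
  (forall s, family_in a b s -> total_length s < dl -> total_jump F s < e) ->
  forall s t, family_in a b (s ++ t) -> total_length (s ++ t) < dl ->
  (\sum_(p <- s) total_variation p.1 p.2 F + (total_jump F t)%:E <= e%:E)%E.
Proof.
move=> H; elim=> [|p s ih] t fst lst.
  by rewrite big_nil add0e lee_fin ltW// H.
rewrite big_cons -addeA; have [->|p12] := eqVneq p.1 p.2.
  rewrite total_variationxx add0e; apply: ih; last first.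
    apply: le_lt_trans lst; rewrite /total_length big_cons lerDr subr_ge0.
    by move: fst => /andP[/andP[/andP[/andP[_ ->]]]].
  by move: fst; rewrite /family_in /= => /andP[/andP[_ ->] /andP[_ ->]].
have /andP[/= /andP[/andP[/andP[ap pp] pb] ins] /andP[sp sep]] := fst.
have lt12 : p.1 < p.2 by rewrite lt_neqAle p12.
have S0 : (\sum_(q <- s) total_variation q.1 q.2 F + (total_jump F t)%:E)%E \is a fin_num.
  rewrite ge0_fin_numE; last first.
    apply: adde_ge0; last by rewrite lee_fin; apply: sumr_ge0.
    rewrite big_seq; apply: sume_ge0 => q qs; apply: total_variation_ge0.
    by move: ins; rewrite all_cat => /andP[/allP/(_ _ qs)/andP[/andP[]]].
  apply: (@le_lt_trans _ _ e%:E); last exact: ltry.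
  apply: ih; first by rewrite /family_in ins sep.
  apply: le_lt_trans lst; rewrite /total_length big_cons lerDr subr_ge0.
  by [].
rewrite -leeBrDr//; apply: ge_ereal_sup => _ [_ [l cdl <-] <-].
rewrite leeBrDr//.
have [u [/andP[inu sepu] lu ju]] := itv_partition_family F cdl.
rewrite -ju addeCA -EFinD -total_jump_cat; apply: ih; last first.
  move: lst; rewrite !total_length_cat lu {1}/total_length big_cons -/(total_length s).
  by move: (total_length s) (total_length t) (p.1) (p.2) => x y z w; lra.
move: ins; rewrite /family_in !all_cat => /andP[-> ->]; rewrite andbT /=.
move: sp sep; rewrite all_cat !pairwise_cat => /andP[sps spt] /and3P[st ps pt].
have U q : q \in u -> [/\ p.1 <= q.1, q.1 <= q.2 & q.2 <= p.2].
  by move=> qu; have /andP[/andP[]] := allP inu _ qu.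
have V q r : q \in u -> separated p r -> separated q r.
  move=> qu; have [h1 h2 h3] := U q qu; rewrite /separated => /orP[h|h].
    by rewrite (le_trans h3 h).
  by rewrite (le_trans h h1) orbT.
apply/andP; split.
  by apply/allP => q qu; have [h1 h2 h3] := U q qu; rewrite h2 (le_trans ap h1) (le_trans h3 pb).
rewrite ps pt sepu /= !andbT allrel_catr st andbT; apply/andP; split.
  by apply/allrelP => q r qs ru; rewrite separatedC V//; exact: (allP sps).
by apply/allrelP => q r qs ru; rewrite V//; exact: (allP spt).
Qed.

End interval_families.

Section variation_of_ac.
Context {R : realType}.
Implicit Types (F G : R -> R) (a b : R).
Local Notation TV := total_variation.

Lemma ac_onB F G a b : ac_on a b F -> ac_on a b G -> ac_on a b (fun x => F x - G x).
Proof.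
move=> acF acG e e0; have e2 : 0 < e / 2 by rewrite divr_gt0.
have [d1 d10 H1] := acF _ e2; have [d2 d20 H2] := acG _ e2.
exists (Num.min d1 d2); first by rewrite lt_min d10.
move=> s fs; rewrite lt_min => /andP[s1 s2].
rewrite [e]splitr; apply: le_lt_trans (ltrD (H1 s fs s1) (H2 s fs s2)).
rewrite /total_jump -big_split /=; apply: ler_sum => p _.
rewrite (_ : _ - _ - _ = (F p.2 - F p.1) - (G p.2 - G p.1)); last by ring.
exact: ler_normB.
Qed.

(** Cut [[a, b]] into finitely many intervals on which the variation is at most
    [1]. *)
Lemma ac_on_bounded_variation F a b : a <= b -> ac_on a b F -> bounded_variation a b F.
Proof.
move=> ab acF; have [dl dl0 H] := acF 1 ltr01.
have short c d : a <= c -> c <= d -> d <= b -> d - c < dl -> (TV c d F <= 1%:E)%E.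
  move=> ac cd db dcl; have := @total_variation_family _ F a b 1 dl H [:: (c, d)] [::].
  rewrite cats0 big_seq1 /total_jump big_nil adde0; apply.
    by rewrite /family_in /= ac cd db.
  by rewrite /total_length big_seq1.
have step n c d : a <= c -> c <= d -> d <= b -> d - c <= n%:R * (dl / 2) -> (TV c d F < +oo)%E.
  elim: n c => [|n ih] c ac cd db.
    rewrite mul0r subr_le0 => dc; have -> : c = d by apply/eqP; rewrite eq_le cd.
    by rewrite total_variationxx ltry.
  have [dcl _|ldc hd] := leP (d - c) (dl / 2).
    by apply: (le_lt_trans (short c d ac cd db _)); rewrite ?ltry//; lra.
  rewrite (@total_variationD _ c d (c + dl / 2)); [|lra|lra].
  apply: lte_add_pinfty; last first.
    by apply: ih; [lra|lra|exact: db|move: hd; rewrite -addn1 natrD mulrDl mul1r; lra].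
  by apply: (le_lt_trans (short c _ ac _ _ _)); rewrite ?ltry//; lra.
apply/bounded_variationP => //; rewrite ge0_fin_numE ?total_variation_ge0//.
apply: (step (Num.bound ((b - a) / (dl / 2)))) => //.
have dl2 : 0 < dl / 2 by rewrite divr_gt0.
rewrite -ler_pdivrMr//; apply/ltW/archi_boundP; rewrite divr_ge0 ?(ltW dl2)//.
by rewrite subr_ge0.
Qed.

Lemma ac_on_variation F a b : a <= b -> ac_on a b F -> ac_on a b (fine \o TV a ^~ F).
Proof.
move=> ab acF e e0; have e2 : 0 < e / 2 by rewrite divr_gt0.
have bv := ac_on_bounded_variation ab acF.
have [dl dl0 H] := acF _ e2; exists dl => // s fs sdl.
have := @total_variation_family _ F a b (e / 2) dl H s [::].
rewrite cats0 /total_jump big_nil adde0 => /(_ fs sdl).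
rewrite [X in (X <= _)%E](_ : _ = (\sum_(p <- s) `|(fine \o TV a ^~ F) p.2 - (fine \o TV a ^~ F) p.1|)%:E).
  by rewrite lee_fin => h; apply: (le_lt_trans h); lra.
rewrite -sumEFin big_seq [RHS]big_seq; apply: eq_bigr => p ps.
have /andP[/allP/(_ _ ps)/andP[/andP[ap pp] pb] _] := fs.
have f1 : TV a p.1 F \is a fin_num.
  by apply/bounded_variationP => //; apply: bounded_variationl bv => //; exact: le_trans pp pb.
have f2 : TV p.1 p.2 F \is a fin_num.
  apply/bounded_variationP => //; apply: (bounded_variationl pp pb).
  by apply: bounded_variationr bv => //; exact: le_trans pp pb.
rewrite /= (total_variationD F ap pp) fineD// addrAC subrr add0r ger0_norm ?fineK//.
by rewrite fine_ge0// total_variation_ge0.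
Qed.

(** Jordan's decomposition *)
Lemma variation_nondecreasing F a b : bounded_variation a b F ->
  {in `[a, b] &, {homo (fine \o TV a ^~ F) : x y / x <= y}} /\
  {in `[a, b] &, {homo (fun x => fine (TV a x F) - F x) : x y / x <= y}}.
Proof.
move=> bv; have H x y : a <= x -> x <= y -> y <= b ->
    fine (TV a y F) = fine (TV a x F) + fine (TV x y F) /\ `|F y - F x| <= fine (TV x y F).
  move=> ax xy yb.
  have f1 : TV a x F \is a fin_num.
    by apply/bounded_variationP => //; apply: bounded_variationl bv => //; exact: le_trans xy yb.
  have f2 : TV x y F \is a fin_num.
    apply/bounded_variationP => //; apply: (bounded_variationl xy yb).
    by apply: bounded_variationr bv => //; exact: le_trans xy yb.
  rewrite (total_variationD F ax xy) fineD//; split => //.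
  by rewrite -lee_fin fineK// total_variation_ge.
split=> x y; rewrite !in_itv /= => /andP[ax xb] /andP[ay yb] xy;
  have [-> n1] := H x y ax xy yb.
  by rewrite lerDl (le_trans _ n1).
by have := ler_norm (F y - F x); move: (fine _) (fine _) n1 => u v; lra.
Qed.

End variation_of_ac.

Section density_of_ac.
Context {R : realType}.
Local Notation mu := (@lebesgue_measure R).
Implicit Types (a b : R) (F G : R -> R).

(** The components of an open set of finite measure are bounded open intervals,
    whose ends are needed to evaluate the increments of a function. *)
Lemma open_interval_finite (J : set R) : open J -> is_interval J -> J !=set0 ->
  (mu J < +oo)%E -> exists c d, c < d /\ J = `]c, d[%classic.
Proof.
move=> oJ iJ Jn0 fin; have := RhullK (mem_set iJ); case: (Rhull J) => i1 i2 JE.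
have [x Jx] := Jn0; move: (Jx) fin; rewrite -JE => xi.
have ball_in y : J y -> exists2 e : R, 0 < e & forall z, `|y - z| < e -> J z.
  by move=> Jy; have /nbhs_ballP[e /= e0 eJ] := open_nbhs_nbhs (conj oJ Jy); exists e.
rewrite lebesgue_measure_itv; have := xi; rewrite /= itv_boundlr.
case: i1 JE xi => [[] c|[]] JE xi /=; case: i2 JE xi => [[] d|[]] JE xi /=; rewrite ?bnd_simp//=;
  try (by move=> _; rewrite ?ltry ?ltNyr /= ltxx); try (by rewrite ?andbF).
- move=> /andP[cx xd] _; exfalso.
  have Jc : J c by rewrite -JE /= in_itv /= lexx (le_lt_trans cx).
  have [e e0 /(_ (c - e / 2))] := ball_in c Jc; rewrite -JE /= in_itv /= opprD addNKr opprK.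
  by have H : `|e / 2| < e; [rewrite gtr0_norm; lra|move=> /(_ H) /andP[]; lra].
- move=> /andP[cx xd] _; exfalso.
  have Jc : J c by rewrite -JE /= in_itv /= lexx (le_trans cx).
  have [e e0 /(_ (c - e / 2))] := ball_in c Jc; rewrite -JE /= in_itv /= opprD addNKr opprK.
  by have H : `|e / 2| < e; [rewrite gtr0_norm; lra|move=> /(_ H) /andP[]; lra].
- move=> /andP[cx xd] _; exists c, d; split; first exact: lt_trans xd.
  by rewrite JE.
- move=> /andP[cx xd] _; exfalso.
  have Jc : J d by rewrite -JE /= in_itv /= lexx (lt_le_trans cx).
  have [e e0 /(_ (d + e / 2))] := ball_in d Jc; rewrite -JE /= in_itv /= opprD addNKr normrN.
  by have H : `|e / 2| < e; [rewrite gtr0_norm; lra|move=> /(_ H) /andP[]; lra].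
Qed.

(** Composing with [clamp a b] extends a function on [[a, b]] by constants, which
    turns it into the distribution function of a finite measure. *)
Definition clamp a b x : R := Num.max a (Num.min b x).

Lemma clamp_in a b x : a <= b -> a <= clamp a b x <= b.
Proof. by move=> ab; rewrite /clamp le_max lexx ge_max ab ge_min lexx. Qed.

Lemma clamp_id a b x : a <= x <= b -> clamp a b x = x.
Proof. by move=> /andP[ax xb]; rewrite /clamp min_r// max_r. Qed.

Lemma clamp_le a b x y : x <= y -> clamp a b x <= clamp a b y.
Proof.
move=> xy; rewrite /clamp ge_max !le_max lexx /=; apply/orP; right.
by rewrite le_min !ge_min lexx /= xy orbT.
Qed.

Lemma clamp_dist a b x y : x <= y -> clamp a b y - clamp a b x <= y - x.
Proof.
move=> xy; rewrite /clamp /Num.max /Num.min.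
case: (ltP b x) => ?; case: (ltP b y) => ?; case: ltP => ?; case: ltP => ?; lra.
Qed.

Lemma clamp_family a b (n : nat) (p : nat -> R * R) : a <= b ->
  (forall j, (p j).1 < (p j).2 \/ p j = (a, a)) ->
  (forall i j, i != j -> (p i).1 < (p i).2 -> (p j).1 < (p j).2 -> separated (p i) (p j)) ->
  let s := [seq (clamp a b (p j).1, clamp a b (p j).2) | j <- iota 0 n] in
  family_in a b s /\ total_length s <= \sum_(j < n) ((p j).2 - (p j).1).
Proof.
move=> ab p12 psep s; have ple j : (p j).1 <= (p j).2 by case: (p12 j) => [/ltW//|->].
split; last first.
  rewrite /total_length big_map -(big_mkord xpredT (fun j => (p j).2 - (p j).1)) /index_iota subn0.
  by apply: ler_sum => j _; exact: clamp_dist.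
rewrite /family_in /s all_map; apply/andP; split.
  apply/allP => j _ /=; have /andP[-> _] := clamp_in (p j).1 ab.
  by have /andP[_ ->] := clamp_in (p j).2 ab; rewrite clamp_le.
rewrite pairwise_map; apply/(pairwiseP 0) => i j; rewrite !inE size_iota => il jl ij.
rewrite !nth_iota// !add0n /separated /=.
have ca : clamp a b a = a by rewrite clamp_id// lexx.
have [pi|->] := p12 i; last by rewrite /= ca; have /andP[-> _] := clamp_in (p j).1 ab.
have [pj|->] := p12 j; last by rewrite /= ca orbC; have /andP[-> _] := clamp_in (p i).1 ab.
have : separated (p i) (p j) by apply: psep => //; rewrite ltn_eqF.
by rewrite /separated => /orP[h|h]; rewrite (clamp_le a b h)// orbT.
Qed.

End density_of_ac.

Section radon_nikodym_density.
Context {R : realType}.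
Local Notation mu := (@lebesgue_measure R).
Implicit Types (a b : R) (F G : R -> R).

Lemma stieltjes_itv (c : cumulative R R) (u v : R) : u <= v ->
  lebesgue_stieltjes_measure c `]u, v]%classic = (c v - c u)%:E.
Proof.
move=> uv; rewrite /lebesgue_stieltjes_measure /measure_extension measurable_mu_extE/=.
  by rewrite wlength_itv_bnd.
exact: is_ocitv.
Qed.

Lemma stieltjes_fin (c : cumulative R R) a b : (forall x, c a <= c x <= c b) ->
  fin_num_fun (lebesgue_stieltjes_measure c).
Proof.
move=> cab; pose nu := lebesgue_stieltjes_measure c.
have nuT : (nu setT <= (c b - c a)%:E)%E.
  rewrite -(bigcup_itvT false false).
  have H : nu `](- n%:R), n%:R]%classic @[n --> \oo] --> nu (\bigcup_n `](- n%:R), n%:R]%classic).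
    apply: nondecreasing_cvg_mu; [by []|exact: bigcup_measurable|].
    by move=> *; apply/subsetPset/subset_itv; rewrite leBSide/= ?lerN2 ler_nat.
  rewrite -(cvg_lim _ H)//; apply: lime_le; first by apply/cvg_ex; eexists; exact: H.
  apply: nearW => n; rewrite /nu stieltjes_itv ?ge0_cp// lee_fin.
  by have /andP[_ h1] := cab n%:R; have /andP[h2 _] := cab (- n%:R); exact: lerB.
move=> A mA; rewrite ge0_fin_numE ?measure_ge0//.
apply: le_lt_trans (ltry (c b - c a)); apply: le_trans nuT.
by apply: le_measure; rewrite ?inE.
Qed.

(** A null set is covered by disjoint open intervals of small total length; by
    absolute continuity the sum of the increments over any finite number of them
    is small. *)
Lemma stieltjes_dominated (c : cumulative R R) a b G : a <= b ->
  ac_on a b G -> (forall x, c x = G (clamp a b x)) ->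
  lebesgue_stieltjes_measure c `<< mu.
Proof.
move=> ab acG cE; pose nu := lebesgue_stieltjes_measure c.
apply/null_content_dominatesP => A mA A0.
apply/eqP; rewrite eq_le measure_ge0 andbT; apply/lee_addgt0Pr => e e0; rewrite add0e.
have [dl dl0 Hdl] := acG e e0.
have [U [oU AU UA]] := @lebesgue_regularity_outer R A dl mA ltac:(by rewrite A0 ltry) dl0.
have mU : measurable U := open_measurable oU.
have Udl : (mu U < dl%:E)%E.
  apply: (@le_lt_trans _ _ (mu (U `\` A) + mu A)%E); last by rewrite A0 adde0.
  rewrite -[in leLHS](setDUK AU) setUC; apply: measureU2 => //; exact: measurableD.
apply: (@le_trans _ _ (nu U)); first by apply: le_measure; rewrite ?inE.
pose J := open_disjoint_itv oU.
have mJ j : measurable (J j) by apply: open_measurable; exact: open_disjoint_itv_open.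
have tJ : trivIset setT J := @open_disjoint_itv_trivIset R U oU.
have UE : U = \bigcup_j J j := @open_disjoint_itv_bigcup R U oU.
have JU j : J j `<=` U by rewrite UE => x Jx; exists j.
have /choice[p pP] : forall j, exists p : R * R,
    (J j = set0 /\ p = (a, a)) \/ (p.1 < p.2 /\ J j = `]p.1, p.2[%classic).
  move=> j; have [J0|/set0P Jn0] := eqVneq (J j) set0; first by exists (a, a); left.
  have [|c' [d [cd JE]]] := @open_interval_finite R (J j) (@open_disjoint_itv_open R U oU j)
    (@open_disjoint_itv_is_interval R U oU j) Jn0.
    apply: (le_lt_trans _ (lt_trans Udl (ltry _))).
    by apply: le_measure; [rewrite inE; exact: mJ|rewrite inE; exact: mU|exact: JU].
  by exists (c', d); right.
have p12 j : (p j).1 < (p j).2 \/ p j = (a, a) by case: (pP j) => [[_ ->]|[]]; [right|left].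
have psep i j : i != j -> (p i).1 < (p i).2 -> (p j).1 < (p j).2 -> separated (p i) (p j).
  move=> ij pi pj; rewrite /separated; apply: contraT; rewrite negb_or -!ltNge => /andP[h1 h2].
  have Ji : J i = `](p i).1, (p i).2[%classic.
    by case: (pP i) => [[_ E]|[]//]; move: pi; rewrite E ltxx.
  have Jj : J j = `](p j).1, (p j).2[%classic.
    by case: (pP j) => [[_ E]|[]//]; move: pj; rewrite E ltxx.
  pose lo := Num.max (p i).1 (p j).1; pose hi := Num.min (p i).2 (p j).2.
  have lohi : lo < hi by rewrite /lo /hi gt_max !lt_min pi pj h1 h2.
  have l1 : (p i).1 <= lo by rewrite /lo le_max lexx.
  have l2 : (p j).1 <= lo by rewrite /lo le_max lexx orbT.
  have l3 : hi <= (p i).2 by rewrite /hi ge_min lexx.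
  have l4 : hi <= (p j).2 by rewrite /hi ge_min lexx orbT.
  have : (J i `&` J j) ((lo + hi) / 2) by rewrite Ji Jj; split; rewrite /= in_itv /=; lra.
  by move/trivIsetP : tJ => /(_ i j I I ij) ->.
have cU : (\sum_(0 <= i < n) nu (J i))%E @[n --> \oo] --> nu U.
  rewrite [X in _ --> nu X]UE; apply: measure_semi_sigma_additive => //.
  by apply: bigcup_measurable => j _; exact: mJ.
rewrite -(cvg_lim _ cU)//.
apply: lime_le; first by apply: is_cvg_nneseries.
apply: nearW => n; rewrite big_mkord.
have [fs ls] := clamp_family n ab p12 psep.
move: fs ls; set s := map _ _ => fs ls.
apply: (@le_trans _ _ (\sum_(j < n) `|G (clamp a b (p j).2) - G (clamp a b (p j).1)|)%:E).
  rewrite -sumEFin; apply: lee_sum => j _.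
  case: (pP j) => [[-> _]|[pj ->]]; first by rewrite /nu measure0 lee_fin.
  apply: (@le_trans _ _ (nu `](p j).1, (p j).2]%classic)).
    by apply: le_measure; rewrite ?inE//; apply: subset_itvl; rewrite bnd_simp.
  by rewrite /nu stieltjes_itv ?(ltW pj)// lee_fin !cE ler_norm.
rewrite lee_fin; apply: ltW; have := Hdl s fs; rewrite /total_jump big_map.
rewrite -(big_mkord xpredT (fun j => `|G (clamp a b (p j).2) - G (clamp a b (p j).1)|)) /index_iota subn0.
apply; apply: (le_lt_trans ls); rewrite -lte_fin; apply: le_lt_trans Udl.
rewrite -sumEFin (eq_bigr (fun j : 'I_n => mu (J j))); last first.
  move=> j _; case: (pP j) => [[-> ->]|[pj ->]]; first by rewrite measure0 subrr.
  by rewrite lebesgue_measure_itv /= lte_fin pj EFinB.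
have mUn : measurable (\big[setU/set0]_(k < n) J k) by apply: bigsetU_measurable => k _; exact: mJ.
rewrite -(@measure_semi_additive_ord_I _ _ _ mu J n _ _ mUn).
- apply: le_measure; [rewrite inE; exact: mUn|rewrite inE; exact: mU|].
  by move=> x; rewrite -bigcup_mkord => -[j _]; exact: JU.
- by move=> k _; exact: mJ.
- by apply: sub_trivIset tJ.
Qed.

(** the Radon-Nikodym density of the Stieltjes measure of [G] *)
Lemma monotone_ac_density G a b : a <= b ->
  {in `[a, b] &, {homo G : x y / x <= y}} -> ac_on a b G ->
  exists h : R -> R, mu.-integrable setT (EFin \o h) /\
    forall x, a <= x <= b -> (\int[mu]_(t in `]a, x]) (h t)%:E = (G x - G a)%:E)%E.
Proof.
move=> ab ndG acG; pose H := G \o clamp a b.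
have ndH : nondecreasing H.
  move=> x y xy; apply: ndG; rewrite ?in_itv /= ?clamp_in//; exact: clamp_le.
have rcH : right_continuous H.
  apply: right_continuousW => x; apply/cvgrPdist_lt => e e0.
  have [dl dl0 Hdl] := acG e e0; near=> y.
  have xy : `|x - y| < dl by near: y; exact: cvgr_dist_lt.
  have W u v : u <= v -> `|u - v| < dl -> `|H u - H v| < e.
    move=> uv uvd; have := Hdl [:: (clamp a b u, clamp a b v)].
    rewrite /total_length /total_jump !big_seq1 /= distrC; apply.
      rewrite /family_in /= !andbT clamp_le// andbT.
      by have /andP[-> _] := clamp_in u ab; have /andP[_ ->] := clamp_in v ab.
    by apply: le_lt_trans uvd; rewrite distrC ger0_norm ?subr_ge0//; exact: clamp_dist.
  have [xley|/ltW ylex] := leP x y; first exact: W.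
  by rewrite distrC W// distrC.
pose c : cumulative R R := HB.pack_for (cumulative R R) H (isCumulative.Build R _ R H ndH rcH).
have cab x : c a <= c x <= c b.
  rewrite /c /= /H /=; have /andP[h1 h2] := clamp_in x ab.
  rewrite !(@clamp_id _ a b a) ?(@clamp_id _ a b b) ?lexx ?ab//.
  by rewrite !ndG// in_itv /= ?lexx ?ab ?h1 ?h2.
have fin := stieltjes_fin cab.
pose nu := lebesgue_stieltjes_measure c.
pose nuf : {finite_measure set _ -> \bar R} :=
  HB.pack_for {finite_measure set _ -> \bar R} nu (Measure_isFinite.Build _ _ _ nu fin).
have dom : nuf `<< mu by apply: (@stieltjes_dominated c a b G ab acG).
have [f [f0 ffin intf fE]] := radon_nikodym_sigma_finite dom.
exists (fine \o f); split.
  by apply: eq_integrable intf => // x _; rewrite /= fineK.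
move=> x /andP[ax xb].
rewrite (eq_integral f); last by move=> t _; rewrite fineK.
rewrite -fE//; have := stieltjes_itv c ax; rewrite /nuf /nu /= => ->.
by rewrite /H /= !clamp_id ?lexx ?ax ?ab.
Unshelve. all: by end_near. Qed.

(** The fundamental theorem of calculus: write the function as the difference of
    two monotone ones and apply Lebesgue's differentiation theorem to the
    integral of the density. *)
Lemma ac_density F a b : a <= b -> ac_on a b F ->
  exists h : R -> R, [/\ mu.-integrable setT (EFin \o h),
    (forall x, a <= x <= b -> (\int[mu]_(t in `]a, x]) (h t)%:E = (F x - F a)%:E)%E) &
    {ae mu, forall x, a < x < b -> is_derive x 1 F (h x)}].
Proof.
move=> ab acF; have bv := ac_on_bounded_variation ab acF.
have [ndV ndVF] := variation_nondecreasing bv.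
have acV := ac_on_variation ab acF.
have [h1 [i1 E1]] := monotone_ac_density ab ndV acV.
have [h2 [i2 E2]] := monotone_ac_density ab ndVF (ac_onB acV acF).
have ih : mu.-integrable setT (EFin \o (fun t => h1 t - h2 t)).
  by apply: eq_integrable (integrableB measurableT i1 i2) => // x _.
have E x : a <= x <= b -> (\int[mu]_(t in `]a, x]) ((h1 t - h2 t)%:E) = (F x - F a)%:E)%E.
  move=> axb; under eq_integral do rewrite EFinB.
  rewrite integralB//; [|exact: integrableS i1|exact: integrableS i2].
  by rewrite E1// E2// -EFinB /=; congr EFin; ring.
exists (fun t => h1 t - h2 t); split => //.
have ihy y : mu.-integrable [set` Interval (BRight a) (BRight y)] (EFin \o (fun t => h1 t - h2 t)).
  by apply: integrableS ih.
have := FTC1 ihy (open_integrable_locally openT ih).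
apply: filterS; first exact: (ae_filter_ringOfSetsType mu).
move=> x /= + /andP[ax xb] => H; have {H} [|dF F'] := H; first by exact: ax.
have [I IE] : exists I : R -> R, I = (fun x => \int[mu]_(t in `]a, x]) (h1 t - h2 t)) by eexists.
rewrite -IE in dF F'.
have dI : is_derive x 1 I (h1 x - h2 x).
  by apply: DeriveDef; [exact: dF|rewrite -derive1E; exact: F'].
have dFa : is_derive x 1 (fun t => I t + F a) (h1 x - h2 x + 0) by apply: is_deriveD.
rewrite addr0 in dFa; apply: near_eq_is_derive dFa => //.
near=> y; rewrite IE /Rintegral /= E ?subrK//.
by apply/andP; split; apply: ltW; near: y; [exact: lt_nbhsr|exact: lt_nbhsl].
Unshelve. all: by end_near. Qed.

End radon_nikodym_density.

(** * Polynomial approximation and integration by parts *)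

Section bernstein.
Context {R : realType}.
Implicit Types (f g : nat -> R) (t : R).

(** the Bernstein polynomial with values [f 0, ..., f n], given by the
    recursion for the number of successes in [n] Bernoulli trials *)
Fixpoint bernstein n f : {poly R} :=
  if n is n'.+1 then (1 - 'X) * bernstein n' f + 'X * bernstein n' (fun k => f k.+1)
  else (f 0%N)%:P.

Lemma bernsteinS n f t : (bernstein n.+1 f).[t] =
  (1 - t) * (bernstein n f).[t] + t * (bernstein n (fun k => f k.+1)).[t].
Proof. by rewrite /= !hornerE. Qed.

Lemma bernstein_le n f g t : 0 <= t <= 1 -> (forall k, (k <= n)%N -> f k <= g k) ->
  (bernstein n f).[t] <= (bernstein n g).[t].
Proof.
move=> /andP[t0 t1]; elim: n f g => [|n ih] f g fg; first by rewrite !hornerC fg.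
rewrite !bernsteinS; apply: lerD; apply: ler_wpM2l; rewrite ?subr_ge0//; apply: ih => k kn.
  by apply: fg; rewrite (leq_trans kn).
exact: fg.
Qed.

Lemma bernstein_affine n f (c e : R) t :
  (bernstein n (fun k => c + e * f k)).[t] = c + e * (bernstein n f).[t].
Proof.
elim: n f => [|n ih] f; first by rewrite !hornerC.
by rewrite !bernsteinS !ih; ring.
Qed.

Lemma bernstein_variance n (c : R) t :
  (bernstein n (fun k => (k%:R - c) ^+ 2)).[t] = n%:R * t * (1 - t) + (n%:R * t - c) ^+ 2.
Proof.
elim: n c => [|n ih] c; first by rewrite hornerC; ring.
rewrite bernsteinS ih (_ : (fun k : nat => (k.+1%:R - c) ^+ 2) = (fun k => (k%:R - (c - 1)) ^+ 2)).
  by rewrite ih -[n.+1]addn1 natrD; ring.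
by apply/funext => k; rewrite -[k.+1]addn1 natrD; congr (_ ^+ 2); ring.
Qed.

(** Bernstein's proof: the variance of the number of successes controls the
    distance of [x k] to [t].  The nodes [x k] avoid the ends of the interval, where
    nothing is known about [g]. *)
Lemma lipschitz_poly_approx (g : R -> R) (L e : R) : 0 < e ->
  (forall s t, 0 < s < 1 -> 0 < t < 1 -> `|g s - g t| <= L * `|s - t|) ->
  exists p : {poly R}, forall t, 0 < t < 1 -> `|g t - p.[t]| <= e.
Proof.
move=> e0; wlog L0 : L / 0 < L => [W H|gL].
  apply: (W (`|L| + 1)); first by rewrite ltr_wpDl.
  move=> s t s01 t01; apply: (le_trans (H s t s01 t01)); rewrite ler_wpM2r//.
  by rewrite (le_trans (ler_norm L))// lerDl.
have [dl [dl0 dlE]] : exists dl : R, 0 < dl /\ L * (2 * dl) = e.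
  by exists (e / (2 * L)); split; [rewrite divr_gt0// mulr_gt0|field; rewrite gt_eqF].
pose n := Num.bound (dl ^- 2).
have dn : (n.+2%:R : R)^-1 <= dl ^+ 2.
  rewrite -[dl ^+ 2]invrK lef_pV2 ?posrE ?invr_gt0 ?exprn_gt0 ?ltr0n//.
  apply: (@le_trans _ _ n%:R); last by rewrite ler_nat; lia.
  by apply/ltW/archi_boundP; rewrite invr_ge0 exprn_ge0// ltW.
have n0 : 0 < (n.+2%:R : R) by rewrite ltr0n.
pose x k : R := k.+1%:R / n.+2%:R.
exists (bernstein n (g \o x)) => t t01; have /andP[t0 t1] := t01.
have t01' : 0 <= t <= 1 by rewrite !ltW.
have x01 k : (k <= n)%N -> 0 < x k < 1.
  by move=> kn; rewrite /x divr_gt0 ?ltr0n//= ltr_pdivrMr// mul1r ltr_nat; lia.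
pose v k : R := (k%:R - (n.+2%:R * t - 1)) ^+ 2.
(* [|y| <= dl + y^2 / dl], with [y = x k - t] *)
have gv k : (k <= n)%N -> `|g (x k) - g t| <= L * dl + L / dl / n.+2%:R ^+ 2 * v k.
  move=> kn; apply: (le_trans (gL _ _ (x01 _ kn) t01)).
  rewrite (_ : L * dl + _ = L * (dl + (x k - t) ^+ 2 / dl)); last first.
    rewrite /v /x -[k.+1]addn1 natrD; field.
    by rewrite !gt_eqF.
  rewrite ler_wpM2l ?(ltW L0)// -real_normK ?num_real//.
  have := sqr_ge0 (`|x k - t| - dl); have := normr_ge0 (x k - t).
  move: `|x k - t| => y y0 h; rewrite -subr_ge0.
  have -> : dl + y ^+ 2 / dl - y = ((y - dl) ^+ 2 + y * dl) / dl by field; rewrite gt_eqF.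
  by rewrite divr_ge0 ?(ltW dl0)// addr_ge0// mulr_ge0// ltW.
have V : (bernstein n v).[t] <= n.+2%:R.
  rewrite bernstein_variance -[n.+2]addn2 natrD.
  have h : 0 <= (n%:R : R) by rewrite ler0n.
  rewrite (_ : n%:R * t - _ = 1 - 2 * t); last by ring.
  by move: (n%:R : R) h => y; nra.
have S : (bernstein n (fun k => L * dl + L / dl / n.+2%:R ^+ 2 * v k)).[t] <= e.
  rewrite bernstein_affine -dlE.
  apply: (@le_trans _ _ (L * dl + L / dl * n.+2%:R^-1)).
    rewrite lerD2l (_ : L / dl / n.+2%:R = L / dl / n.+2%:R ^+ 2 * n.+2%:R); last first.
      by field; rewrite !gt_eqF.
    by rewrite ler_wpM2l// divr_ge0 ?exprn_ge0 ?ler0n// divr_ge0// ltW.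
  apply: (@le_trans _ _ (L * dl + L / dl * dl ^+ 2)).
    by rewrite lerD2l ler_wpM2l// divr_ge0// ltW.
  by rewrite le_eqVlt; apply/orP; left; apply/eqP; field; rewrite gt_eqF.
move: S; set w := (fun k => _) => S.
have U : (bernstein n (g \o x)).[t] <= g t + 1 * (bernstein n w).[t].
  rewrite -bernstein_affine; apply: bernstein_le => // k kn.
  by have := gv k kn; rewrite -/(w k) mul1r ler_distl => /andP[_]; rewrite addrC.
have D : g t + -1 * (bernstein n w).[t] <= (bernstein n (g \o x)).[t].
  rewrite -bernstein_affine; apply: bernstein_le => // k kn.
  by have := gv k kn; rewrite -/(w k) mulN1r ler_distl => /andP[].
by rewrite ler_distl; apply/andP; split; lra.
Qed.

End bernstein.

Section ac_facts.
Context {R : realType}.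
Implicit Types (f : R -> R).
Local Notation AC := (Defs.absolutely_continuous `]0, 1[%classic).

Lemma ac_uniform f : AC f -> forall e : R, 0 < e -> exists2 dl : R, 0 < dl &
  forall s t, 0 < s < 1 -> 0 < t < 1 -> `|s - t| < dl -> `|f s - f t| < e.
Proof.
move=> acf e e0; have [dl dl0 H] := acf e e0; exists dl => // s t.
wlog st : s t / s <= t => [W s01 t01 std|/andP[s0 s1] /andP[t0 t1] std].
  have [st|/ltW ts] := leP s t; first exact: W.
  by rewrite distrC W// distrC.
have := H 1%N (fun=> s) (fun=> t); rewrite !big_ord1 distrC; apply => //.
- by move=> i x; rewrite /= !in_itv /= => /andP[sx xt]; rewrite (lt_le_trans s0)//= (le_lt_trans xt).
- by move=> i j _ _ _; rewrite !ord1.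
- by rewrite -[t - s]ger0_norm ?subr_ge0// distrC.
Qed.

(** [f] varies by at most [1] on each of finitely many subintervals. *)
Lemma ac_bounded f : AC f -> exists M : R, forall t, 0 < t < 1 -> `|f t| <= M.
Proof.
move=> acf; have [dl dl0 H] := ac_uniform acf ltr01.
have step n s t : 0 < s < 1 -> 0 < t < 1 -> s <= t -> t - s <= n%:R * (dl / 2) -> `|f s - f t| <= n%:R.
  elim: n s => [|n ih] s s01 t01 st.
    rewrite mul0r subr_le0 => ts; have -> : s = t by apply/eqP; rewrite eq_le st.
    by rewrite subrr normr0.
  have n0 : 0 <= (n%:R : R) by rewrite ler0n.
  have [ts|ts h] := leP (t - s) (dl / 2).
    move=> _; apply: ltW; apply: (@lt_le_trans _ _ 1); last by rewrite ler1n.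
    by apply: H => //; rewrite distrC ger0_norm ?subr_ge0//; lra.
  have s'01 : 0 < s + dl / 2 < 1 by move: s01 t01; lra.
  apply: (le_trans (ler_distD (f (s + dl / 2)) _ _)); rewrite -[n.+1]addn1 natrD addrC.
  apply: lerD.
    by apply: ih => //; [lra|move: h; rewrite -[n.+1]addn1 natrD mulrDl mul1r; lra].
  by apply/ltW/H => //; rewrite opprD addNKr normrN gtr0_norm; lra.
have [n nP] : exists n : nat, 1 <= n%:R * (dl / 2).
  exists (Num.bound (2 / dl)).
  have := @archi_boundP _ (2 / dl); rewrite divr_ge0 ?(ltW dl0)// => /(_ isT)/ltW.
  by rewrite ler_pdivrMr// mulrA ler_pdivlMr// mul1r.
exists (`|f (1 / 2)| + n%:R) => t t01.
have h01 : 0 < (1 / 2 : R) < 1 by lra.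
have ht : `|f t - f (1 / 2)| <= n%:R.
  have [th|/ltW ht] := leP t (1 / 2); first by apply: step => //; move: t01; lra.
  by rewrite distrC; apply: step => //; move: t01; lra.
by rewrite -[f t](subrK (f (1 / 2))) (le_trans (ler_normD _ _))// addrC lerD2l.
Qed.

Lemma ac_measurable f : AC f -> measurable_fun (`]0%R, 1%R[%classic : set R) f.
Proof.
move=> acf; apply: open_continuous_measurable_fun; first exact: interval_open.
move=> t; rewrite inE /= in_itv /= => t01; apply/cvgrPdist_lt => e e0.
have [dl dl0 H] := ac_uniform acf e0.
have /andP[t0 t1] := t01; near=> s.
have ts : `|t - s| < dl by near: s; exact: cvgr_dist_lt.
have s0 : 0 < s by near: s; exact: lt_nbhsr.
have s1 : s < 1 by near: s; exact: lt_nbhsl.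
by apply: H => //; rewrite s0.
Unshelve. all: by end_near. Qed.

Lemma lipschitz_ac f (L : R) :
  (forall s t, 0 < s < 1 -> 0 < t < 1 -> `|f s - f t| <= L * `|s - t|) -> AC f.
Proof.
move=> H e e0; have L1 : 0 < `|L| + 1 by rewrite ltr_wpDl.
exists (e / (`|L| + 1)); first by rewrite divr_gt0.
move=> n a b ab abD _ /[!ltr_pdivlMr]// h; apply: le_lt_trans h.
rewrite mulr_suml; apply: ler_sum => i _.
have a01 : 0 < a i < 1 by have := abD i (a i); rewrite /= !in_itv /= lexx ab; apply.
have b01 : 0 < b i < 1 by have := abD i (b i); rewrite /= !in_itv /= lexx ab; apply.
apply: (le_trans (H _ _ b01 a01)); rewrite ger0_norm ?subr_ge0// mulrC.
by rewrite ler_wpM2l ?subr_ge0// (le_trans (ler_norm L))// lerDl.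
Qed.

Lemma bounded_derive_lipschitz f (M : R) :
  (forall t, 0 < t < 1 -> derivable f t 1) ->
  (forall t, 0 < t < 1 -> `|f^`()%classic t| <= M) ->
  forall s t, 0 < s < 1 -> 0 < t < 1 -> `|f s - f t| <= M * `|s - t|.
Proof.
move=> df fM s t; wlog st : s t / s < t => [W s01 t01|s01 t01].
  have [st|ts|->] := ltgtP s t; first exact: W.
  - by rewrite distrC [`|s - t|]distrC W.
  - by rewrite !subrr normr0 mulr0.
have sub x : s <= x <= t -> 0 < x < 1 by move: s01 t01; lra.
have [c cst E] := @MVT R f f^`()%classic s t st
  ltac:(move=> x; rewrite in_itv /= => /andP[sx xt]; rewrite derive1E; apply: DeriveDef => //; apply: df; apply: sub; lra)
  ltac:(apply: derivable_within_continuous => x; rewrite in_itv /= => xst; apply: df; exact: sub).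
rewrite distrC E normrM [`|s - t|]distrC ler_wpM2r//; apply: fM; apply: sub.
by move: cst; rewrite in_itv /=; lra.
Qed.

End ac_facts.

Section integration_by_parts.
Context {R : realType}.
Local Notation mu := (@lebesgue_measure R).
Local Notation O01 := (`]0%R, 1%R[%classic : set R).
Local Notation AC := (Defs.absolutely_continuous O01).
Implicit Types (f g : R -> R) (P : {poly R}).

Lemma mO01 : measurable O01. Proof. exact: measurable_itv. Qed.

Lemma muO01_lty : (mu O01 < +oo)%E.
Proof. by rewrite lebesgue_measure_itv /= lte_fin ltr01 -EFinB subr0 ltry. Qed.

Lemma O01P t : O01 t = (0 < t < 1) :> Prop.
Proof. by rewrite /= in_itv. Qed.

Lemma bmf_O01 f : bmf (`[0%R, 1%R]%classic : set R) f -> bmf O01 f.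
Proof.
move=> [mf [M fM]]; split.
  by apply: measurable_funS mf => //; apply: subset_itvW.
by exists M => t /=; rewrite in_itv /= => /andP[t0 t1]; apply: fM; rewrite /= in_itv /= !ltW.
Qed.

Lemma bmf_poly P : bmf O01 (horner P).
Proof. exact/bmf_O01/bmf_horner. Qed.

Lemma integral_O01 f : measurable_fun (`[0%R, 1%R]%classic : set R) f ->
  \int[mu]_(t in `[0%R, 1%R]) f t = \int[mu]_(t in O01) f t.
Proof.
move=> mf; rewrite /Rintegral -integral_itv_bndo_bndc; last first.
  by apply/measurable_EFinP; apply: measurable_funS mf => //; apply: subset_itvl; rewrite bnd_simp.
rewrite -integral_itv_obnd_cbnd//.
by apply/measurable_EFinP; apply: measurable_funS mf => //; apply: subset_itvW.
Qed.

Lemma ac_mul f g : AC f -> AC g -> AC (fun t => f t * g t).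
Proof.
move=> acf acg; have [M fM] := ac_bounded acf; have [N gN] := ac_bounded acg.
move=> e e0; have M0 : 0 < `|M| + 1 by rewrite ltr_wpDl.
have N0 : 0 < `|N| + 1 by rewrite ltr_wpDl.
have [d1 d10 H1] := acf (e / 2 / (`|N| + 1)) ltac:(by rewrite !divr_gt0).
have [d2 d20 H2] := acg (e / 2 / (`|M| + 1)) ltac:(by rewrite !divr_gt0).
exists (Num.min d1 d2); first by rewrite lt_min d10.
move=> n a b ab abD tr; rewrite lt_min => /andP[s1 s2].
have := H1 n a b ab abD tr s1; have := H2 n a b ab abD tr s2.
rewrite (ltr_pdivlMr _ _ M0) (ltr_pdivlMr _ _ N0) => h2 h1; rewrite [e]splitr addrC; apply: le_lt_trans (ltrD h2 h1).
rewrite addrC !mulr_suml -big_split /=; apply: ler_sum => i _.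
have a01 : 0 < a i < 1 by have := abD i (a i); rewrite /= !in_itv /= lexx ab; apply.
have b01 : 0 < b i < 1 by have := abD i (b i); rewrite /= !in_itv /= lexx ab; apply.
rewrite (_ : _ - _ = (f (b i) - f (a i)) * g (b i) + (g (b i) - g (a i)) * f (a i)); last by ring.
apply: (le_trans (ler_normD _ _)); rewrite !normrM; apply: lerD; apply: ler_wpM2l => //.
  by apply: (le_trans (gN _ b01)); rewrite (le_trans (ler_norm N))// lerDl.
by apply: (le_trans (fM _ a01)); rewrite (le_trans (ler_norm M))// lerDl.
Qed.

Lemma poly_ac P : AC (horner P).
Proof.
have [_ [M PM]] := bmf_horner P^`().
apply: (@lipschitz_ac _ _ M); apply: bounded_derive_lipschitz.
  by move=> t _; exact: derivable_horner.
move=> t /andP[t0 t1]; rewrite derive1E; have /@derive_val -> := is_derive_poly P t.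
by apply: PM; rewrite /= in_itv /= !ltW.
Qed.

(** The boundary terms tend to [0] because [f] is bounded near the ends. *)
Lemma ac_by_parts f P : AC f -> P.[0] = 0 -> P.[1] = 0 ->
  mu.-integrable O01 (EFin \o (fun t => f^`()%classic t * P.[t])) ->
  \int[mu]_(t in O01) (f t * P^`().[t]) = - \int[mu]_(t in O01) (f^`()%classic t * P.[t]).
Proof.
move=> acf P0 P1 ifP; have [M fM] := ac_bounded acf.
have bf : bmf O01 f.
  by split; [exact: ac_measurable|exists M => t; rewrite O01P; exact: fM].
have ifP' : mu.-integrable O01 (EFin \o (fun t => f t * P^`().[t])).
  by apply: bmf_integrable; [exact: mO01|exact: muO01_lty|apply: bmfM => //; exact: bmf_poly].
pose k (t : R) : R := f^`()%classic t * P.[t] + f t * P^`().[t].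
have ik : mu.-integrable O01 (EFin \o k).
  have [u uE] : exists u : R -> \bar R, u = EFin \o (fun t => f^`()%classic t * P.[t]) by eexists.
  have [v vE] : exists v : R -> \bar R, v = EFin \o (fun t => f t * P^`().[t]) by eexists.
  have -> : EFin \o k = (u \+ v)%E by apply/funext => t; rewrite uE vE.
  by apply: integrableD; [exact: mO01|rewrite uE|rewrite vE].
have acfP := ac_mul acf (poly_ac P).
have sub a b : 0 < a -> b < 1 -> `]a, b] `<=` O01.
  move=> a0 b1 t /=; rewrite !in_itv /= => /andP[at_ tb].
  by rewrite (lt_trans a0 at_) (le_lt_trans tb b1).
have ftc a b : 0 < a -> a <= b -> b < 1 ->
    (\int[mu]_(t in `]a, b]) (k t)%:E = (f b * P.[b] - f a * P.[a])%:E)%E.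
  move=> a0 ab b1; pose b' := (b + 1) / 2.
  have ab' : a <= b' by rewrite /b'; lra.
  have b'1 : b' < 1 by rewrite /b'; lra.
  have [h [ih hE dh]] := ac_density ab' (ac_on_absolutely_continuous a0 b'1 acfP).
  have [h2 [_ _ dh2]] := ac_density ab' (ac_on_absolutely_continuous a0 b'1 acf).
  rewrite -(hE b); last by rewrite ab /b' /=; lra.
  apply: ae_eq_integral => //.
  - by apply: (measurable_funS mO01 (sub a b a0 b1)); case/integrableP : ik.
  - by apply: measurable_funS (measurable_int _ ih).
  have aef := ae_filter_ringOfSetsType mu.
  apply: filterS2 dh dh2 => t Ht Ht2 /=; rewrite in_itv /= => /andP[at_ tb].
  have tab' : a < t < b' by rewrite at_ /b' /=; lra.
  have d1 := Ht tab'; have d2 := Ht2 tab'.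
  have d3 : is_derive t 1 (fun t => f t * P.[t]) (f t *: P^`().[t] + P.[t] *: h2 t).
    exact: is_deriveM.
  rewrite /k derive1E (@derive_val _ _ _ _ _ _ _ d2).
  have := @derive_val _ _ _ _ _ _ _ d1; rewrite (@derive_val _ _ _ _ _ _ _ d3) => <-.
  by congr EFin; rewrite /GRing.scale /=; ring.
pose a n : R := n.+2%:R^-1.
have a0 n : 0 < a n by rewrite /a invr_gt0.
have a12 n : a n <= 1 / 2.
  by rewrite /a div1r lef_pV2 ?posrE// ler_nat.
have ca : a n @[n --> \oo] --> (0 : R).
  by have H := @cvg_harmonic R; rewrite -(cvg_shiftS (@harmonic R)) in H; exact: H.
pose F n : \bar R := (\int[mu]_(t in O01) ((EFin \o k) \_ `]a n, (1 - a n)%R]) t)%E.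
have FE n : (F n = (f (1 - a n) * P.[1 - a n] - f (a n) * P.[a n])%:E)%E.
  rewrite /F -integral_mkcondr setIidr; last by apply: sub => //; have := a0 n; lra.
  by apply: ftc => //; [have := a12 n; lra|have := a0 n; lra].
(* the integral of the derivative of [f P] over [[a n, 1 - a n]] has two limits *)
have c1 : (F n @[n --> \oo] --> \int[mu]_(t in O01) (k t)%:E)%E.
  have := @dominated_convergence _ _ _ mu O01 mO01 (fun n => (EFin \o k) \_ `]a n, 1 - a n])
    (EFin \o k) (abse \o (EFin \o k)).
  case=> //.
  - move=> n; apply: (measurable_restrict _ _ _).1 => //.
    by apply: measurable_funS (measurable_int _ ik) => //; exact: subIsetl.
  - exact: measurable_int ik.
  - apply: aeW => t; rewrite O01P => /andP[t0 t1]; apply: cvg_near_cst.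
    near=> n; rewrite patchE mem_set//= in_itv /=.
    have h1 : a n < t by near: n; exact: (cvgr_lt _ ca).
    have h2 : a n < 1 - t by near: n; apply: (cvgr_lt _ ca); rewrite subr_gt0.
    by rewrite h1 /=; lra.
  - exact: integrable_abse.
  - apply: aeW => t n _; rewrite patchE; case: ifPn => // _.
    by have -> : (point : \bar R) = 0%E by []; rewrite abse0; exact: abse_ge0.
have c2 : (F n @[n --> \oo] --> 0)%E.
  have -> : F = EFin \o (fun n => f (1 - a n) * P.[1 - a n] - f (a n) * P.[a n]).
    by apply/funext => n; rewrite FE.
  apply/cvg_EFin; first exact: nearW.
  have lim0 (u : nat -> R) (l : R) : u n @[n --> \oo] --> l -> P.[l] = 0 -> (forall n, 0 < u n < 1) ->
      f (u n) * P.[u n] @[n --> \oo] --> (0 : R).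
    move=> ul Pl u01; apply: norm_cvg0.
    have cP : M * `|P.[u n]| @[n --> \oo] --> (0 : R).
      rewrite -[X in _ --> X](mulr0 M) -(normr0 R) -Pl; apply: cvgMr; apply: cvg_norm.
      by apply: continuous_cvg ul; exact: continuous_horner.
    apply: (squeeze_cvgr _ (cvg_cst (0 : R)) cP); apply: nearW => n; rewrite normr_ge0 normrM /=.
    by rewrite ler_wpM2r// fM.
  rewrite -[X in _ --> X](subr0 (0 : R)); apply: cvgB; last first.
    by apply: (lim0 a 0 ca P0) => n; have := a0 n; have := a12 n; lra.
  apply: (lim0 (fun n => 1 - a n) 1 _ P1) => [|n]; last by have := a0 n; have := a12 n; lra.
  by rewrite -[X in _ --> X](subr0 (1 : R)); apply: cvgB => //; exact: cvg_cst.
have k0 : \int[mu]_(t in O01) k t = 0 by rewrite /Rintegral (cvg_unique _ c1 c2).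
have kD := @RintegralD _ _ _ mu O01 _ _ mO01 ifP ifP'.
by apply/eqP; rewrite -addr_eq0 addrC -kD; apply/eqP; exact: k0.
Unshelve. all: by end_near. Qed.

End integration_by_parts.

(** * Jacobi expansions of functions of Sobolev regularity *)

Section weighted_l2.
Context {R : realType}.
Local Notation mu := (@lebesgue_measure R).
Local Notation O01 := (`]0%R, 1%R[%classic : set R).
Implicit Types (f g h : R -> R) (c : R) (p : {poly R}) (a b k m : nat).

Local Notation jpoly := (@jpoly R).

Definition wint (f : R -> R) : R := \int[mu]_(t in O01) f t.

Definition oint f := mu.-integrable O01 (EFin \o f).

Lemma oint_bmf f : bmf O01 f -> oint f.
Proof. exact: (@bmf_integrable _ _ R mu O01 mO01 muO01_lty). Qed.

Lemma ointD f g : oint f -> oint g -> oint (fun t => f t + g t).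
Proof. exact: (@integrableD _ _ R mu O01 mO01 (EFin \o f) (EFin \o g)). Qed.

Lemma ointZ c f : oint f -> oint (fun t => c * f t).
Proof. exact: (@integrableZl _ _ R mu O01 mO01 c (EFin \o f)). Qed.

Lemma oint_le f g : measurable_fun O01 f -> (forall t, O01 t -> `|f t| <= g t) -> oint g -> oint f.
Proof.
move=> mf fg; apply: (@le_integrable _ _ R mu O01 mO01 (EFin \o f) (EFin \o g)).
  exact/measurable_EFinP.
by move=> t Ot; rewrite /= lee_fin (le_trans (fg t Ot))// ler_norm.
Qed.

Lemma wintD f g : oint f -> oint g -> wint (fun t => f t + g t) = wint f + wint g.
Proof. exact: (@RintegralD _ _ R mu O01 f g mO01). Qed.

Lemma wintZ c f : oint f -> wint (fun t => c * f t) = c * wint f.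
Proof. by move=> fi; exact: (@RintegralZl _ _ R mu O01 f c mO01 fi). Qed.

Lemma eq_wint f g : (forall t, O01 t -> f t = g t) -> wint f = wint g.
Proof. by move=> fg; apply: eq_Rintegral => t /set_mem/fg. Qed.

Lemma wint_ge0 f : (forall t, O01 t -> 0 <= f t) -> 0 <= wint f.
Proof. by move=> f0; apply: Rintegral_ge0 => t; exact: f0. Qed.

Definition wL2 a b h := measurable_fun O01 h /\
  oint (fun t => h t ^+ 2 * (jw a b).[t]).

Lemma jw_horner a b (t : R) : (jw a b).[t] = (1 - t) ^+ a * t ^+ b.
Proof. by rewrite /jw hornerM !horner_exp !hornerE. Qed.

Lemma jw_ge0 a b (t : R) : O01 t -> 0 <= (jw a b).[t].
Proof. by rewrite O01P jw_horner => /andP[t0 t1]; rewrite mulr_ge0// exprn_ge0 ?subr_ge0// ltW. Qed.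

Lemma jwD a b m k : jw (a + m) (b + k) = jw a b * jw m k :> {poly R}.
Proof. by rewrite /jw !exprD; ring. Qed.

Lemma jw_le1 a b (t : R) : O01 t -> (jw a b).[t] <= 1.
Proof.
rewrite O01P jw_horner => /andP[t0 t1]; rewrite -[leRHS]mul1r; apply: ler_pM.
- by rewrite exprn_ge0// subr_ge0 ltW.
- by rewrite exprn_ge0// ltW.
- by rewrite exprn_ile1 ?subr_ge0 ?(ltW t1)// gerBl ltW.
- by rewrite exprn_ile1 ?(ltW t0)// ltW.
Qed.

Lemma wL2_bmf a b h : bmf O01 h -> wL2 a b h.
Proof.
move=> bh; split; first by case: bh.
by apply: oint_bmf; apply: bmfM; [exact: bmfX|exact: bmf_poly].
Qed.

Lemma wL2_shift a b m k h : wL2 a b h -> wL2 (a + m) (b + k) h.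
Proof.
move=> [mh ih]; split => //; apply: oint_le ih.
  apply: measurable_funM; first exact: measurable_funX.
  exact: (proj1 (bmf_poly _)).
move=> t Ot; rewrite jwD hornerM mulrA normrM ger0_norm; last first.
  by apply: mulr_ge0; [exact: sqr_ge0|exact: jw_ge0].
apply: ler_piMr; first by apply: mulr_ge0; [exact: sqr_ge0|exact: jw_ge0].
by rewrite ger0_norm ?jw_ge0// jw_le1.
Qed.

(** [|h| <= 1 + h^2], and the weight and the polynomial are bounded. *)
Lemma wL2_integrable a b h p : wL2 a b h -> oint (fun t => h t * (jw a b * p).[t]).
Proof.
move=> [mh ih]; have [mp [M pM]] := bmf_poly p.
have iw : oint (horner (jw a b)) by apply: oint_bmf; exact: bmf_poly.
apply: oint_le (ointZ (`|M|) (ointD iw ih)).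
  by apply: measurable_funM => //; exact: (proj1 (bmf_poly _)).
move=> t Ot; rewrite hornerM.
have w0 := jw_ge0 a b Ot; have p1 := pM t Ot.
rewrite (_ : h t * _ = p.[t] * (h t * (jw a b).[t])); last by ring.
rewrite normrM; apply: ler_pM => //; first by rewrite (le_trans p1)// ler_norm.
rewrite normrM (ger0_norm w0) -[X in _ <= X + _]mul1r -mulrDl ler_wpM2r//.
rewrite -[h t ^+ 2]real_normK ?num_real//.
by have := sqr_ge0 (`|h t| - 1); have := normr_ge0 (h t); move: `|h t| => y; nra.
Qed.

Section expansion.
Variables (a b : nat) (h : R -> R).
Hypothesis hL2 : wL2 a b h.

Definition wdot p := wint (fun t => h t * (jw a b * p).[t]).
Definition wnorm := wint (fun t => h t ^+ 2 * (jw a b).[t]).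
Definition werr p := wint (fun t => (h t - p.[t]) ^+ 2 * (jw a b).[t]).
Definition wcoef k := wdot (jpoly a b k).
Definition wsum m : {poly R} := \sum_(k < m) wcoef k *: jpoly a b k.

Lemma wdotD p u : wdot (p + u) = wdot p + wdot u.
Proof.
rewrite /wdot -(wintD (wL2_integrable p hL2) (wL2_integrable u hL2)).
by apply: eq_wint => t _; rewrite mulrDr hornerD mulrDr.
Qed.

Lemma wdotZ c p : wdot (c *: p) = c * wdot p.
Proof.
rewrite /wdot -(wintZ c (wL2_integrable p hL2)).
by apply: eq_wint => t _; rewrite -scalerAr hornerZ mulrCA.
Qed.

Lemma wdot0 : wdot 0 = 0.
Proof. by rewrite -(scale0r (0 : {poly R})) wdotZ mul0r. Qed.

Lemma wdot_sum (I : Type) (s : seq I) (F : I -> {poly R}) :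
  wdot (\sum_(i <- s) F i) = \sum_(i <- s) wdot (F i).
Proof. by elim: s => [|i s ih]; rewrite ?big_nil ?wdot0// !big_cons wdotD ih. Qed.

Lemma pint_O01 p : pint p = wint (horner p).
Proof. by rewrite pintE /wint integral_O01//; case: (bmf_horner p). Qed.

Lemma werrE p : werr p = wnorm - 2 * wdot p + pint (jw a b * p * p).
Proof.
have i2 := ointZ (-2) (wL2_integrable p hL2).
have i3 : oint (horner (jw a b * p * p)) by apply: oint_bmf; exact: bmf_poly.
rewrite -mulNr -(wintZ (-2) (wL2_integrable p hL2)) pint_O01.
rewrite -(wintD (proj2 hL2) i2) -(wintD (ointD (proj2 hL2) i2) i3).
by apply: eq_wint => t _; rewrite !hornerM; ring.
Qed.

Lemma werr_ge0 p : 0 <= werr p.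
Proof.
apply: wint_ge0 => t Ot; apply: mulr_ge0; first exact: sqr_ge0.
exact: jw_ge0.
Qed.

Lemma werr_sum m (c : nat -> R) : werr (\sum_(k < m) c k *: jpoly a b k) =
  wnorm - \sum_(k < m) wcoef k ^+ 2 + \sum_(k < m) (c k - wcoef k) ^+ 2.
Proof.
rewrite werrE pint_sum_jpoly wdot_sum.
rewrite -[RHS]addrA -sumrN -big_split -[LHS]addrA mulr_sumr -sumrN -big_split /=; congr (_ + _).
by apply: eq_bigr => k _; rewrite wdotZ /wcoef; ring.
Qed.

Lemma werr_wsum m : werr (wsum m) = wnorm - \sum_(k < m) wcoef k ^+ 2.
Proof. rewrite werr_sum [X in _ + X]big1 ?addr0// => k _.
by rewrite subrr expr0n. Qed.

Lemma bessel m : \sum_(k < m) wcoef k ^+ 2 <= wnorm.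
Proof. by rewrite -subr_ge0 -werr_wsum werr_ge0. Qed.

(** The partial sums of the expansion are the best approximations in the weighted
    L2 norm. *)
Lemma werr_wsum_le m p : (size p <= m)%N -> werr (wsum m) <= werr p.
Proof.
move=> pm; rewrite [in leRHS](jpoly_span a b pm) (werr_sum m (jcoef a b p)) werr_wsum lerDl.
by apply: sumr_ge0 => k _; exact: sqr_ge0.
Qed.

End expansion.
End weighted_l2.

Section sobolev_coefficients.
Context {R : realType}.
Local Notation mu := (@lebesgue_measure R).
Local Notation O01 := (`]0%R, 1%R[%classic : set R).
Local Notation AC := (Defs.absolutely_continuous O01).
Local Notation jpoly := (@jpoly R).
Implicit Types (f g h : R -> R) (a b k m : nat).

Lemma wint_le f g : oint f -> oint g -> (forall t, O01 t -> f t <= g t) -> wint f <= wint g.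
Proof. move=> fi gi fg; exact: (@le_Rintegral _ _ R mu O01 f g mO01 fi gi fg). Qed.

Lemma wint_cst (c : R) : wint (fun=> c) = c.
Proof.
rewrite /wint Rintegral_cst; last exact: mO01.
have H : mu O01 = 1%E by rewrite lebesgue_measure_itv /= lte_fin ltr01 -EFinB subr0.
by rewrite [X in fine X]H mulr1.
Qed.

Lemma wint_ae f g : measurable_fun O01 f -> measurable_fun O01 g ->
  {ae mu, forall t, 0 < t < 1 -> f t = g t} -> wint f = wint g.
Proof.
move=> mf mg fg; rewrite /wint /Rintegral; congr fine; apply: ae_eq_integral.
- exact: mO01.
- exact/measurable_EFinP.
- exact/measurable_EFinP.
have aef := ae_filter_ringOfSetsType mu.
by apply: filterS fg => t H; rewrite O01P => t01; rewrite H.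
Qed.

Section chain.
Variables (g : R -> R) (s : nat).
Local Notation G j := (derive1n j g).
Hypothesis dg : forall k t, (k < s)%N -> 0 < t < 1 -> derivable (G k) t 1.
Hypothesis acg : AC (G s).

Lemma sobolev_ac j : (j <= s)%N -> AC (G j).
Proof.
move=> js; rewrite -(subKn js); move: (s - j)%N (leq_subr j s) => i.
elim: i => [|i ih] is_; first by rewrite subn0.
have [M HM] := ac_bounded (ih (ltnW is_)).
apply: (@lipschitz_ac _ _ M); apply: bounded_derive_lipschitz => t t01.
  by apply: dg => //; lia.
by rewrite -derive1nS (_ : (s - i.+1).+1 = s - i)%N ?HM//; lia.
Qed.

Lemma sobolev_lipschitz : (0 < s)%N -> exists L : R,
  forall x y, 0 < x < 1 -> 0 < y < 1 -> `|g x - g y| <= L * `|x - y|.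
Proof.
move=> s0; have [M HM] := ac_bounded (sobolev_ac s0).
exists M; apply: bounded_derive_lipschitz => t t01; first exact: (@dg 0%N).
exact: HM.
Qed.

Lemma sobolev_bmf j : (j <= s)%N -> bmf O01 (G j).
Proof.
move=> js; have ac := sobolev_ac js; split; first exact: ac_measurable.
by have [M HM] := ac_bounded ac; exists M => t; rewrite O01P; exact: HM.
Qed.

(** The derivative of the weight that remains after [j] steps still vanishes at
    both ends.  In the last step the derivative of order [s + 1] of [g] is only
    square integrable for the weight [jw a b]; the other factor is divisible by
    that weight. *)
Lemma sobolev_by_parts a b k j : wL2 a b (G s.+1) -> (j <= s.+1)%N -> (s < k)%N ->
  wint (fun t => g t * (jw (a + k) (b + k))^`(k).[t]) =
  (-1) ^+ j * wint (fun t => G j t * (jw (a + k) (b + k))^`(k - j).[t]).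
Proof.
move=> GL2 + sk; elim: j => [|j ih] js; first by rewrite subn0 expr0 mul1r.
rewrite ih ?(ltnW js)// exprS mulN1r mulNr -mulrN; congr (_ * _).
rewrite (_ : k - j = (k - j.+1).+1)%N; last by lia.
rewrite derivnS; apply: ac_by_parts.
- by apply: sobolev_ac.
- by have [] := @jw_deriv_ends R a b k (k - j.+1) ltac:(lia).
- by have [] := @jw_deriv_ends R a b k (k - j.+1) ltac:(lia).
have [jlt|] := ltnP j s.
  by apply: oint_bmf; apply: bmfM; [exact: (sobolev_bmf jlt)|exact: bmf_poly].
move=> sj; have -> : j = s by lia.
rewrite jw_derivn_small// scalerAr jwD -(mulrA (jw a b) (jw s.+1 s.+1)).
exact: wL2_integrable.
Qed.

(** Up to the factor bounded in [jnorm_ratio], the coefficients of [g] are those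
    of its derivative of order [s + 1] in the basis for the weight with both
    exponents increased by [s + 1]. *)
Lemma sobolev_coef a b k : wL2 a b (G s.+1) -> (s < k)%N ->
  wcoef a b g k ^+ 2 <=
  s.+1%:R ^+ s.+1 / k%:R ^+ (2 * s.+1) * wcoef (a + s.+1) (b + s.+1) (G s.+1) (k - s.+1) ^+ 2.
Proof.
move=> GL2 sk; have GL2' := wL2_shift s.+1 s.+1 GL2.
have bg : bmf O01 g := sobolev_bmf (leq0n s).
have E1 : wcoef a b g k = (Num.sqrt (jnorm a b k))^-1 * ((-1) ^+ k / k`!%:R) *
    wint (fun t => g t * (jw (a + k) (b + k))^`(k).[t]).
  rewrite -wintZ; last by apply: oint_bmf; apply: bmfM => //; exact: bmf_poly.
  apply: eq_wint => t _; rewrite jpolyE -scalerAr jacobi01_rodrigues !hornerZ.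
  by ring.
have E2 : wint (fun t => G s.+1 t * (jw (a + k) (b + k))^`(k - s.+1).[t]) =
    ((-1) ^+ (k - s.+1) * (k - s.+1)`!%:R * Num.sqrt (jnorm (a + s.+1) (b + s.+1) (k - s.+1))) *
    wcoef (a + s.+1) (b + s.+1) (G s.+1) (k - s.+1).
  rewrite -wintZ; last exact: wL2_integrable.
  apply: eq_wint => t _; rewrite jw_derivn_small// jpolyE -(scalerAr _ (jw (a + s.+1) (b + s.+1))) !hornerZ.
  have := @sqrt_jnorm_neq0 R (a + s.+1) (b + s.+1) (k - s.+1).
  move: (Num.sqrt _) => x x0; move: (G s.+1 t) ((-1) ^+ (k - s.+1)) ((jw _ _ * _).[t]) => u v w.
  by field.
rewrite E1 (sobolev_by_parts GL2 (leqnn _) sk) E2.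
set w := wcoef _ _ _ _; rewrite -[X in X <= _]mul1r.
have -> : 1 * ((Num.sqrt (jnorm a b k))^-1 * ((-1) ^+ k / k`!%:R) * ((-1) ^+ s.+1 *
    ((-1) ^+ (k - s.+1) * (k - s.+1)`!%:R * Num.sqrt (jnorm (a + s.+1) (b + s.+1) (k - s.+1)) * w))) ^+ 2 =
    ((k - s.+1)`!%:R / k`!%:R) ^+ 2 * @jnorm R (a + s.+1) (b + s.+1) (k - s.+1) / jnorm a b k * w ^+ 2.
  have n1 := @jnorm_gt0 R a b k; have n2 := @jnorm_gt0 R (a + s.+1) (b + s.+1) (k - s.+1).
  rewrite -[in RHS](sqr_sqrtr (ltW n1)) -[in RHS](sqr_sqrtr (ltW n2)).
  rewrite mul1r !exprMn !sqrr_sign !mul1r !exprVn; ring.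
by rewrite ler_wpM2r ?sqr_ge0// jnorm_ratio//; lia.
Qed.

End chain.
End sobolev_coefficients.

Section sobolev_approximation.
Context {R : realType}.
Local Notation mu := (@lebesgue_measure R).
Local Notation I01 := (`[0%R, 1%R]%classic : set R).
Local Notation O01 := (`]0%R, 1%R[%classic : set R).
Local Notation jpoly := (@jpoly R).
Implicit Types (a b k m s : nat).

Lemma sum_inv_sqr_le m : \sum_(j < m) ((j.+1)%:R ^+ 2 : R)^-1 <= 2.
Proof.
have H n : \sum_(j < n.+1) ((j.+1)%:R ^+ 2 : R)^-1 <= 2 - n.+1%:R^-1.
  elim: n => [|n ih]; first by rewrite big_ord_recr big_ord0 /= add0r expr1n; lra.
  rewrite big_ord_recr /=; apply: (le_trans (lerD ih (lexx _))).
  have x0 : 0 < (n.+1%:R : R) by rewrite ltr0n.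
  rewrite -[n.+2]addn1 natrD; move: (n.+1%:R : R) x0 => x x0.
  rewrite -subr_ge0; have -> : 2 - (x + 1)^-1 - (2 - x^-1 + ((x + 1) ^+ 2)^-1) = (x * (x + 1) ^+ 2)^-1.
    by field; rewrite !gt_eqF//; lra.
  by rewrite invr_ge0 mulr_ge0 ?(ltW x0)// sqr_ge0.
case: m => [|m]; first by rewrite big_ord0.
by apply: (le_trans (H m)); rewrite gerBl invr_ge0 ler0n.
Qed.

Lemma jpoly_sqr_le a b k (t : R) : 0 <= t <= 1 ->
  (jpoly a b k).[t] ^+ 2 <= 2 ^+ (a + b).+1 * (2 * (a + b).+1%:R ^+ (2 * (a + b)).+1) *
                           k.+1%:R ^+ (2 * (a + b)).+2.
Proof.
move=> t01; have sk : (size (jpoly a b k) <= k.+1)%N by rewrite size_jpoly.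
by have := nikolskii a b sk t01; rewrite pint_jpoly eqxx mulr1.
Qed.

Lemma young_abs (x d e : R) : 0 <= d -> 0 <= e -> x ^+ 2 <= d * e -> `|x| <= (d + e) / 2.
Proof.
move=> d0 e0 xde; rewrite -(@ler_pXn2r _ 2) ?nnegrE ?divr_ge0 ?addr_ge0//.
rewrite real_normK ?num_real//; apply: (le_trans xde); rewrite -subr_ge0.
have -> : ((d + e) / 2) ^+ 2 - d * e = ((d - e) / 2) ^+ 2 by field.
exact: sqr_ge0.
Qed.

Lemma sum_tail_le (x y : nat -> R) m M : (forall j, 0 <= x j) -> (forall j, 0 <= y j) ->
  (forall j, (m <= j)%N -> x j <= y j) ->
  \sum_(j < M) x j <= \sum_(j < m) x j + \sum_(j < M) y j.
Proof.
move=> x0 y0 xy; have [mM|Mm] := leqP m M.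
  rewrite -(subnKC mM) !big_split_ord /= lerD2l; apply: (@le_trans _ _ (\sum_(i < M - m) y (m + i)%N)).
    by apply: ler_sum => i _; rewrite xy// leq_addr.
  by rewrite lerDr; apply: sumr_ge0.
rewrite -(subnKC (ltnW Mm)) big_split_ord /= -addrA lerDl addr_ge0//; exact: sumr_ge0.
Qed.

Lemma double_exponent a b s : (a + b < s)%N -> ((2 * (a + b)).+2 + 2 <= 2 * s.+1)%N.
Proof. by lia. Qed.

Section coefs.
Variables (a b s : nat) (g : R -> R).
Local Notation G j := (derive1n j g).
Local Notation r := s.+1.
Hypothesis dg : forall k t, (k < s)%N -> 0 < t < 1 -> derivable (G k) t 1.
Hypothesis acg : Defs.absolutely_continuous O01 (G s).
Hypothesis GL2 : wL2 a b (G r).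
Hypothesis abs : (a + b < s)%N.

Let c k := wcoef a b g k.
Let d k := wcoef (a + r) (b + r) (G r) k.
Let B := wnorm (a + r) (b + r) (G r).
Let E := wnorm a b g.
Let K : R := 2 ^+ (a + b).+1 * (2 * (a + b).+1%:R ^+ (2 * (a + b)).+1).

Let gL2 : wL2 a b g.
Proof. exact/wL2_bmf/(sobolev_bmf dg acg (leq0n s)). Qed.

Let K0 : 0 <= K.
Proof. by apply: mulr_ge0; [exact: exprn_ge0|apply: mulr_ge0 => //; apply: exprn_ge0; exact: ler0n]. Qed.

Let B0 : 0 <= B.
Proof. by apply: wint_ge0 => t Ot; apply: mulr_ge0; [exact: sqr_ge0|exact: jw_ge0]. Qed.

Let E0 : 0 <= E.
Proof. by apply: wint_ge0 => t Ot; apply: mulr_ge0; [exact: sqr_ge0|exact: jw_ge0]. Qed.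

Let coef j : c (r + j)%N ^+ 2 <= r%:R ^+ r / (r + j)%:R ^+ (2 * r) * d j ^+ 2.
Proof. by have := sobolev_coef dg acg GL2 (leq_addr j r); rewrite addKn. Qed.

Let expn_le (x : R) n m' : 1 <= x -> (n <= m')%N -> x ^+ n <= x ^+ m'.
Proof. by move=> x1 nm; rewrite ler_weXn2l. Qed.

(** Young's inequality splits each term into a summable square of a coefficient
    and [1 / (j + 1)^2]; the latter is where [a + b < s] is used, against the
    growth of the polynomials. *)
Let term j t : 0 <= t <= 1 -> `|c (r + j)%N * (jpoly a b (r + j)).[t]| <=
  (d j ^+ 2 + r%:R ^+ r * K * 2 ^+ (2 * (a + b)).+2 * (j.+1%:R ^+ 2)^-1) / 2.
Proof.
move=> t01; have k0 : 0 < ((r + j)%:R : R) by rewrite ltr0n.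
have k1 : 1 <= ((r + j)%:R : R) by rewrite ler1n.
have e0 : 0 <= r%:R ^+ r * K * 2 ^+ (2 * (a + b)).+2.
  by apply: mulr_ge0; [apply: mulr_ge0 => //; apply: exprn_ge0; exact: ler0n|exact: exprn_ge0].
apply: young_abs; [exact: sqr_ge0|by apply: mulr_ge0 => //; rewrite invr_ge0; apply: exprn_ge0; exact: ler0n|].
rewrite exprMn; apply: (le_trans (ler_pM (sqr_ge0 _) (sqr_ge0 _) (coef j) (jpoly_sqr_le a b (r + j) t01))).
have D0 : 0 <= d j ^+ 2 by exact: sqr_ge0.
have h1 : ((r + j).+1%:R : R) <= 2 * (r + j)%:R by rewrite -[_.+1]addn1 natrD; lra.
have h2 : (r + j).+1%:R ^+ (2 * (a + b)).+2 <= 2 ^+ (2 * (a + b)).+2 * (r + j)%:R ^+ (2 * (a + b)).+2 :> R.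
  by rewrite -exprMn lerXn2r ?nnegrE// ?ler0n// mulr_ge0 ?ler0n.
have h3 : (r + j)%:R ^+ (2 * (a + b)).+2 * (j.+1%:R ^+ 2) <= (r + j)%:R ^+ (2 * r) :> R.
  apply: (@le_trans _ _ ((r + j)%:R ^+ (2 * (a + b)).+2 * (r + j)%:R ^+ 2)).
    by rewrite ler_wpM2l ?exprn_ge0 ?ler0n// lerXn2r ?nnegrE ?ler0n// ler_nat addSn ltnS leq_addl.
  by rewrite -exprD expn_le// double_exponent.
have p1 : 0 < ((r + j)%:R ^+ (2 * r) : R) by rewrite exprn_gt0.
have p2 : 0 < (j.+1%:R ^+ 2 : R) by rewrite exprn_gt0// ltr0n.
have y0 : 0 <= (r%:R ^+ r : R) by apply: exprn_ge0; exact: ler0n.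
have w0 : 0 <= (2 ^+ (2 * (a + b)).+2 : R) by exact: exprn_ge0.
rewrite -/K; move: K K0 (d j ^+ 2) D0 {e0} h2 h3 p1 p2 y0 w0 => k k0' D D0.
move: ((r + j)%:R ^+ (2 * r) : R) ((r + j).+1%:R ^+ (2 * (a + b)).+2 : R) (2 ^+ (2 * (a + b)).+2 : R).
move: ((r + j)%:R ^+ (2 * (a + b)).+2 : R) (r%:R ^+ r : R) (j.+1%:R ^+ 2 : R) => x y z u v w h2 h3 u0 z0 y0 w0.
have H : v / u <= w / z.
  rewrite ler_pdivrMr// mulrAC ler_pdivlMr//; apply: (@le_trans _ _ (w * x * z)).
    by rewrite ler_wpM2r// ltW.
  by rewrite -mulrA ler_wpM2l.
rewrite (_ : y / u * D * (k * v) = D * y * k * (v / u)); last by ring.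
rewrite (_ : D * (y * k * w / z) = D * y * k * (w / z)); last by ring.
by apply: ler_wpM2l => //; do 2! (apply: mulr_ge0 => //).
Qed.

Lemma wsum_bounded : exists C : R, forall m t, 0 <= t <= 1 -> `|(wsum a b g m).[t]| <= C.
Proof.
exists (\sum_(k < r) (c k ^+ 2 + K * k.+1%:R ^+ (2 * (a + b)).+2) / 2 +
        (B + r%:R ^+ r * K * 2 ^+ (2 * (a + b)).+2 * 2) / 2) => m t t01.
rewrite /wsum horner_sum.
apply: (@le_trans _ _ (\sum_(k < r + m) `|c k * (jpoly a b k).[t]|)).
  apply: (@le_trans _ _ (\sum_(k < m) `|c k * (jpoly a b k).[t]|)).
    apply: le_trans (ler_norm_sum _ _ _) _; apply: ler_sum => k _; by rewrite hornerZ.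
  by rewrite [(r + m)%N]addnC big_split_ord /= lerDl sumr_ge0.
rewrite big_split_ord /=; apply: lerD.
  apply: ler_sum => k _; apply: young_abs; first exact: sqr_ge0.
    by apply: mulr_ge0 => //; apply: exprn_ge0; exact: ler0n.
  by rewrite exprMn ler_wpM2l ?sqr_ge0// jpoly_sqr_le.
apply: (@le_trans _ _ (\sum_(j < m) ((d j ^+ 2 + r%:R ^+ r * K * 2 ^+ (2 * (a + b)).+2 * (j.+1%:R ^+ 2)^-1) / 2))).
  by apply: ler_sum => j _; exact: term.
rewrite -mulr_suml ler_wpM2r ?invr_ge0// big_split /= -mulr_sumr; apply: lerD.
  exact: (bessel (wL2_shift r r GL2)).
apply: ler_wpM2l; last exact: sum_inv_sqr_le.
by apply: mulr_ge0; [apply: mulr_ge0 => //; apply: exprn_ge0; exact: ler0n|exact: exprn_ge0].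
Qed.

(** Beyond the order [r] the coefficients are bounded by [sobolev_coef] and
    Bessel's inequality for the derivative; for [m + 1] smaller than
    [r] the term [E] absorbs the whole sum. *)
Lemma wsum_coef_tail m M : (0 < m)%N ->
  \sum_(k < r + M) c k ^+ 2 <= \sum_(k < m.+1) c k ^+ 2 + (r%:R ^+ r * B + r%:R ^+ (2 * r) * E) / m%:R ^+ (2 * r).
Proof.
move=> m0; have m0' : 0 < (m%:R ^+ (2 * r) : R) by rewrite exprn_gt0// ltr0n.
have rB : 0 <= r%:R ^+ r * B by apply: mulr_ge0 => //; apply: exprn_ge0; exact: ler0n.
have rE : 0 <= r%:R ^+ (2 * r) * E by apply: mulr_ge0 => //; apply: exprn_ge0; exact: ler0n.
have [rm|mr] := leqP r m.+1; last first.
  apply: (le_trans (bessel gL2 (r + M))); rewrite -[leLHS]add0r; apply: lerD.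
    by apply: sumr_ge0 => k _; exact: sqr_ge0.
  rewrite ler_pdivlMr// -[leLHS]add0r; apply: lerD => //; rewrite mulrC; apply: ler_wpM2r => //.
  by rewrite lerXn2r ?nnegrE ?ler0n// ler_nat; lia.
rewrite -(subnKC rm) !big_split_ord /= -addrA lerD2l.
apply: (le_trans (@sum_tail_le (fun j => c (r + j)%N ^+ 2)
   (fun j => r%:R ^+ r / m%:R ^+ (2 * r) * d j ^+ 2) (m.+1 - r) M _ _ _)).
- by move=> j; exact: sqr_ge0.
- by move=> j; apply: mulr_ge0; [apply: divr_ge0; [apply: exprn_ge0; exact: ler0n|exact: ltW]|exact: sqr_ge0].
- move=> j mj; apply: (le_trans (coef j)); apply: ler_wpM2r; first exact: sqr_ge0.
  apply: ler_wpM2l; first by apply: exprn_ge0; exact: ler0n.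
  rewrite lef_pV2 ?posrE ?exprn_gt0 ?ltr0n//.
  by rewrite lerXn2r ?nnegrE ?ler0n// ler_nat; lia.
rewrite lerD2l -mulr_sumr mulrDl -[leLHS]addr0; apply: lerD; last by apply: divr_ge0 => //; exact: ltW.
rewrite [leRHS]mulrAC; apply: ler_wpM2l; last exact: (bessel (wL2_shift r r GL2)).
by apply: divr_ge0; [apply: exprn_ge0; exact: ler0n|exact: ltW].
Qed.

(** A polynomial uniformly close to [g] shows that the expansion converges to [g],
    so the error is the sum of the squares of the remaining coefficients. *)
Lemma wsum_rate : exists C : R, forall m, (0 < m)%N ->
  werr a b g (wsum a b g m.+1) <= C / m%:R ^+ (2 * r).
Proof.
exists (r%:R ^+ r * B + r%:R ^+ (2 * r) * E) => m m0; apply/ler_addgt0Pr => e e0.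
have s0 : (0 < s)%N by lia.
have [L gL] := sobolev_lipschitz dg acg s0.
have [e' e'0 ee'] : exists2 e' : R, 0 < e' & e' ^+ 2 <= e.
  exists (Num.min 1 e); first by rewrite lt_min ltr01.
  apply: (@le_trans _ _ (1 * Num.min 1 e)); last by rewrite mul1r ge_min lexx orbT.
  by rewrite expr2 ler_wpM2r ?le_min ?ler01 ?(ltW e0)// ge_min lexx.
have [p gp] := lipschitz_poly_approx e'0 gL.
have bg : bmf O01 (fun t => (g t - p.[t]) ^+ 2 * (jw a b).[t]).
  apply: bmfM; last exact: bmf_poly.
  by apply: bmfX; apply: bmfB; [exact: (sobolev_bmf dg acg (leq0n s))|exact: bmf_poly].
have err_p : werr a b g p <= e.
  rewrite -[leRHS]wint_cst; apply: wint_le.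
  - exact: oint_bmf.
  - by apply: oint_bmf; exact: bmf_cst.
  move=> t Ot; apply: le_trans ee'; rewrite -[leRHS]mulr1; apply: ler_pM.
  - exact: sqr_ge0.
  - exact: jw_ge0.
  - by rewrite -[leLHS]real_normK ?num_real// lerXn2r ?nnegrE ?(ltW e'0)// gp -?O01P.
  - exact: jw_le1.
have := werr_wsum_le gL2 (leq_addl r (size p)).
rewrite !(werr_wsum gL2) => h; have := wsum_coef_tail (size p) m0; rewrite -/E.
move: h err_p; rewrite -/E /c.
move: (\sum_(k < _) _) (\sum_(k < _) _) => x y h1 h2 h3.
by lra.
Qed.

End coefs.
End sobolev_approximation.

Section sobolev_phi.
Context {R : realType}.
Local Notation mu := (@lebesgue_measure R).
Local Notation I01 := (`[0%R, 1%R]%classic : set R).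
Local Notation O01 := (`]0%R, 1%R[%classic : set R).

Lemma oint_I01_lty (f : R -> R) : measurable_fun I01 f -> (forall t, I01 t -> 0 <= f t) ->
  (\int[mu]_(t in I01) (f t)%:E < +oo)%E -> oint f.
Proof.
move=> mf f0 fI; have sub : O01 `<=` I01 by exact: subset_itvW.
apply/integrableP; split; first by apply/measurable_EFinP; apply: measurable_funS mf.
apply: le_lt_trans fI; under eq_integral => t /set_mem Ot.
  rewrite /= ger0_norm; last exact/f0/sub.
  over.
by apply: ge0_subset_integral => //; exact/measurable_EFinP.
Qed.

(** [wsum_bounded] and [wsum_rate] in terms of the basis [phi] and the density
    [q], for the representative [g] of [ell].  The coefficient of order [0], which
    is absent from the model, vanishes because [ell] is centred. *)
Lemma sobolev_phi_approx n (i : 'I_n.+1) r (ell : R -> R) : (n.+1 < r)%N ->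
  measurable_fun I01 ell -> (exists M : R, forall t, 0 <= t <= 1 -> `|ell t| <= M) ->
  \int[mu]_(t in I01) (ell t * q n.+1 i.+1 t) = 0 ->
  sobolev2 (q n.+1 i.+1) r ell ->
  exists (C : R) (c : nat -> R),
    (forall m t, 0 <= t <= 1 -> `|\sum_(k < m) c k * phi n.+1 i.+1 k.+1 t| <= C) /\
    (forall m, (0 < m)%N ->
      \int[mu]_(t in I01) ((ell t - \sum_(k < m) c k * phi n.+1 i.+1 k.+1 t) ^+ 2 * q n.+1 i.+1 t)
      <= C / m%:R ^+ (2 * r)).
Proof.
case: r => // s nr mell [M Mell] ell0 [_ [g [ellg dg acg [mG GL]]]].
rewrite [s.+1.-1]/= in dg acg.
pose a := (n - i)%N; pose b := (i : nat); have ab : (a + b)%N = n.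
  by rewrite /a /b subnK// -ltnS.
pose f : R := a`!%:R * b`!%:R.
have f0 : 0 < f by rewrite mulr_gt0 ?ltr0n ?fact_gt0.
pose K := Num.sqrt f; have K0 : 0 < K by rewrite sqrtr_gt0.
have qE' t : 0 <= t <= 1 -> q n.+1 i.+1 t = f^-1 * (jw a b).[t] by move=> t01; rewrite q_jw.
have phE k t : phi n.+1 i.+1 k t = K * (@jpoly R a b k).[t] by rewrite phiE.
have O2I t : O01 t -> 0 <= t <= 1 by rewrite O01P => /andP[t0 t1]; rewrite !ltW.
have GL2 : wL2 a b (derive1n s.+1 g).
  split; first by apply: measurable_funS mG => //; exact: subset_itvW.
  have : oint (fun t => derive1n s.+1 g t ^+ 2 * q n.+1 i.+1 t).
    apply: oint_I01_lty => //.
      by apply: measurable_funM; [exact: measurable_funX|case: (@bmf_q R n i)].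
    move=> t; rewrite /= in_itv /= => t01; apply: mulr_ge0; first exact: sqr_ge0.
    by rewrite qE'// mulr_ge0 ?invr_ge0 ?(ltW f0)// jw_horner mulr_ge0// exprn_ge0; lra.
  move=> /(ointZ f); apply: oint_le.
    apply: measurable_funM; last exact: (proj1 (bmf_poly _)).
    by apply: measurable_funX; apply: measurable_funS mG => //; exact: subset_itvW.
  move=> t Ot; rewrite qE' ?O2I// ger0_norm; last by apply: mulr_ge0; [exact: sqr_ge0|exact: jw_ge0].
  move: (_ ^+ 2 : R) ((jw a b).[t] : R) => x y; rewrite (_ : f * _ = x * y)//.
  by field; rewrite gt_eqF.
have abs : (a + b < s)%N by rewrite ab.
have dg' k t : (k < s)%N -> 0 < t < 1 -> derivable (derive1n k g) t 1 by move=> ks; exact: dg.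
have [C1 H1] := wsum_bounded dg' acg GL2 abs.
have [C2 H2] := wsum_rate dg' acg GL2 abs.
have bg : bmf O01 g := sobolev_bmf dg' acg (leq0n s).
have bell : bmf O01 ell.
  by apply: bmf_O01; split => //; exists M => t; rewrite /= in_itv /=; exact: Mell.
have ellg' : {ae mu, forall t, 0 < t < 1 -> ell t = g t}.
  have aef := ae_filter_ringOfSetsType mu.
  by apply: filterS ellg => t H /andP[t0 t1]; apply: H; rewrite !ltW.
have c0 : wcoef a b g 0 = 0.
  have sJ := @size_jpoly R a b 0.
  have JE : @jpoly R a b 0 = ((@jpoly R a b 0)`_0)%:P by apply: size1_polyC; rewrite sJ.
  have wE : wint (fun t => ell t * (jw a b * @jpoly R a b 0).[t]) = 0.
    rewrite JE (@eq_wint _ _ (fun t => ((@jpoly R a b 0)`_0 * f) * (ell t * q n.+1 i.+1 t))).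
      rewrite wintZ; last first.
        apply: oint_bmf; apply: bmfM => //; apply: bmf_O01; exact: (@bmf_q R n i).
      rewrite /wint -integral_O01 ?ell0 ?mulr0//.
      by apply: measurable_funM => //; case: (@bmf_q R n i).
    move=> t Ot; rewrite qE' ?O2I// hornerM hornerC.
    by field; rewrite gt_eqF.
  rewrite /wcoef /wdot -wE; apply: wint_ae.
  - by apply: measurable_funM; [case: bg|exact: (proj1 (bmf_poly _))].
  - by apply: measurable_funM; [case: bell|exact: (proj1 (bmf_poly _))].
  by have aef := ae_filter_ringOfSetsType mu; apply: filterS ellg' => t H t01; rewrite H.
pose c k := wcoef a b g k.+1 / K.
have sumE m t : \sum_(k < m) c k * phi n.+1 i.+1 k.+1 t = (wsum a b g m.+1).[t].
  rewrite /wsum big_ord_recl c0 scale0r add0r horner_sum; apply: eq_bigr => k _.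
  by rewrite hornerZ phE /c mulrA mulfVK// gt_eqF.
exists (Num.max C1 (C2 / f)), c; split => [m t t01|m m0].
  by rewrite sumE le_max H1.
have -> : \int[mu]_(t in I01) ((ell t - \sum_(k < m) c k * phi n.+1 i.+1 k.+1 t) ^+ 2 * q n.+1 i.+1 t)
   = f^-1 * werr a b g (wsum a b g m.+1).
  have bsq h : bmf O01 h -> bmf O01 (fun t => (h t - (wsum a b g m.+1).[t]) ^+ 2 * (jw a b).[t]).
    move=> bh; apply: bmfM; last exact: bmf_poly.
    by apply: bmfX; apply: bmfB => //; exact: bmf_poly.
  transitivity (\int[mu]_(t in I01) (f^-1 * ((ell t - (wsum a b g m.+1).[t]) ^+ 2 * (jw a b).[t]))).
    apply: eq_Rintegral => t /set_mem; rewrite /= in_itv /= => t01.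
    by rewrite sumE qE'// mulrCA.
  rewrite integral_O01; last first.
    have bellI : bmf I01 ell by split => //; exists M => t; rewrite /= in_itv /=; exact: Mell.
    apply: (proj1 (_ : bmf I01 _)); apply: bmfM; first exact: bmf_cst.
    apply: bmfM; last exact: bmf_horner.
    by apply: bmfX; apply: bmfB => //; exact: bmf_horner.
  rewrite -/(wint _) wintZ; last exact/oint_bmf/bsq.
  congr (_ * _); apply: wint_ae; [by case: (bsq _ bell)|by case: (bsq _ bg)|].
  by have aef := ae_filter_ringOfSetsType mu; apply: filterS ellg' => t H t01; rewrite H.
apply: (@le_trans _ _ (C2 / f / m%:R ^+ (2 * s.+1))).
  by rewrite mulrC mulrAC ler_wpM2r ?invr_ge0 ?(ltW f0)// H2.
by rewrite ler_wpM2r ?invr_ge0 ?exprn_ge0 ?ler0n// le_max lexx orbT.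
Qed.

End sobolev_phi.

(** * Empirical means of independent observations *)

Section independent_pairs.
Context {R : realType} {d d' : measure_display}.
Context {Omega : measurableType d} {T : measurableType d'} (P : probability Omega R).
Implicit Types (X Y : {RV P >-> T}) (u v : T -> R).

Lemma bmf_rv d'' (T' : measurableType d'') (u : T' -> R) (X : {RV P >-> T'}) :
  bmf [set: T'] u -> bmf [set: Omega] (u \o X).
Proof.
move=> [mu_ [M uM]]; split; first by apply: measurableT_comp.
by exists M => o _; exact: uM.
Qed.

(** The law of the pair is the product of the laws; then Fubini's theorem. *)
Lemma expect_indep X Y u v :
  (forall A B, measurable A -> measurable B ->
     P (X @^-1` A `&` Y @^-1` B) = (P (X @^-1` A) * P (Y @^-1` B))%E) ->
  bmf [set: T] u -> bmf [set: T] v ->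
  \int[P]_o (u (X o) * v (Y o)) = (\int[P]_o u (X o)) * (\int[P]_o v (Y o)).
Proof.
move=> ind bu bv.
pose XY (o : Omega) : T * T := (X o, Y o).
have mXY : measurable_fun [set: Omega] XY by apply: measurable_fun_pair.
pose XYr : {RV P >-> (T * T)%type} := mfun_Sub (mem_set mXY).
pose m1 : probability T R := [the probability _ _ of distribution P X].
pose m2 : probability T R := [the probability _ _ of distribution P Y].
have muE A : measurable A -> distribution P XYr A = (m1 \x m2)%E A.
  move=> mA; apply/esym; apply: product_measure_unique mA => B C mB mC.
  by rewrite /m1 /m2 /distribution /pushforward /= -ind.
pose w (z : T * T) := u z.1 * v z.2.
have bw : bmf [set: T * T] w.
  split.
    apply: measurable_funM; apply: measurableT_comp => //; first by case: bu.
    by case: bv.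
  have [M uM] := proj2 bu; have [N vN] := proj2 bv; exists (M * N) => z _.
  by rewrite /w normrM ler_pM// ?uM// vN.
have t1 : (m1 [set: T] < +oo)%E by rewrite probability_setT ltry.
have t2 : (m2 [set: T] < +oo)%E by rewrite probability_setT ltry.
have t12 : ((m1 \x m2)%E [set: T * T] < +oo)%E.
  by rewrite -muE// probability_setT ltry.
have iw : (m1 \x m2)%E.-integrable [set: T * T] (EFin \o w).
  exact: (@bmf_integrable _ _ R (m1 \x m2)%E setT measurableT t12).
have pt : (P [set: Omega] < +oo)%E by rewrite probability_setT ltry.
have bXY : bmf [set: Omega] (w \o XYr) by exact: bmf_rv.
apply: EFin_inj; rewrite -(@bintE _ _ R P setT measurableT pt _ bXY).
rewrite -(@integral_distribution _ _ _ _ _ P XYr (EFin \o w)); last 2 first.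
- by apply/measurable_EFinP; case: bw.
- exact: (@bmf_integrable _ _ R P setT measurableT pt).
rewrite (eq_measure_integral (m1 \x m2)%E); last by move=> A mA _; exact: muE.
rewrite -integral12_prod_meas1//.
have uE (Z : {RV P >-> T}) (g : T -> R) : bmf [set: T] g ->
    (\int[distribution P Z]_x (g x)%:E = (\int[P]_o g (Z o))%:E)%E.
  move=> bg; rewrite integral_distribution.
  - by rewrite -(@bintE _ _ R P setT measurableT pt _ (bmf_rv Z bg)).
  - by apply/measurable_EFinP; case: bg.
  - exact: (@bmf_integrable _ _ R P setT measurableT pt _ (bmf_rv Z bg)).
have bc (c : R) : bmf [set: T] (fun y => c * v y) by apply: bmfM => //; exact: bmf_cst.
rewrite (@eq_integral _ _ _ m1 setT (fun x => ((\int[P]_o v (Y o)) * u x)%:E)); last first.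
  move=> x _; rewrite /fubini_F /w /= (uE Y (fun y => u x * v y) (bc (u x))).
  by rewrite (@bintZ _ _ R P setT measurableT pt (u x) _ (bmf_rv Y bv)) mulrC.
rewrite (uE X (fun x => (\int[P]_o v (Y o)) * u x)); last by apply: bmfM => //; exact: bmf_cst.
by rewrite (@bintZ _ _ R P setT measurableT pt _ _ (bmf_rv X bu)) mulrC.
Qed.

End independent_pairs.

Section density_expectation.
Context {R : realType} {d d' : measure_display}.
Context {Omega : measurableType d} {T : measurableType d'} (P : probability Omega R).
Variable mu : {sigma_finite_measure set T -> \bar R}.

Lemma expect_density (X : {RV P >-> T}) (f0 u : T -> R) : measurable_fun setT f0 ->
  (forall x, 0 <= f0 x) ->
  (forall B, measurable B -> P (X @^-1` B) = (\int[mu]_(x in B) (f0 x)%:E)%E) ->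
  bmf [set: T] u ->
  \int[P]_o u (X o) = \int[mu]_x (u x * f0 x).
Proof.
move=> mf0 f00 XE bu.
pose nu : probability T R := [the probability _ _ of distribution P X].
have nuE B : measurable B -> nu B = (\int[mu]_(x in B) (f0 x)%:E)%E by move=> mB; rewrite -XE.
have dom : nu `<< mu.
  apply/null_content_dominatesP => A mA A0; rewrite nuE//.
  apply: null_set_integral => //; exact/measurable_EFinP/measurable_funTS.
have pt : (P [set: Omega] < +oo)%E by rewrite probability_setT ltry.
have t1 : (nu [set: T] < +oo)%E by rewrite probability_setT ltry.
have inu : nu.-integrable [set: T] (EFin \o u).
  exact: (@bmf_integrable _ _ R nu setT measurableT t1).
have H := Radon_Nikodym_change_of_variables dom measurableT inu.
have fin : (\int[mu]_x (f0 x)%:E = 1)%E.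
  by rewrite -nuE// probability_setT.
have if0 : mu.-integrable setT (EFin \o f0).
  apply/integrableP; split; first exact/measurable_EFinP.
  under eq_integral do rewrite /= ger0_norm//.
  by rewrite fin ltry.
have aeq : ae_eq mu setT (EFin \o f0) (Radon_Nikodym (charge_of_finite_measure nu) mu).
  apply: integral_ae_eq => //.
  move=> A _ mA; by rewrite -Radon_Nikodym_integral// -nuE.
rewrite /Rintegral; congr fine; rewrite -[LHS](@integral_distribution _ _ _ _ _ P X (EFin \o u)).
- rewrite -H; apply: ae_eq_integral => //.
  + apply: emeasurable_funM; first by apply/measurable_EFinP; case: bu.
    by apply: measurable_int; exact: Radon_Nikodym_integrable.
  + by apply/measurable_EFinP; apply: measurable_funM => //; case: bu.
  have aef := ae_filter_ringOfSetsType mu.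
  by apply: filterS aeq => x /= Hx _; rewrite -Hx.
- by apply/measurable_EFinP; case: bu.
- exact: (@bmf_integrable _ _ R P setT measurableT pt _ (bmf_rv X bu)).
Qed.

End density_expectation.

Section empirical_mean.
Context {R : realType} {d d' : measure_display}.
Context {Omega : measurableType d} {T : measurableType d'} (P : probability Omega R).
Variable mu : {sigma_finite_measure set T -> \bar R}.
Variables (X : nat -> {RV P >-> T}) (f0 : T -> R).
Hypothesis mf0 : measurable_fun setT f0.
Hypothesis f00 : forall x, 0 <= f0 x.
Hypothesis XE : forall j B, measurable B -> P (X j @^-1` B) = (\int[mu]_(x in B) (f0 x)%:E)%E.
Hypothesis Xind : forall i j, i != j -> forall A B, measurable A -> measurable B ->
  P (X i @^-1` A `&` X j @^-1` B) = (P (X i @^-1` A) * P (X j @^-1` B))%E.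

Let pt : (P [set: Omega] < +oo)%E.
Proof. by rewrite probability_setT ltry. Qed.

Let intD := @bintD _ _ R P setT measurableT pt.
Let intZ := @bintZ _ _ R P setT measurableT pt.
Let int_sum := @bint_sum _ _ R P setT measurableT pt.

Let int_cst (c : R) : \int[P]_o c = c.
Proof. by rewrite Rintegral_cst// [X in fine X](_ : _ = 1%E) ?mulr1//; exact: probability_setT. Qed.

(** Centred functions of distinct observations are orthogonal. *)
Lemma empirical_mean_variance (u : T -> R) n : bmf [set: T] u -> (0 < n)%N ->
  \int[P]_o (n%:R^-1 * (\sum_(l < n) u (X l o)) - \int[mu]_x (u x * f0 x)) ^+ 2 <=
  n%:R^-1 * \int[mu]_x (u x ^+ 2 * f0 x).
Proof.
move=> bu n0; set m := \int[mu]_x (u x * f0 x).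
pose v x := u x - m.
have bv : bmf [set: T] v by apply: bmfB => //; exact: bmf_cst.
have Em l : \int[P]_o u (X l o) = m by exact: (expect_density mf0 f00 (XE l)).
have Ev l : \int[P]_o v (X l o) = 0.
  rewrite (@bintB _ _ R P setT measurableT pt _ _ (bmf_rv (X l) bu) (bmf_cst _ m)).
  by rewrite Em int_cst subrr.
have Ev2 l : \int[P]_o (v (X l o) ^+ 2) <= \int[mu]_x (u x ^+ 2 * f0 x).
  have bu2 : bmf [set: T] (fun x => u x ^+ 2) by exact: bmfX.
  rewrite -(expect_density mf0 f00 (XE l) bu2).
  have -> : \int[P]_o (v (X l o) ^+ 2) = \int[P]_o (u (X l o) ^+ 2 + ((- (2 * m)) * u (X l o) + m ^+ 2)).
    by apply: eq_Rintegral => o _; rewrite /v; ring.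
  have b1 : bmf [set: Omega] (fun o => u (X l o) ^+ 2) by exact: (bmf_rv (X l) bu2).
  have b2 : bmf [set: Omega] (fun o => (- (2 * m)) * u (X l o)).
    by apply: bmfM; [exact: bmf_cst|exact: (bmf_rv (X l) bu)].
  rewrite (intD b1 (bmfD b2 (bmf_cst _ (m ^+ 2)))) (intD b2 (bmf_cst _ (m ^+ 2))).
  rewrite (intZ (- (2 * m)) (bmf_rv (X l) bu)) Em int_cst gerDl.
  by have := sqr_ge0 m; rewrite expr2; lra.
have n0' : (n%:R : R) != 0 by rewrite pnatr_eq0 -lt0n.
have bvv k l : bmf [set: Omega] (fun o => v (X k o) * v (X l o)).
  by apply: bmfM; [exact: (bmf_rv (X k) bv)|exact: (bmf_rv (X l) bv)].
have -> : \int[P]_o (n%:R^-1 * (\sum_(l < n) u (X l o)) - m) ^+ 2 =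
    \int[P]_o (n%:R^-1 ^+ 2 * \sum_(k < n) \sum_(l < n) v (X k o) * v (X l o)).
  apply: eq_Rintegral => o _.
  have -> : n%:R^-1 * (\sum_(l < n) u (X l o)) - m = n%:R^-1 * \sum_(l < n) v (X l o).
    rewrite /v sumrB sumr_const card_ord mulrBr -(mulr_natl m n) mulKf//.
  rewrite exprMn; congr (_ * _); rewrite expr2 mulr_suml; apply: eq_bigr => k _.
  by rewrite mulr_sumr.
rewrite intZ; last by apply: bmf_sum => k; apply: bmf_sum => l; exact: bvv.
rewrite (@int_sum _ (index_enum _) (fun (k : 'I_n) o => \sum_(l < n) v (X k o) * v (X l o))); last first.
  by move=> k; apply: bmf_sum => l; exact: bvv.
rewrite expr2 -mulrA ler_wpM2l ?invr_ge0 ?ler0n//.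
rewrite mulrC ler_pdivrMr ?ltr0n// mulrC mulr_natl -[in leRHS](card_ord n) -sumr_const.
apply: ler_sum => k _.
rewrite (@int_sum _ (index_enum _) (fun (l : 'I_n) o => v (X k o) * v (X l o))); last by move=> l; exact: bvv.
rewrite (bigD1 k)//= big1 ?addr0; first by under eq_Rintegral do rewrite -expr2; exact: Ev2.
move=> l lk; rewrite (expect_indep _ bv bv) ?Ev ?mul0r//.
by apply: Xind; apply: contra lk => /eqP/val_inj ->.
Qed.

(** Markov's inequality for the sum over the coordinates of [phi] *)
Lemma empirical_mean_deviation N (phi : T -> 'rV[R]_N) (c : R) n :
  (forall j, bmf [set: T] (fun x => phi x 0 j)) -> (0 < n)%N -> 0 < c ->
  (P [set o | (c <= \sum_j (n%:R^-1 * (\sum_(l < n) phi (X l o) 0%R j) -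
                          \int[mu]_x (phi x 0%R j * f0 x)) ^+ 2)%R]
   <= ((\sum_j \int[mu]_x (phi x 0%R j ^+ 2 * f0 x))%R / n%:R / c)%:E)%E.
Proof.
move=> bphi n0 c0.
pose Z j o := (n%:R^-1 * (\sum_(l < n) phi (X l o) 0 j) - \int[mu]_x (phi x 0 j * f0 x)) ^+ 2.
have bZ j : bmf [set: Omega] (Z j).
  apply: bmfX; apply: bmfB; last exact: bmf_cst.
  apply: bmfM; first exact: bmf_cst.
  by apply: bmf_sum => l; exact: (bmf_rv (X l) (bphi j)).
pose S o := \sum_j Z j o.
have bS : bmf [set: Omega] S by apply: bmf_sum.
have S0 o : 0 <= S o by apply: sumr_ge0 => j _; exact: sqr_ge0.
have mS : measurable_fun setT (EFin \o S) by apply/measurable_EFinP; case: bS.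
have := @le_integral_abse _ _ R P setT measurableT _ c mS c0.
rewrite setTI.
have -> : [set x | (c%:E <= `|(EFin \o S) x|)%E] = [set o | c <= S o].
  by apply/seteqP; split => o /=; rewrite lee_fin ger0_norm.
have -> : (\int[P]_(x in setT) `|(EFin \o S) x| = (\int[P]_o S o)%:E)%E.
  rewrite -(@bintE _ _ R P setT measurableT pt _ bS); apply: eq_integral => o _.
  by rewrite /= ger0_norm.
move=> h; rewrite EFinM lee_pdivlMr// muleC; apply: (le_trans h); rewrite lee_fin.
rewrite (@int_sum _ (index_enum _) Z bZ) mulr_suml; apply: ler_sum => j _.
by rewrite mulrC; exact: empirical_mean_variance.
Qed.

End empirical_mean.

(** * The exponential model on the simplex *)

Section block_vectors.
Context {R : realType} {p : nat}.
Variable m : 'I_p -> nat.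

Lemma sum_blocks (F : forall i, 'I_(m i) -> R) :
  \sum_(j < \sum_i m i) F (tagnat.sig1 j) (tagnat.sig2 j) = \sum_i \sum_k F i k.
Proof.
rewrite sig_big_dep /= (reindex (@tagnat.sig p m))/=; first exact: eq_bigr.
by exists (@tagnat.rank p m) => j _; [exact: tagnat.sigK|exact: tagnat.rankK].
Qed.

Lemma sum_submxrow (h : 'rV[R]_(\sum_i m i)) (F : forall i, 'I_(m i) -> R) :
  \sum_j h 0 j * F (tagnat.sig1 j) (tagnat.sig2 j) = \sum_i \sum_k submxrow h i 0 k * F i k.
Proof.
rewrite -(sum_blocks (fun i k => submxrow h i 0 k * F i k)).
by apply: eq_bigr => j _; rewrite mxE tagnat.sig2K.
Qed.

End block_vectors.

Section simplex_model.
Context {R : realType} {n : nat}.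
Variable m : 'I_n.+1 -> nat.
Local Notation mu := (@lebesgue_measure R).
Local Notation T := (n.+1.-tuple R).
Local Notation lam := (@lebesgue_tuple R n.+1).
Local Notation Delta := (@simplex R n.+1).
Local Notation I01 := (`[0%R, 1%R]%classic : set R).
Local Notation N := (\sum_i m i)%N.
Local Notation phv := (@phi_vec R n.+1 m).

Lemma mDelta : measurable Delta. Proof. exact: measurable_simplex. Qed.

Lemma lamDelta : lam Delta = (n.+1`!%:R^-1)%:E.
Proof.
have -> : Delta = ordered_in 0 1 1 n.+1.
  apply/seteqP; split=> x [H1 H2]; split=> // k; first by rewrite ltn_ord; exact: H1.
  by have := H1 k; rewrite ltn_ord.
rewrite volume_ordered_in//; congr EFin.
by rewrite subnn subr0 expr1n !expr0 fact0 divr1 mulr1 mul1r.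
Qed.

Lemma lamDelta_lty : (lam Delta < +oo)%E. Proof. by rewrite lamDelta ltry. Qed.

Lemma lamDelta_gt0 : (0 < lam Delta)%E.
Proof. by rewrite lamDelta lte_fin invr_gt0 ltr0n fact_gt0. Qed.

Lemma Delta_coord x (i : 'I_n.+1) : Delta x -> 0 <= tnth x i <= 1.
Proof. by case=> H _; exact: H. Qed.

Lemma bmf_phi (i : 'I_n.+1) k : bmf I01 (@phi R n.+1 i.+1 k).
Proof.
apply: (@eq_bmf _ _ _ _ (fun t => Num.sqrt ((n - i)`!%:R * i`!%:R) * (@jpoly R (n - i) i k).[t])).
  by move=> t _; rewrite phiE.
by apply: bmfM; [exact: bmf_cst|exact: bmf_horner].
Qed.

Lemma measurable_coord (i : 'I_n.+1) (g : R -> R) : measurable_fun I01 g ->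
  measurable_fun [set: T] (fun x => g (tnth x i) * \1_I01 (tnth x i)).
Proof.
move=> mg; have mg' : measurable_fun [set: R] (fun t => g t * \1_I01 t).
  rewrite (_ : (fun t => g t * \1_I01 t) = g \_ I01).
    by apply/(measurable_restrictT _ mI01).
  apply/funext => t; rewrite patchE indicE; case: ifP; rewrite ?mulr1// ?mulr0//.
by apply: (measurableT_comp mg'); exact: measurable_tnth.
Qed.

Lemma bmf_coord_fun (i : 'I_n.+1) (g : R -> R) : bmf I01 g -> bmf [set: T] (coord_fun i g).
Proof.
move=> [mg [M gM]]; split.
  have -> : coord_fun i g = fun x => (g (tnth x i) * \1_I01 (tnth x i)) * \1_Delta x.
    apply/funext => x; rewrite /coord_fun; have [Dx|nDx] := pselect (Delta x); last first.
      by rewrite [\1_Delta x]indicE memNset// !mulr0.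
    by rewrite [\1_I01 _]indicE mem_set ?mulr1//= in_itv /= Delta_coord.
  apply: measurable_funM; first exact: measurable_coord.
  by apply: measurable_indic; exact: mDelta.
exists `|M| => x _; rewrite /coord_fun; have [Dx|nDx] := pselect (Delta x); last first.
  by rewrite indicE memNset// mulr0 normr0.
rewrite indicE mem_set// mulr1; apply: (le_trans (gM _ _)); last exact: ler_norm.
by rewrite /= in_itv /= Delta_coord.
Qed.

Lemma phi_vecE x j : phv x 0 j =
  coord_fun (tagnat.sig1 j) (@phi R n.+1 (tagnat.sig1 j).+1 (tagnat.sig2 j).+1) x.
Proof. by rewrite !mxE. Qed.

Lemma bmf_phi_vec j : bmf [set: T] (fun x => phv x 0 j).
Proof.
apply: (@eq_bmf _ _ _ _ (coord_fun (tagnat.sig1 j) (@phi R n.+1 (tagnat.sig1 j).+1 (tagnat.sig2 j).+1))).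
  by move=> x _; rewrite phi_vecE.
by apply: bmf_coord_fun; exact: bmf_phi.
Qed.

Lemma bmf_Delta (f : T -> R) : bmf [set: T] f -> bmf Delta f.
Proof.
by move=> [mf [M fM]]; split; [exact: measurable_funTS|exists M => x _; exact: fM].
Qed.

Lemma lin_phi_vec (th : 'rV[R]_N) x : lin phv th x = log_model th x.
Proof.
rewrite /lin /log_model -(sum_submxrow th (fun i k => coord_fun i (@phi R n.+1 i.+1 k.+1) x)).
by apply: eq_bigr => j _; rewrite phi_vecE.
Qed.

Lemma log_mass_lnmass (u : T -> R) : log_mass u = lnmass lam Delta u.
Proof. by rewrite lnmassE. Qed.

Lemma exp_density_tilt (u : T -> R) x : Delta x -> exp_density u x = tilt lam Delta u x.
Proof. by move=> Dx; rewrite /exp_density indicE mem_set// mulr1 log_mass_lnmass tilt_expR. Qed.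

Lemma A_map_mean_map (th : 'rV[R]_N) : A_map th = mean_map lam Delta phv th.
Proof.
apply/rowP => j; rewrite !mxE; apply: eq_Rintegral => x /set_mem Dx; congr (_ * _).
rewrite /f_model exp_density_tilt//; congr (tilt _ _ _ _).
by apply/funext => y; rewrite lin_phi_vec.
Qed.

Lemma KL_rKL (u v : T -> R) : bmf Delta u -> bmf Delta v ->
  KL (exp_density u) (exp_density v) = (rKL lam Delta u v)%:E.
Proof.
move=> bu bv; rewrite rKL_def /KL.
have bt := bmf_tilt lam bu.
rewrite -(@bintE _ _ R lam Delta mDelta lamDelta_lty); last first.
  by apply: bmfM => //; apply: bmfB; [exact: bmfB|exact: bmf_cst].
apply: eq_integral => x /set_mem Dx; rewrite !exp_density_tilt//.
have t0 := tilt_gt0 lam Delta v x; have u0 := tilt_gt0 lam Delta u x.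
rewrite inver gt_eqF// -EFinM lne_EFin ?divr_gt0// -EFinM; congr EFin; congr (_ * _).
rewrite !tilt_expR -expRN -expRD expRK; ring.
Qed.

End simplex_model.

Section gram_bounds.
Context {R : realType} {n : nat}.
Local Notation mu := (@lebesgue_measure R).
Local Notation T := (n.+1.-tuple R).
Local Notation lam := (@lebesgue_tuple R n.+1).
Local Notation Delta := (@simplex R n.+1).
Local Notation I01 := (`[0%R, 1%R]%classic : set R).
Local Notation jpoly := (@jpoly R).
Local Notation V := (fine (lam Delta)).

Let intD := @bintD _ _ R lam Delta mDelta lamDelta_lty.
Let intZ := @bintZ _ _ R lam Delta mDelta lamDelta_lty.
Let int_le := @bint_le _ _ R lam Delta mDelta lamDelta_lty.
Let int_sum := @bint_sum _ _ R lam Delta mDelta lamDelta_lty.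

Lemma V_gt0 : 0 < V.
Proof. by rewrite lamDelta /= invr_gt0 ltr0n fact_gt0. Qed.

Lemma bmf_tnth (i : 'I_n.+1) (g : R -> R) : bmf I01 g -> bmf Delta (fun x => g (tnth x i)).
Proof.
move=> bg; apply: eq_bmf (bmf_Delta (bmf_coord_fun i bg)) => x Dx.
by rewrite /coord_fun indicE mem_set// mulr1.
Qed.

Lemma int_simplex_coord (i : 'I_n.+1) (g : R -> R) : bmf I01 g -> (forall t, I01 t -> 0 <= g t) ->
  \int[lam]_(x in Delta) g (tnth x i) = \int[mu]_(t in I01) (g t * q n.+1 i.+1 t).
Proof.
move=> bg g0; apply: EFin_inj.
rewrite -(@bintE _ _ R lam Delta mDelta lamDelta_lty _ (bmf_tnth i bg)).
rewrite -(@bintE _ _ R mu I01 mI01 muI01_lty); last by apply: bmfM => //; exact: bmf_q.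
pose h t := g t * \1_I01 t.
have mh : measurable_fun [set: R] h.
  rewrite (_ : h = g \_ I01); first by apply/(measurable_restrictT _ mI01); case: bg.
  by apply/funext => t; rewrite /h patchE indicE; case: ifP; rewrite ?mulr1// ?mulr0.
have h0 t : 0 <= h t.
  rewrite /h indicE; have [It|nIt] := pselect (I01 t); first by rewrite mem_set// mulr1 g0.
  by rewrite memNset// mulr0.
have hE t : I01 t -> h t = g t by move=> It; rewrite /h indicE mem_set// mulr1.
transitivity (\int[lam]_(x in Delta) (h (tnth x i))%:E)%E.
  apply: eq_integral => x /set_mem Dx; rewrite hE//= in_itv /=; exact: Delta_coord.
rewrite ge0_simplex_marginal//.
by apply: eq_integral => t /set_mem It; rewrite hE.
Qed.

Lemma int_q (i : 'I_n.+1) : \int[mu]_(t in I01) q n.+1 i.+1 t = V.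
Proof.
transitivity (\int[mu]_(t in I01) (1 * q n.+1 i.+1 t)).
  by apply: eq_Rintegral => t _; rewrite mul1r.
rewrite -(int_simplex_coord i (bmf_cst _ 1))// Rintegral_cst ?mul1r//.
exact: mDelta.
Qed.

Section model_functions.
Variable m : 'I_n.+1 -> nat.
Local Notation N := (\sum_i m i)%N.
Local Notation phv := (@phi_vec R n.+1 m).
Implicit Types (h : 'rV[R]_N).

(** The function of the coordinate [i] in [log_model h] is proportional to the
    polynomial [comp_poly h i], to which the results on the unit interval apply. *)
Definition comp_fun h (i : 'I_n.+1) (t : R) : R :=
  \sum_(k < m i) submxrow h i 0 k * phi n.+1 i.+1 k.+1 t.

Definition comp_poly h (i : 'I_n.+1) : {poly R} :=
  \sum_(k < m i) submxrow h i 0 k *: jpoly (n - i) i k.+1.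

Definition sqr_block h (i : 'I_n.+1) : R := \sum_k submxrow h i 0 k ^+ 2.

Let f (i : 'I_n.+1) : R := (n - i)`!%:R * i`!%:R.
Let f0 i : 0 < f i. Proof. by rewrite mulr_gt0 ?ltr0n ?fact_gt0. Qed.

Lemma comp_funE h i t : comp_fun h i t = Num.sqrt (f i) * (comp_poly h i).[t].
Proof.
rewrite /comp_fun /comp_poly horner_sum mulr_sumr; apply: eq_bigr => k _.
by rewrite phiE hornerZ mulrCA.
Qed.

Lemma bmf_comp_fun h i : bmf I01 (comp_fun h i).
Proof. by apply: bmf_sum => k; apply: bmfM; [exact: bmf_cst|exact: bmf_phi]. Qed.

Lemma lin_comp_fun h x : Delta x -> lin phv h x = \sum_i comp_fun h i (tnth x i).
Proof.
move=> Dx; rewrite lin_phi_vec /log_model; apply: eq_bigr => i _; apply: eq_bigr => k _.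
by rewrite /coord_fun indicE mem_set// mulr1.
Qed.

Lemma dot_blocks h : dot h h = \sum_i sqr_block h i.
Proof.
rewrite /dot /sqr_block -(sum_blocks (fun i k => submxrow h i 0 k ^+ 2)).
by apply: eq_bigr => j _; rewrite mxE tagnat.sig2K expr2.
Qed.

Lemma size_comp_poly h i : (size (comp_poly h i) <= (m i).+1)%N.
Proof.
apply: (leq_trans (size_sum _ _ _)); apply/bigmax_leqP => k _.
by apply: (leq_trans (size_scale_leq _ _)); rewrite size_jpoly ltnS.
Qed.

Lemma pint_comp_poly_sqr h (i : 'I_n.+1) : pint (@jw R (n - i) i * comp_poly h i * comp_poly h i) = sqr_block h i.
Proof.
pose c l : R := if l is k.+1 then oapp (fun k => submxrow h i 0 k) 0 (insub k) else 0.
have ck (k : 'I_(m i)) : c k.+1 = submxrow h i 0 k by rewrite /c /= valK.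
have -> : comp_poly h i = \sum_(l < (m i).+1) c l *: jpoly (n - i) i l.
  rewrite big_ord_recl scale0r add0r; apply: eq_bigr => k _.
  by rewrite lift0 -ck.
rewrite pint_sum_jpoly big_ord_recl mul0r add0r; apply: eq_bigr => k _.
by rewrite lift0 ck expr2.
Qed.

(** Only polynomials of positive degree occur, and they are orthogonal to the
    constants. *)
Lemma pint_comp_poly h (i : 'I_n.+1) : pint (@jw R (n - i) i * comp_poly h i) = 0.
Proof.
rewrite /comp_poly mulr_sumr pint_sum big1// => k _.
rewrite -scalerAr pintZ -[_ * jpoly _ _ _]mulr1 pint_jpoly_small ?mulr0//.
by rewrite size_poly1.
Qed.

Lemma int_comp_fun_sqr h i :
  \int[mu]_(t in I01) (comp_fun h i t ^+ 2 * q n.+1 i.+1 t) = sqr_block h i.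
Proof.
rewrite -pint_comp_poly_sqr pintE; apply: eq_Rintegral => t /set_mem It.
rewrite q_jw; last by move: It; rewrite /= in_itv.
rewrite comp_funE exprMn sqr_sqrtr ?(ltW (f0 i))// -/(f i) !hornerM.
by field; rewrite gt_eqF.
Qed.

Lemma int_comp_fun h i : \int[mu]_(t in I01) (comp_fun h i t * q n.+1 i.+1 t) = 0.
Proof.
have E (t : R) : 0 <= t <= 1 -> comp_fun h i t * q n.+1 i.+1 t =
    (Num.sqrt (f i) / f i *: (@jw R (n - i) i * comp_poly h i)).[t].
  by move=> It; rewrite q_jw// comp_funE hornerZ (hornerM (@jw R (n - i) i)) -/(f i); ring.
transitivity (\int[mu]_(t in I01) (Num.sqrt (f i) / f i *: (@jw R (n - i) i * comp_poly h i)).[t]).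
  apply: eq_Rintegral => t /set_mem; rewrite /= in_itv /=; exact: E.
by rewrite -pintE pintZ pint_comp_poly mulr0.
Qed.

Lemma int_simplex_comp_sqr h i : \int[lam]_(x in Delta) comp_fun h i (tnth x i) ^+ 2 = sqr_block h i.
Proof.
rewrite -int_comp_fun_sqr -(@int_simplex_coord i (fun t => comp_fun h i t ^+ 2))//.
  by apply: bmfX; exact: bmf_comp_fun.
by move=> t _; exact: sqr_ge0.
Qed.

Lemma sqr_sum_le (F : 'I_n.+1 -> R) : (\sum_i F i) ^+ 2 <= n.+1%:R * \sum_i F i ^+ 2.
Proof.
have := cauchy_schwarz_sum (fun=> 1) F.
rewrite (eq_bigr F) => [|i _]; last by rewrite mul1r.
rewrite [X in _ <= X * _](eq_bigr (fun=> 1)); last by move=> i _; rewrite expr1n.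
by rewrite sumr_const card_ord.
Qed.

Lemma gram_upper h : \int[lam]_(x in Delta) lin phv h x ^+ 2 <= n.+1%:R * dot h h.
Proof.
have b2 i : bmf Delta (fun x => comp_fun h i (tnth x i) ^+ 2).
  by apply: bmfX; apply: bmf_tnth; exact: bmf_comp_fun.
apply: (@le_trans _ _ (\int[lam]_(x in Delta) (n.+1%:R * \sum_i comp_fun h i (tnth x i) ^+ 2))).
  apply: int_le.
  - by apply: bmfX; apply: bmf_lin => j; apply: bmf_Delta; exact: bmf_phi_vec.
  - by apply: bmfM; [exact: bmf_cst|exact: bmf_sum].
  by move=> x Dx; rewrite lin_comp_fun//; exact: sqr_sum_le.
rewrite intZ; last exact: bmf_sum.
rewrite (@int_sum _ _ (fun (i : 'I_n.+1) x => comp_fun h i (tnth x i) ^+ 2) b2) dot_blocks.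
by under eq_bigr do rewrite int_simplex_comp_sqr.
Qed.

(** [simplex_variance] for each coordinate: the norm of each component is
    controlled by the distance of the sum to the constants. *)
Lemma gram_lower h (c : R) : dot h h <= 2 * n.+1%:R / V * \int[lam]_(x in Delta) (lin phv h x - c) ^+ 2.
Proof.
have V0 := V_gt0.
pose g i t := comp_fun h i t * \1_I01 t.
have bg i := bmf_comp_fun h i.
have gE i t : I01 t -> g i t = comp_fun h i t by move=> It; rewrite /g indicE mem_set// mulr1.
have mg i : measurable_fun [set: R] (g i).
  rewrite (_ : g i = comp_fun h i \_ I01); first by apply/(measurable_restrictT _ mI01); case: (bg i).
  by apply/funext => t; rewrite /g patchE indicE; case: ifP; rewrite ?mulr1// ?mulr0.
pose S (x : T) := \sum_i g i (tnth x i) - c.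
have mS : measurable_fun [set: T] S.
  apply: measurable_funB => //; apply: measurable_sum => i.
  by apply: (measurableT_comp (mg i)); exact: measurable_tnth.
have blin : bmf Delta (lin phv h) by apply: bmf_lin => j; apply: bmf_Delta; exact: bmf_phi_vec.
have SE : \int[lam]_(x in Delta) S x ^+ 2 = \int[lam]_(x in Delta) (lin phv h x - c) ^+ 2.
  apply: eq_Rintegral => x /set_mem Dx; rewrite /S lin_comp_fun//; congr ((_ - _) ^+ 2).
  by apply: eq_bigr => i _; rewrite gE//= in_itv /= Delta_coord.
have bS : bmf Delta (fun x => S x ^+ 2).
  apply: (@eq_bmf _ _ _ _ (fun x => (lin phv h x - c) ^+ 2)); last first.
    by apply: bmfX; apply: bmfB => //; exact: bmf_cst.
  move=> x Dx; rewrite /S lin_comp_fun//; congr ((_ - _) ^+ 2).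
  by apply: eq_bigr => i _; rewrite gE//= in_itv /= Delta_coord.
have block i : V * sqr_block h i <= 2 * \int[lam]_(x in Delta) (lin phv h x - c) ^+ 2.
  have := @simplex_variance R n i (g i) S (mg i).
  rewrite int_q -SE -lee_fin EFinM => H; apply: (le_trans _ (le_trans (H _ mS _ _) _)).
  - rewrite -EFinM lee_fin ler_wpM2l ?(ltW V0)// -int_comp_fun_sqr.
    rewrite le_eqVlt; apply/orP; left; apply/eqP.
    by apply: eq_Rintegral => t /set_mem It; rewrite gE.
  - have [_ [M cM]] := bg i; exists `|M| => t; rewrite /g indicE.
    have [It|nIt] := pselect (I01 t); last by rewrite memNset// mulr0 normr0.
    by rewrite mem_set// mulr1 (le_trans (cM t It))// ler_norm.
  - move=> s t y; rewrite /S opprB addrA subrK -sumrB (bigD1 i)//= !tnth_ins big1 ?addr0// => j ji.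
    by case: (unliftP i j) ji => [k ->|->]; rewrite ?eqxx// => _; rewrite !tnth_ins_lift subrr.
  - by rewrite -[RHS](int_comp_fun h i); apply: eq_Rintegral => t /set_mem It; rewrite gE.
  by rewrite (@bintE _ _ R lam Delta mDelta lamDelta_lty _ bS).
rewrite [leRHS]mulrAC ler_pdivlMr// mulrC dot_blocks mulr_sumr.
apply: (le_trans (ler_sum _ (fun i _ => block i))).
by rewrite sumr_const card_ord -[leLHS]mulr_natl mulrCA mulrA.
Qed.

Definition point_const : R := n.+1%:R * (n`!%:R ^+ 2 *
  (2 ^+ n.+1 * (2 * n.+1%:R ^+ (2 * n).+1) * 2 ^+ (2 * n.+1))).

(** Nikolskii's inequality in each coordinate; the exponents of the weights [q]
    all have sum [n], whence the same power of [N] for all coordinates. *)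
Lemma lin_sqr_le h x : (forall i, 0 < m i)%N -> Delta x ->
  lin phv h x ^+ 2 <= point_const * N%:R ^+ (2 * n.+1) * dot h h.
Proof.
move=> m0 Dx; rewrite lin_comp_fun//; apply: (le_trans (sqr_sum_le _)).
rewrite /point_const -!mulrA ler_wpM2l ?ler0n// !mulrA dot_blocks mulr_sumr; apply: ler_sum => i _.
have ni : (n - i + i)%N = n by rewrite subnK// -ltnS.
have := nikolskii (n - i) i (size_comp_poly h i) (Delta_coord i Dx).
rewrite ni pint_comp_poly_sqr comp_funE exprMn sqr_sqrtr ?(ltW (f0 i))// -/(f i) => H.
have fle : f i <= n`!%:R ^+ 2.
  rewrite /f expr2; apply: ler_pM; rewrite ?ler0n// ler_nat; apply: leq_fact.
    exact: leq_subr.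
  by rewrite -ltnS.
have s0 : 0 <= sqr_block h i by apply: sumr_ge0 => k _; exact: sqr_ge0.
have mN : (m i <= N)%N by rewrite (bigD1 i)//= leq_addr.
have hN : (m i).+1%:R ^+ (2 * n).+2 <= 2 ^+ (2 * n.+1) * N%:R ^+ (2 * n.+1) :> R.
  rewrite mulnS add2n -exprMn -natrM lerXn2r ?nnegrE ?ler0n// ler_nat mul2n -addnn.
  by have := m0 i; lia.
apply: (le_trans (ler_pM (ltW (f0 i)) (sqr_ge0 _) fle H)).
move: H fle s0 hN; set A := 2 ^+ n.+1 * _; have A0 : 0 <= A.
  by rewrite /A; apply: mulr_ge0; [exact: exprn_ge0|apply: mulr_ge0 => //; apply: exprn_ge0; exact: ler0n].
move=> _ _ s0 hN.
apply: (@le_trans _ _ (n`!%:R ^+ 2 * (A * (2 ^+ (2 * n.+1) * N%:R ^+ (2 * n.+1)) * sqr_block h i))).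
  by apply: ler_wpM2l; [exact: sqr_ge0|apply: ler_wpM2r => //; exact: ler_wpM2l].
by rewrite /A expr2 !mulrA.
Qed.

End model_functions.
End gram_bounds.

Section model_bias_variance.
Context {R : realType} {n : nat}.
Local Notation mu := (@lebesgue_measure R).
Local Notation T := (n.+1.-tuple R).
Local Notation lam := (@lebesgue_tuple R n.+1).
Local Notation Delta := (@simplex R n.+1).
Local Notation I01 := (`[0%R, 1%R]%classic : set R).
Local Notation V := (fine (lam Delta)).

Let int_le := @bint_le _ _ R lam Delta mDelta lamDelta_lty.
Let intZ := @bintZ _ _ R lam Delta mDelta lamDelta_lty.
Let int_sum := @bint_sum _ _ R lam Delta mDelta lamDelta_lty.

Lemma int_phi_sqr (i : 'I_n.+1) k :
  \int[lam]_(x in Delta) @phi R n.+1 i.+1 k (tnth x i) ^+ 2 = 1.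
Proof.
rewrite (@int_simplex_coord R n i (fun t => @phi R n.+1 i.+1 k t ^+ 2)); first last.
- by move=> t _; exact: sqr_ge0.
- by apply: bmfX; exact: bmf_phi.
rewrite -[RHS](_ : (k == k)%:R = 1 :> R); last by rewrite eqxx.
rewrite -(pint_jpoly (n - i) i k k) pintE.
have E (t : R) : 0 <= t <= 1 -> @phi R n.+1 i.+1 k t ^+ 2 * q n.+1 i.+1 t =
    (@jw R (n - i) i * @jpoly R (n - i) i k * @jpoly R (n - i) i k).[t].
  move=> It; rewrite q_jw// phiE exprMn sqr_sqrtr; last by rewrite mulr_ge0.
  rewrite (hornerM (_ * _)) (hornerM (@jw R (n - i) i)); field.
  by rewrite !pnatr_eq0 -!lt0n !fact_gt0.
by apply: eq_Rintegral => t /set_mem; rewrite /= in_itv /=; exact: E.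
Qed.

Lemma int_exp_density (u g : T -> R) :
  \int[lam]_x (g x * exp_density u x) = \int[lam]_(x in Delta) (g x * tilt lam Delta u x).
Proof.
rewrite [RHS]Rintegral_mkcond; apply: eq_Rintegral => x _.
rewrite patchE; case: ifPn => [/set_mem Dx|nDx]; first by rewrite exp_density_tilt.
by rewrite /exp_density indicE (negbTE nDx) !mulr0.
Qed.

(** The basis functions have norm one and [exp_density u] is bounded. *)
Lemma second_moment_le (m : 'I_n.+1 -> nat) (u : T -> R) B : bmf Delta u ->
  (forall x, Delta x -> `|u x| <= B) ->
  \sum_j \int[lam]_x (@phi_vec R n.+1 m x 0 j ^+ 2 * exp_density u x) <=
    expR (2 * B) / V * (\sum_i m i)%:R.
Proof.
move=> bu uB.
apply: (@le_trans _ _ (\sum_(j < \sum_i m i) (expR (2 * B) / V))); last first.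
  by rewrite sumr_const card_ord -[leLHS]mulr_natr.
apply: ler_sum => j _; rewrite int_exp_density.
have bj : bmf Delta (fun x => @phi_vec R n.+1 m x 0 j ^+ 2).
  by apply: bmfX; apply: bmf_Delta; exact: bmf_phi_vec.
apply: (@le_trans _ _ (\int[lam]_(x in Delta) (expR (2 * B) / V * (@phi_vec R n.+1 m x 0 j ^+ 2)))).
  apply: int_le.
  - by apply: bmfM => //; exact: bmf_tilt.
  - by apply: bmfM => //; exact: bmf_cst.
  move=> x Dx; rewrite mulrC ler_wpM2r ?sqr_ge0//.
  have := tilt_bounds mDelta lamDelta_lty lamDelta_gt0 bu uB Dx.
  by case/andP.
rewrite intZ// -[leRHS]mulr1 le_eqVlt; apply/orP; left; apply/eqP; congr (_ * _).
rewrite -(int_phi_sqr (tagnat.sig1 j) (tagnat.sig2 j).+1).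
apply: eq_Rintegral => x /set_mem Dx.
by rewrite phi_vecE /coord_fun indicE mem_set// mulr1.
Qed.

(** On the simplex the squared distance is bounded by one-dimensional ones, whose
    weights are the marginals [q]. *)
Lemma model_approximation (ell : 'I_n.+1 -> R -> R) (r : 'I_n.+1 -> nat) :
  (forall i, measurable_fun I01 (ell i)) ->
  (forall i, exists M : R, forall t : R, 0 <= t <= 1 -> `|ell i t| <= M) ->
  (forall i, \int[mu]_(t in I01) (ell i t * q n.+1 i.+1 t) = 0) ->
  (forall i, (n.+1 < r i)%N) ->
  (forall i : 'I_n.+1, sobolev2 (q n.+1 i.+1) (r i) (ell i)) ->
  exists2 C : R, 0 < C & forall m : 'I_n.+1 -> nat, (forall i, 0 < m i)%N ->
    exists2 th, forall x, Delta x -> `|lin (@phi_vec R n.+1 m) th x| <= C &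
      \int[lam]_(x in Delta) (\sum_i coord_fun i (ell i) x - lin (@phi_vec R n.+1 m) th x) ^+ 2
        <= C * \sum_i (m i)%:R ^- (2 * r i).
Proof.
move=> mell bell ell0 hr sob.
have /choice[C HC] : forall i : 'I_n.+1, exists C : R, exists c : nat -> R,
    (forall m t, 0 <= t <= 1 -> `|\sum_(k < m) c k * @phi R n.+1 i.+1 k.+1 t| <= C) /\
    (forall m, (0 < m)%N -> \int[mu]_(t in I01)
       ((ell i t - \sum_(k < m) c k * @phi R n.+1 i.+1 k.+1 t) ^+ 2 * q n.+1 i.+1 t) <=
       C / m%:R ^+ (2 * r i)).
  by move=> i; exact: sobolev_phi_approx.
have /choice[c Hc] := HC.
have C0 i : 0 <= C i.
  have := (Hc i).1 0%N 0; rewrite lexx ler01 => /(_ isT); exact: le_trans.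
have S0 : 0 <= \sum_i C i by apply: sumr_ge0.
have C1 i : C i <= \sum_i C i by rewrite (bigD1 i)//= lerDl; apply: sumr_ge0.
exists (1 + n.+1%:R * \sum_i C i) => [|m m0].
  by rewrite ltr_pwDl// mulr_ge0.
pose th : 'rV[R]_(\sum_i m i) := \mxrow_i \row_(k < m i) c i k.
have thE i t : comp_fun th i t = \sum_(k < m i) c i k * @phi R n.+1 i.+1 k.+1 t.
  by apply: eq_bigr => k _; rewrite /th mxrowK mxE.
have bl i : bmf I01 (fun t => ell i t - comp_fun th i t).
  apply: bmfB; last exact: bmf_comp_fun.
  split=> //; have [M HM] := bell i; exists M => t; rewrite /= in_itv; exact: HM.
exists th => [x Dx|].
  rewrite lin_comp_fun//; apply: (le_trans (ler_norm_sum _ _ _)).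
  apply: (@le_trans _ _ (\sum_i C i)).
    by apply: ler_sum => i _; rewrite thE; apply: (Hc i).1; exact: Delta_coord.
  by rewrite -[leLHS]add0r lerD// ler_peMl// ler1n.
have bli i : bmf Delta (fun x => (ell i (tnth x i) - comp_fun th i (tnth x i)) ^+ 2).
  by apply: bmfX; apply: (@bmf_tnth R n i _ (bl i)).
apply: (@le_trans _ _ (\int[lam]_(x in Delta) (n.+1%:R *
    \sum_i (ell i (tnth x i) - comp_fun th i (tnth x i)) ^+ 2))).
  apply: int_le.
  - apply: (@eq_bmf _ _ _ _ (fun x => (\sum_i (ell i (tnth x i) - comp_fun th i (tnth x i))) ^+ 2)).
      move=> x Dx; rewrite lin_comp_fun// sumrB; congr ((_ - _) ^+ 2).
      by apply: eq_bigr => i _; rewrite /coord_fun indicE mem_set// mulr1.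
    by apply: bmfX; apply: bmf_sum => i; apply: (@bmf_tnth R n i _ (bl i)).
  - by apply: bmfM; [exact: bmf_cst|exact: bmf_sum].
  move=> x Dx; rewrite lin_comp_fun//.
  have -> : \sum_i coord_fun i (ell i) x - \sum_i comp_fun th i (tnth x i) =
      \sum_i (ell i (tnth x i) - comp_fun th i (tnth x i)).
    rewrite sumrB; congr (_ - _).
    by apply: eq_bigr => i _; rewrite /coord_fun indicE mem_set// mulr1.
  exact: sqr_sum_le.
rewrite intZ; last exact: bmf_sum.
rewrite (@int_sum _ _ (fun (i : 'I_n.+1) x => (ell i (tnth x i) - comp_fun th i (tnth x i)) ^+ 2) bli).
have s0 : 0 <= \sum_i (m i)%:R ^- (2 * r i) :> R.
  by apply: sumr_ge0 => i _; rewrite invr_ge0 exprn_ge0.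
apply: (@le_trans _ _ (n.+1%:R * (\sum_i C i) * \sum_i (m i)%:R ^- (2 * r i))); last first.
  by apply: ler_wpM2r => //; rewrite lerDr.
rewrite -mulrA; apply: ler_wpM2l => //; rewrite mulr_sumr; apply: ler_sum => i _.
rewrite (@int_simplex_coord R n i (fun t => (ell i t - comp_fun th i t) ^+ 2)); first last.
- by move=> t _; exact: sqr_ge0.
- by apply: bmfX; exact: bl.
apply: (@le_trans _ _ (C i / (m i)%:R ^+ (2 * r i))); last first.
  by apply: ler_wpM2r => //; rewrite invr_ge0 exprn_ge0.
apply: le_trans ((Hc i).2 (m i) (m0 i)); rewrite le_eqVlt; apply/orP; left; apply/eqP.
by apply: eq_Rintegral => t _; rewrite thE.
Qed.

End model_bias_variance.

(** * Measurability of the divergence of the estimator *)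

Section econt_closure.
Context (R : realType) (N : nat).
Implicit Types f g : 'rV[R]_N -> R.

Lemma econt_cst (c : R) : @econt R N (fun=> c).
Proof. by apply: (@econt_lip _ _ _ 0) => // a b; rewrite subrr normr0 mul0r. Qed.

Lemma econtD f g : econt f -> econt g -> econt (fun x => f x + g x).
Proof.
move=> cf cg; have := econtB cf (econtB (econt_cst 0) cg).
by congr econt; apply/funext => x; rewrite sub0r opprK.
Qed.

Lemma econt_norm f : econt f -> econt (fun x => `|f x|).
Proof.
move=> cf a e e0; have [de de0 H] := cf a e e0; exists de => // b /H.
exact/le_trans/ler_dist_dist.
Qed.

Lemma econt_sum (J : Type) (s : seq J) (F : J -> 'rV[R]_N -> R) :
  (forall j, econt (F j)) -> econt (fun x => \sum_(j <- s) F j x).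
Proof.
move=> cF; elim: s => [|j s IH].
  by have := econt_cst 0; congr econt; apply/funext => x; rewrite big_nil.
have := econtD (cF j) IH; congr econt; apply/funext => x; by rewrite big_cons.
Qed.

Lemma rat_dense_rV (a : 'rV[R]_N) (e : R) : 0 < e ->
  exists p : 'rV[rat]_N, `|a - map_mx ratr p| <= e.
Proof.
move=> e0; have /choice[p Hp] : forall j, exists p : rat, `|a 0 j - ratr p| <= e.
  move=> j; have [|p] := @rat_in_itvoo R (a 0 j) (a 0 j + e); first by rewrite ltrDl.
  rewrite in_itv /= => /andP[p1 p2]; exists p.
  by rewrite ler_distlC; apply/andP; split; lra.
exists (\row_j p j); apply: row_norm_le => [|j]; first exact: ltW.
by rewrite !mxE.
Qed.

(** By compactness of closed balls, a nonnegative continuous function that is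
    small at points with rational coordinates of a ball vanishes somewhere. *)
Lemma vanish_rat (f : 'rV[R]_N -> R) : econt f -> (forall a, 0 <= f a) ->
  ((exists a, f a = 0) <->
   exists M : nat, forall j : nat, exists p : 'rV[rat]_N,
     `|map_mx ratr p : 'rV[R]_N| <= M%:R /\ f (map_mx ratr p) <= j.+1%:R^-1).
Proof.
move=> cf f0; split=> [[a a0]|[M HM]].
  have [M /ltW HM] : exists M : nat, `|a| + 1 < M%:R.
    by exists (Num.truncn (`|a| + 1)).+1; rewrite truncnS_gt.
  exists M => j; have j0 : 0 < j.+1%:R^-1 :> R by rewrite invr_gt0.
  have [de de0 H] := cf a _ j0.
  have m0 : 0 < Num.min de 1 by rewrite lt_min de0 ltr01.
  have [p Hp] := rat_dense_rV a m0.
  move: Hp; rewrite le_min => /andP[pd p1]; exists p; split.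
    rewrite -[map_mx _ _](subrK a) (le_trans (ler_normD _ _))// addrC distrC.
    by apply: le_trans HM; rewrite lerD2l.
  by have := H _ pd; rewrite a0 sub0r normrN ger0_norm.
pose K := [set a : 'rV[R]_N | `|a| <= M%:R].
have cnorm : econt (fun a : 'rV[R]_N => `|a|).
  by apply: (@econt_lip _ _ _ 1) => // a b; rewrite mul1r ler_dist_dist.
have cK : compact K.
  apply: bounded_closed_compact; last first.
    have /continuous_closedP := econt_continuous cnorm.
    by move=> H; exact: (H _ (@closed_le _ M%:R)).
  exists M%:R; split; first exact: num_real.
  by move=> y hy a /= Ka; apply: le_trans (ltW hy).
have K0 : K !=set0 by exists 0; rewrite /K /= normr0.
have [a /set_mem Ka Ha] := EVT_min_rV K0 cK (continuous_subspaceT (econt_continuous cf)).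
exists a; apply/eqP; rewrite eq_le f0 andbT; apply/ler_addgt0Pr => e e0; rewrite add0r.
have [j je] : exists j : nat, e^-1 < j.+1%:R.
  by exists (Num.truncn e^-1); rewrite truncnS_gt.
have [p [pM pj]] := HM j; apply: (le_trans (Ha _ (mem_set (pM : K _)))).
by apply: (le_trans pj); rewrite -[leRHS]invrK lef_pV2 ?posrE ?invr_gt0// ltW.
Qed.

End econt_closure.

Section measurable_selection.
Context d (Om : measurableType d) (R : realType) (N N' : nat).
Variables (A : 'rV[R]_N -> 'rV[R]_N') (k : 'rV[R]_N -> R) (V : Om -> 'rV[R]_N').
Hypotheses (cA : forall j, econt (fun th => A th 0 j)) (ck : econt k).
Hypothesis mV : forall j, measurable_fun [set: Om] (fun o => V o 0 j).

(** Solving the equation with a bound on [k] amounts to finding a zero of a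
    nonnegative continuous function; [vanish_rat] reduces this to countably many
    conditions. *)
Lemma measurable_solvable_le (c : R) :
  measurable [set o | exists th, A th = V o /\ k th <= c].
Proof.
pose f o th := \sum_j `|A th 0 j - V o 0 j| + (`|k th - c| + (k th - c)).
have f0 o th : 0 <= f o th.
  rewrite addr_ge0//; first exact: sumr_ge0.
  by rewrite -lerBlDr sub0r -normrN ler_norm.
have cf o : econt (f o).
  apply: econtD.
    by apply: econt_sum => j; apply: econt_norm; apply: econtB => //; exact: econt_cst.
  have ckc : econt (fun th => k th - c) by apply: econtB => //; exact: econt_cst.
  by apply: econtD => //; exact: econt_norm.
have fE o : (exists th, A th = V o /\ k th <= c) <-> exists th, f o th = 0.
  split=> -[th].
    move=> [Ath kc]; exists th; rewrite /f big1 ?add0r; last by move=> j _; rewrite Ath subrr normr0.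
    by rewrite ler0_norm ?addNr// subr_le0.
  move=> /eqP; rewrite paddr_eq0; [|exact: sumr_ge0|]; last first.
    by rewrite -lerBlDr sub0r -normrN ler_norm.
  move=> /andP[/eqP s0 /eqP n0]; exists th; split.
    apply/rowP => j; apply/eqP; rewrite -subr_eq0 -normr_eq0; apply/eqP.
    by apply: (psumr_eq0P _ s0) => // i _; exact: normr_ge0.
  by rewrite -subr_le0 -oppr_ge0 -(addr0_eq n0).
rewrite (_ : [set o | _] = \bigcup_(M : nat) \bigcap_(j : nat) \bigcup_(p : 'rV[rat]_N)
    [set o | `|map_mx ratr p : 'rV[R]_N| <= M%:R /\ f o (map_mx ratr p) <= j.+1%:R^-1]); last first.
  apply/seteqP; split=> o.
    move=> /fE /(vanish_rat (cf o) (f0 o))[M HM]; exists M => // j _.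
    by have [p pP] := HM j; exists p.
  move=> [M _ HM]; apply/fE; apply/(vanish_rat (cf o) (f0 o)); exists M => j.
  by have [p _ pP] := HM j I; exists p.
apply: bigcup_measurable => M _; apply: bigcap_measurable => [|j _]; first by exists 0%N.
apply: countable_bigcupT_measurable => [|p]; first exact: countableP.
have [pM|pM] := boolP (`|map_mx ratr p : 'rV[R]_N| <= M%:R); last first.
  by rewrite (_ : [set o | _] = set0)//; apply/seteqP; split=> // o [].
rewrite (_ : [set o | _] = [set o | f o (map_mx ratr p) <= j.+1%:R^-1]); last first.
  by apply/seteqP; split=> o //= [].
apply: measurable_le_set => //; apply: measurable_funD => //.
apply: measurable_sum => i; apply: measurableT_comp => //.
exact: measurable_funB.
Qed.

(** The value of [k] does not depend on the solution, so it is at most [c] if and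
    only if some solution satisfies this bound. *)
Lemma measurable_solution_value (th0 : 'rV[R]_N) :
  (forall a b, A a = A b -> k a = k b) ->
  measurable_fun [set: Om] (fun o => k (xget th0 [set th | A th = V o])).
Proof.
move=> kA; apply: (measurability _ (RGenOInfty.measurableE R)) => _ [_ [c ->] <-].
rewrite setTI; pose S (x : R) := [set o | exists th, A th = V o /\ k th <= x].
have sol o th : A th = V o -> A (xget th0 [set th | A th = V o]) = V o.
  by move=> Ath; exact: (@xgetPex _ th0 [set th | A th = V o] (ex_intro _ th Ath)).
have mE : measurable [set o | exists th, A th = V o].
  rewrite (_ : [set o | _] = \bigcup_(n : nat) S n%:R).
    by apply: bigcup_measurable => n _; exact: measurable_solvable_le.
  apply/seteqP; split=> o /= [th].
    move=> Ath; exists (Num.truncn (k th)).+1 => //; exists th; split=> //.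
    by rewrite ltW// truncnS_gt.
  by move=> _ [b [Ab _]]; exists b.
rewrite -[X in measurable X]setCK; apply: measurableC.
rewrite (_ : ~` _ = S c `|` ((~` [set o | exists th, A th = V o]) `&` [set o | k th0 <= c])).
  apply: measurableU; first exact: measurable_solvable_le.
  by apply: measurableI; [exact: measurableC|apply: measurable_le_set].
apply/seteqP; split=> o /=.
  rewrite /preimage /= in_itv /= andbT => /negP; rewrite -leNgt => H.
  have [[th Ath]|nth] := pselect (exists th, A th = V o).
    left; exists (xget th0 [set th | A th = V o]); split=> //.
    exact: sol Ath.
  by right; split=> //; move: H; rewrite xgetPN// => b Ab; apply: nth; exists b.
rewrite /preimage /= in_itv /= andbT => H; apply/negP; rewrite -leNgt; case: H.
  move=> [th [Ath kc]]; rewrite (kA _ th)//.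
  by rewrite Ath; exact: sol Ath.
by move=> [nth kc]; rewrite xgetPN// => b Ab; apply: nth; exists b.
Qed.

End measurable_selection.

(** * Stochastic order of magnitude *)

Section tail_asymptotics.
Context d (Om : measurableType d) (R : realType) (P : probability Om R).
Implicit Types Y : Om -> R.

Lemma measurable_tail Y (C : R) : measurable_fun [set: Om] Y ->
  measurable [set o | C < `|Y o|].
Proof.
move=> mY; rewrite (_ : [set o | _] = ~` [set o | `|Y o| <= C]).
  by apply: measurableC; apply: measurable_le_set => //; exact: measurableT_comp.
by apply/seteqP; split=> o /=; [move=> h /(lt_le_trans h); rewrite ltxx|move=> /negP; rewrite -ltNge].
Qed.

Lemma le_tail Y (C C' : R) : measurable_fun [set: Om] Y -> C <= C' ->
  (P [set o | (C' < `|Y o|)%R] <= P [set o | (C < `|Y o|)%R])%E.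
Proof.
move=> mY CC; apply: le_measure; rewrite ?inE; [exact: measurable_tail|exact: measurable_tail|].
by move=> o /=; exact: le_lt_trans.
Qed.

Lemma tight Y (e : R) : measurable_fun [set: Om] Y -> 0 < e ->
  exists C : R, (P [set o | (C < `|Y o|)%R] < e%:E)%E.
Proof.
move=> mY e0; pose F (j : nat) := [set o | j%:R < `|Y o|].
have F0 : \bigcap_j F j = set0.
  apply/seteqP; split=> // o Fo; have := Fo (Num.truncn `|Y o|).+1 I.
  by rewrite /F /= ltNge ltW// truncnS_gt.
have mF j : measurable (F j) by exact: measurable_tail.
have := @nonincreasing_cvg_mu _ _ _ P F; rewrite F0 measure0.
move=> /(_ _ mF measurable0) H.
have {}H : P \o F @ \oo --> 0%E.
  apply: H; first by rewrite (le_lt_trans (probability_le1 _ _))// ltry.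
  apply/nonincreasing_seqP => j; apply/subsetPset => o /=; rewrite /F /=.
  by apply: le_lt_trans; rewrite ler_nat.
move/fine_cvgP : H => [_ H]; have [j _ /(_ j (leqnn j)) /= Hj] := cvgr_lt _ H e e0.
by exists j%:R; rewrite -lte_fin fineK// in Hj; exact: fin_num_measure.
Qed.

Lemma tail_div Y (a C : R) : 0 < a ->
  [set o | (C%:E < `|(Y o)%:E / a%:E|)%E] = [set o | C * a < `|Y o|].
Proof.
move=> a0; apply/seteqP; split=> o /=;
  by rewrite inver gt_eqF// -EFinM abse_EFin lte_fin normrM normfV (gtr0_norm a0) ltr_pdivlMr.
Qed.

(** A bound for large [k] is enough: each of the finitely many other terms is
    tight. *)
Lemma bigO_tail (Y : nat -> Om -> R) (a : nat -> R) :
  (forall k, measurable_fun [set: Om] (Y k)) -> (forall k, (0 < k)%N -> 0 < a k) ->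
  (forall e : R, 0 < e -> exists C k0, forall k, (0 < k)%N -> (k0 <= k)%N ->
    (P [set o | (C * a k < `|Y k o|)%R] < e%:E)%E) ->
  bigO_P P (fun k o => (Y k o)%:E) a.
Proof.
move=> mY a0 H e e0; have [C [k0 HC]] := H e e0.
have /choice[c Hc] : forall k, exists c : R, (P [set o | (c < `|Y k o|)%R] < e%:E)%E.
  by move=> k; exact: tight.
have S0 : 0 <= \sum_(k < k0) `|c k / a k| by apply: sumr_ge0.
exists (1 + `|C| + \sum_(k < k0) `|c k / a k|) => [|k k1].
  by rewrite ltr_wpDr// ltr_wpDr.
have ak := a0 k k1.
rewrite tail_div//; have [kk|kk] := leqP k0 k.
  apply: (le_lt_trans _ (HC k k1 kk)); apply: le_tail => //; apply: ler_wpM2r; first exact: ltW.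
  by rewrite (le_trans (ler_norm C))// addrAC lerDr addr_ge0.
apply: (le_lt_trans _ (Hc k)); apply: le_tail => //.
rewrite -ler_pdivrMr// (le_trans (ler_norm _))// (bigD1 (Ordinal kk))//=.
by rewrite addrCA lerDl !addr_ge0//; apply: sumr_ge0.
Qed.

Lemma cvg_in_probability_bigO (Y : nat -> Om -> R) (a : nat -> R) :
  (forall k, measurable_fun [set: Om] (Y k)) -> (forall k, (0 < k)%N -> 0 < a k) ->
  a k @[k --> \oo] --> (0 : R) ->
  bigO_P P (fun k o => (Y k o)%:E) a -> cvg_in_probability0 P (fun k o => (Y k o)%:E).
Proof.
move=> mY a0 acvg bY e e0.
have EE k : [set o | (e%:E < `|(Y k o)%:E|)%E] = [set o | e < `|Y k o|].
  by apply/seteqP; split=> o /=; rewrite lte_fin.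
have fP k : P [set o | (e%:E < `|(Y k o)%:E|)%E] \is a fin_num.
  by apply: fin_num_measure; rewrite EE; exact: measurable_tail.
apply/fine_cvgP; split.
  exact: nearW.
apply/cvgrPdist_lt => h h0; have [C C0 HC] := bY h h0.
near=> k; have k1 : (0 < k)%N by near: k; exact: nbhs_infty_gt.
have ak : a k < e / C.
  near: k; have := cvgr_lt _ acvg (e / C); apply; exact: divr_gt0.
rewrite sub0r normrN ger0_norm ?fine_ge0//.
rewrite -lte_fin /= fineK ?EE; last by rewrite -EE; exact: fP.
have := HC k k1; rewrite tail_div ?a0//; apply: le_lt_trans.
by apply: le_tail => //; rewrite mulrC -ler_pdivlMr// ltW.
Unshelve. all: by end_near. Qed.

End tail_asymptotics.

(** * Risk of the maximum likelihood estimator *)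
Lemma pairwise_independent (R : realType) d d' (Om : measurableType d) (E : measurableType d')
    (P : probability Om R) (X : nat -> {RV P >-> E}) : mutually_independent P X ->
  forall i j, i != j -> forall A B, measurable A -> measurable B ->
  P (X i @^-1` A `&` X j @^-1` B) = (P (X i @^-1` A) * P (X j @^-1` B))%E.
Proof.
move=> ind i j ij A B mA mB.
have := ind [:: i; j] (fun k => if k == i then A else B); rewrite /= inE ij.
move=> /(_ isT) H; have {}H := H (fun k => _); move: H.
rewrite big_cons big_seq1 eqxx eq_sym (negbTE ij).
move=> <- => [|k]; last by case: ifP.
congr (P _); apply/seteqP; split=> o /=.
  by move=> [Ao Bo] k /=; rewrite !inE => /orP[/eqP->|/eqP->]; rewrite /preimage/= ?eqxx// eq_sym (negbTE ij).
move=> H; split.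
  by have := H i; rewrite /preimage /= eqxx; apply; rewrite /= inE eqxx.
by have := H j; rewrite /preimage /= eq_sym (negbTE ij); apply; rewrite /= !inE eqxx orbT.
Qed.

Section mle_risk.
Context {R : realType} {n : nat}.
Local Notation mu := (@lebesgue_measure R).
Local Notation T := (n.+1.-tuple R).
Local Notation lam := (@lebesgue_tuple R n.+1).
Local Notation Delta := (@simplex R n.+1).
Local Notation V := (fine (lam Delta)).
Context {disp : measure_display} {Omega : measurableType disp} (P : probability Omega R).
Variables (X : nat -> {RV P >-> T}) (u : T -> R) (B : R).
Hypotheses (bu : bmf Delta u) (uB : forall x, Delta x -> `|u x| <= B).

Definition mle_risk m (th0 : 'rV[R]_(\sum_(i < n.+1) m i)) k (o : Omega) : R :=
  rKL lam Delta u (lin (@phi_vec R n.+1 m) (Theta th0 (mu_hat m k (fun j => X j o)))).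

Lemma KL_f_hat m (th0 : 'rV[R]_(\sum_(i < n.+1) m i)) k o :
  KL (exp_density u) (f_hat th0 k (fun j => X j o)) = (mle_risk th0 k o)%:E.
Proof.
rewrite /f_hat /f_model /mle_risk; set th := Theta _ _.
have -> : log_model th = lin (@phi_vec R n.+1 m) th.
  by apply/funext => x; rewrite lin_phi_vec.
apply: KL_rKL => //; apply: bmf_lin => j; apply: bmf_Delta; exact: bmf_phi_vec.
Qed.

Lemma bmf_phi_vec_Delta m j : bmf Delta (fun x => @phi_vec R n.+1 m x 0 j).
Proof. by apply: bmf_Delta; exact: bmf_phi_vec. Qed.

Lemma bmf_lin_phi_vec m th : bmf Delta (lin (@phi_vec R n.+1 m) th).
Proof. by apply: bmf_lin => j; exact: bmf_phi_vec_Delta. Qed.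

Lemma measurable_phi_vec_sum m k j :
  measurable_fun [set: Omega] (fun o => k%:R^-1 * (\sum_(l < k) @phi_vec R n.+1 m (X l o) 0 j)).
Proof.
apply: measurable_funM => //; apply: measurable_sum => l.
by apply: (measurableT_comp (bmf_phi_vec j).1).
Qed.

Lemma mu_hatE m k (o : Omega) j : @mu_hat R n.+1 m k (fun j => X j o) 0 j =
  k%:R^-1 * (\sum_(l < k) @phi_vec R n.+1 m (X l o) 0 j).
Proof. by rewrite /mu_hat mxE summxE. Qed.

Lemma measurable_mle_risk m (th0 : 'rV[R]_(\sum_(i < n.+1) m i)) k :
  measurable_fun [set: Omega] (mle_risk th0 k).
Proof.
apply: (@measurable_solution_value _ _ _ _ _ (@A_map R n.+1 m)
  (fun th => rKL lam Delta u (lin (@phi_vec R n.+1 m) th))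
  (fun o => mu_hat m k (fun j => X j o))).
- move=> j; have := @econt_mean_map _ _ _ _ _ mDelta lamDelta_lty lamDelta_gt0 _ _ (@bmf_phi_vec_Delta m) j.
  by congr econt; apply/funext => th; rewrite A_map_mean_map.
- exact: (econt_rKL_lin mDelta lamDelta_lty lamDelta_gt0 (@bmf_phi_vec_Delta m) bu).
- move=> j; rewrite (_ : (fun o => _) = fun o =>
    k%:R^-1 * (\sum_(l < k) @phi_vec R n.+1 m (X l o) 0 j)).
    exact: measurable_phi_vec_sum.
  by apply/funext => o; rewrite mu_hatE.
move=> a b; rewrite !A_map_mean_map.
exact: (rKL_mean_map mDelta lamDelta_lty lamDelta_gt0 (@bmf_phi_vec_Delta m) bu).
Qed.

Lemma mle_risk_ge0 m (th0 : 'rV[R]_(\sum_(i < n.+1) m i)) k o : 0 <= mle_risk th0 k o.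
Proof. by apply: (rKL_ge0 mDelta lamDelta_lty lamDelta_gt0) => //; exact: bmf_lin_phi_vec. Qed.

Definition risk_const : R := mle_constant V B (2 * n.+1%:R / V) n.+1%:R.

Hypothesis mf0 : measurable_fun setT (exp_density u).
Hypothesis f00 : forall x, 0 <= exp_density u x.
Hypothesis XE : forall j A, measurable A ->
  P (X j @^-1` A) = (\int[lam]_(x in A) (exp_density u x)%:E)%E.
Hypothesis Xind : mutually_independent P X.

Let G0 : 0 < 2 * n.+1%:R / V :> R.
Proof. by rewrite divr_gt0 ?V_gt0// mulr_gt0. Qed.

Lemma risk_const_gt0 : 0 < risk_const.
Proof.
have [] := @mle_near _ _ _ lam Delta mDelta lamDelta_lty lamDelta_gt0 _ _
  (@bmf_phi_vec_Delta (fun=> 1%N)) B _ n.+1%:R G0 (ltr0Sn _ _).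
by [].
Qed.

(** By [mle_near] the risk is large only when the empirical means are far from
    their expectations. *)
Lemma mle_risk_tail m (th0 th : 'rV[R]_(\sum_(i < n.+1) m i)) k (c e : R) :
  (0 < k)%N -> (forall i, 0 < m i)%N -> 0 < c ->
  (forall x, Delta x -> `|lin (@phi_vec R n.+1 m) th x| <= B) ->
  \int[lam]_(x in Delta) (u x - lin (@phi_vec R n.+1 m) th x) ^+ 2 <= e ->
  risk_const * (@point_const R n * (\sum_i m i)%:R ^+ (2 * n.+1)) * (c + e) <= 1 ->
  (P [set o | (risk_const * (c + e) < `|mle_risk th0 k o|)%R] <=
    (expR (2 * B) / V * (\sum_i m i)%:R / k%:R / c)%:E)%E.
Proof.
move=> k0 m0 c0 thB the small.
have Xind2 := pairwise_independent Xind.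
have H := empirical_mean_deviation mf0 f00 XE Xind2 (@bmf_phi_vec R n m) k0 c0.
pose mean j := \int[lam]_x (@phi_vec R n.+1 m x 0 j * exp_density u x).
apply: (le_trans _ (le_trans H _)); last first.
  rewrite lee_fin ler_wpM2r ?invr_ge0 ?(ltW c0)// ler_wpM2r ?invr_ge0 ?ler0n//.
  exact: second_moment_le.
apply: le_measure; rewrite ?inE.
- by apply: measurable_tail; exact: measurable_mle_risk.
- apply: measurable_le_set => //; apply: measurable_sum => j; apply: measurable_funX.
  by apply: measurable_funB => //; exact: measurable_phi_vec_sum.
move=> o /= big; rewrite leNgt; apply/negP => far; move: big; apply/negP; rewrite -leNgt.
rewrite ger0_norm ?mle_risk_ge0//.
pose v := @mu_hat R n.+1 m k (fun j => X j o).
pose mu0 : 'rV[R]_(\sum_i m i) := \row_j \int[lam]_(x in Delta) (@phi_vec R n.+1 m x 0 j * tilt lam Delta u x).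
have [_ near] := @mle_near _ _ _ lam Delta mDelta lamDelta_lty lamDelta_gt0 _ _
  (@bmf_phi_vec_Delta m) B _ n.+1%:R G0 (ltr0Sn _ _).
have vc : dot (v - mu0) (v - mu0) <= c.
  apply: le_trans (ltW far); rewrite /dot le_eqVlt; apply/orP; left; apply/eqP.
  apply: eq_bigr => j _; rewrite [(v - mu0) 0 j]mxE [(- mu0) 0 j]mxE [mu0 0 j]mxE.
  by rewrite {1 2}/v mu_hatE -int_exp_density expr2.
have k2 : 0 <= @point_const R n * (\sum_i m i)%:R ^+ (2 * n.+1).
  by rewrite !mulr_ge0 ?exprn_ge0.
have [[th1 th1v] H2] := near u th v _ c e bu uB thB (@gram_lower R n m) (@gram_upper R n m)
  (fun h x => @lin_sqr_le R n m h x m0) the vc c0 k2 small.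
apply: H2; rewrite -A_map_mean_map.
apply: (@xgetPex _ th0 [set th | A_map th = v]); exists th1.
by rewrite /= A_map_mean_map.
Qed.

End mle_risk.

Theorem theorem3p3 (R : realType) (disp : measure_display)
    (Omega : measurableType disp) (P : probability Omega R)
    (d : nat) (hd : (2 <= d)%N)
    (ell : 'I_d -> R -> R)
    (hell_meas : forall i, measurable_fun (`[0, 1]%classic : set R) (ell i))
    (hell_bounded : forall i, exists M : R,
       forall t : R, 0 <= t <= 1 -> `|ell i t| <= M)
    (hell_mean : forall i, \int[@lebesgue_measure R]_(t in `[0, 1]%classic)
       (ell i t * q d i.+1 t) = 0)
    (f0 : d.-tuple R -> R) (hf0 : pdensity f0)
    (hf0_prod : forall x,
       f0 x = exp_density (fun y => \sum_(i < d) coord_fun i (ell i) y) x)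
    (r : 'I_d -> nat) (hr : forall i, (d < r i)%N)
    (hell_sobolev : forall i : 'I_d, sobolev2 (q d i.+1) (r i) (ell i))
    (X : nat -> {RV P >-> d.-tuple R})
    (hX_indep : mutually_independent P X)
    (hX_density : forall j (B : set (d.-tuple R)), measurable B ->
       P (X j @^-1` B) = (\int[lebesgue_tuple d]_(x in B) (f0 x)%:E)%E)
    (m : nat -> 'I_d -> nat)
    (hm_pos : forall n i, (0 < n)%N -> (0 < m n i)%N)
    (hm_infty : forall i, m n i @[n --> \oo] --> \oo)
    (hm_bias : (\sum_i m n i)%:R ^+ (2 * d) *
         (\sum_i (m n i)%:R ^- (2 * r i)) @[n --> \oo] --> (0 : R))
    (hm_var : (\sum_i m n i)%:R ^+ (2 * d + 1) / n%:R @[n --> \oo] --> (0 : R))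
    (theta0 : forall n, 'rV[R]_(\sum_i m n i)) :
  let D n o := KL f0 (f_hat (theta0 n) n (fun j => X j o)) in
  cvg_in_probability0 P D /\
  bigO_P P D (fun n => \sum_i (m n i)%:R ^- (2 * r i) +
                       (\sum_i m n i)%:R / n%:R).
Proof.
case: d hd ell hell_meas hell_bounded hell_mean f0 hf0 hf0_prod r hr hell_sobolev
  X hX_indep hX_density m hm_pos hm_infty hm_bias hm_var theta0 => [//|n] _.
move=> ell mell bell ell0 f0 hf0 f0E r hr sob X Xind XE m m0 _ bias var th0 D.
pose u : n.+1.-tuple R -> R := fun y => \sum_(i < n.+1) coord_fun i (ell i) y.
have {f0E}f0E : f0 = exp_density u by apply/funext.
subst f0; case: hf0 => mf0 f00 _ _.
have bell' i : bmf (`[0, 1]%classic : set R) (ell i).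
  by split=> //; have [M HM] := bell i; exists M => t; rewrite /= in_itv; exact: HM.
have bu : bmf (@simplex R n.+1) u.
  by apply: bmf_sum => i; apply: bmf_Delta; exact: bmf_coord_fun.
have [C C0 approx] := model_approximation mell bell ell0 hr sob.
have [_ [M uM]] := bu.
pose B := `|M| + C.
have uB x : simplex x -> `|u x| <= B.
  by move=> Dx; rewrite (le_trans (uM x Dx))// (le_trans (ler_norm M))// lerDl ltW.
pose N k : R := (\sum_i m k i)%:R.
pose beta k : R := \sum_i (m k i)%:R ^- (2 * r i).
pose a k : R := beta k + N k / k%:R.
pose Y k o := mle_risk X u (th0 k) k o.
have DE : D = fun k o => (Y k o)%:E.
  by apply/funext => k; apply/funext => o; exact: KL_f_hat.
rewrite {}DE.
have mY k : measurable_fun [set: Omega] (Y k) by exact: measurable_mle_risk.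
have beta0 k : 0 <= beta k by apply: sumr_ge0 => i _; rewrite invr_ge0 exprn_ge0.
have N1 k : (0 < k)%N -> 1 <= N k.
  by move=> k0; rewrite ler1n (bigD1 ord0)//= addn_gt0 m0.
have Nk k : (0 < k)%N -> 0 < N k / k%:R.
  by move=> k0; apply: divr_gt0; [exact: (lt_le_trans ltr01 (N1 k k0))|rewrite ltr0n].
have a0 k : (0 < k)%N -> 0 < a k.
  by move=> k0; rewrite ltr_wpDl// Nk.
have acvg : a k @[k --> \oo] --> (0 : R).
  pose g k : R := N k ^+ (2 * n.+1) * beta k + N k ^+ (2 * n.+1 + 1) / k%:R.
  have gcvg : g k @[k --> \oo] --> (0 : R).
    by have H := cvgD bias var; rewrite addr0 in H; exact: H.
  apply: (@squeeze_cvgr _ _ _ _ (fun=> 0) g) => //; last exact: cvg_cst.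
  near=> k; have k0 : (0 < k)%N by near: k; exact: nbhs_infty_gt.
  rewrite (ltW (a0 k k0))/= /a /g lerD//.
    by rewrite ler_peMl// exprn_ege1// N1.
  by rewrite ler_wpM2r ?invr_ge0 ?ler0n// addn1 exprS ler_peMr ?exprn_ege1 ?N1.
have K0 : 0 < @risk_const R n B by exact: risk_const_gt0.
set K := @risk_const R n B in K0.
suff bO : bigO_P P (fun k o => (Y k o)%:E) a.
  by split; [exact: (cvg_in_probability_bigO mY a0 acvg bO)|exact: bO].
apply: bigO_tail => // e e0.
pose U := expR (2 * B) / fine (lebesgue_tuple n.+1 (@simplex R n.+1)).
have U0 : 0 < U by rewrite divr_gt0 ?expR_gt0 ?V_gt0.
(* Markov's bound for a noise of [C'] times its order of magnitude is [e / 2]. *)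
pose C' := 2 * U / e.
have C'0 : 0 < C' by rewrite divr_gt0// mulr_gt0.
(* the smallness condition of [mle_risk_tail], under which the log-densities of
   the model stay bounded *)
have small : \forall k \near \oo, K * (@point_const R n * N k ^+ (2 * n.+1)) *
    (C' * (N k / k%:R) + C * beta k) <= 1.
  pose p := @point_const R n.
  have /cvgr_lt : K * p * C' * (N k ^+ (2 * n.+1 + 1) / k%:R) +
     K * p * C * (N k ^+ (2 * n.+1) * beta k) @[k --> \oo] --> (0 : R).
    have H := cvgD (cvgM (cvg_cst (K * p * C')) var) (cvgM (cvg_cst (K * p * C)) bias).
    by rewrite !mulr0 addr0 in H; exact: H.
  move=> /(_ 1 ltr01); apply: filterS => k /ltW.
  by apply: le_trans; rewrite le_eqVlt; apply/orP; left; apply/eqP; rewrite addn1 exprS /p; ring.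
have [k1 _ Hk1] := small.
exists (K * Num.max C' C), k1 => k k0 kk1.
have [th thC the] := approx (m k) (fun i => m0 k i k0).
have thB x : simplex x -> `|lin (@phi_vec R n.+1 (m k)) th x| <= B.
  by move=> Dx; rewrite (le_trans (thC x Dx))// lerDr.
have cpos : 0 < C' * (N k / k%:R) by rewrite mulr_gt0 ?Nk.
have tail := mle_risk_tail bu uB mf0 f00 XE Xind (th0 k) k0 (fun i => m0 k i k0) cpos thB the (Hk1 k kk1).
apply: (@le_lt_trans _ _ (e / 2)%:E); last by rewrite lte_fin; lra.
apply: le_trans (le_trans tail _).
  apply: le_tail; first exact: mY.
  rewrite -mulrA; apply: ler_wpM2l; first exact: ltW.
  rewrite /a mulrDr addrC lerD//; apply: ler_wpM2r.
  - exact: beta0.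
  - by rewrite le_max lexx orbT.
  - exact: ltW (Nk k k0).
  by rewrite le_max lexx.
rewrite lee_fin le_eqVlt; apply/orP; left; apply/eqP.
rewrite -/(N k) -/U /C'; have := N1 k k0; have : 0 < k%:R :> R by rewrite ltr0n.
move: (N k) => Nk' kp N1'; field.
by rewrite !gt_eqF// (lt_le_trans ltr01).
Unshelve. all: by end_near. Qed.
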